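(* There exist a simply-connected compact flat manifold $M_1$ with mixed boundary conditions (both the Dirichlet part and the Neumann part of the boundary being nonempty) and a connected compact flat manifold $M_2$ with pure Dirichlet boundary conditions that are isospectral. In particular, the number of Neumann boundary components is not spectrally determined, and orbifolds can be Dirichlet isospectral to manifolds: there exist a compact flat Riemannian orbifold with boundary, with nonempty singular set, and a compact flat Riemannian manifold with boundary that are Dirichlet isospectral.
   Context: Let $M$ be a compact flat Riemannian manifold with piecewise smooth boundary and disjoint smooth open subsets $\partial_DM,\partial_NM\subseteq\partial M$ with $\partial M=\overline{\partial_DM\cup\partial_NM}$. The spectrum of $M$ (with these boundary conditions) is the sequence of eigenvalues $\lambda$, with multiplicities, of $\Delta\varphi=\lambda\varphi$ on the interior $M^\circ$, $\varphi=0$ on $\partial_DM$, $\partial\varphi/\partial n=0$ on $\partial_NM$, with $\varphi\in C(M)\cap C^\infty(M^\circ\cup\partial_DM\cup\partial_NM)$ and $\Delta=-\operatorname{div}\nabla$. Pure Dirichlet means $\partial_NM=\varnothing$. Manifolds with given boundary conditions are isospectral if their spectra coincide. Simply-connected includes connected. Neumann boundary components are the connected components of the closure of $\partial_NM$. The Dirichlet spectrum of an orbifold of the form $\widetilde M/\iota$, with $\widetilde M$ a compact flat manifold with boundary and $\iota$ an isometric involution of $\widetilde M$, is the sequence of eigenvalues, with multiplicities, of $\Delta$ on $\iota$-invariant functions on $\widetilde M$ vanishing on $\partial\widetilde M$. *)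

(* Defs.v *)
From HB Require Import structures.
From mathcomp Require Import all_boot all_order all_algebra.
From mathcomp Require Import all_classical all_reals all_analysis.

Set Implicit Arguments.
Unset Strict Implicit.
Unset Printing Implicit Defensive.
Import Order.TTheory GRing.Theory Num.Theory.
Import numFieldNormedType.Exports.

Local Open Scope classical_set_scope.
Local Open Scope ring_scope.

Section Euclidean.
Context {R : realType}.

(* Squared Euclidean distance; the library norm on 'rV is the sup norm. *)
Definition sqdist n (x y : 'rV[R]_n) : R := \sum_i (x ord0 i - y ord0 i) ^+ 2.

Definition basis_vec n (i : 'I_n) : 'rV[R]_n := delta_mx ord0 i.

(* C^infinity: all iterated directional derivatives exist and are
   differentiable everywhere. *)
Definition smooth n (g : 'rV[R]_n -> R) : Prop :=
  forall (vs : seq 'rV[R]_n) (x : 'rV[R]_n),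
    differentiable (foldr (fun v h => 'D_v h) g vs) x.

(* Continuous selections of finitely many smooth functions; such functions are
   automatically locally Lipschitz. *)
Definition piecewise_smooth n (f : 'rV[R]_n -> R) : Prop :=
  continuous f /\
  exists (m : nat) (h : 'I_m -> 'rV[R]_n -> R),
    (forall i, smooth (h i)) /\ (forall y, exists i, f y = h i y).

(* The sign convention is Delta = - div grad. *)
Definition laplacian n (g : 'rV[R]_n -> R) (x : 'rV[R]_n) : R :=
  - \sum_(i < n) 'D_(basis_vec i) ('D_(basis_vec i) g) x.

(* Coordinate 0 of R^(n+1) is the height over the remaining n coordinates. *)
Definition base n (x : 'rV[R]_n.+1) : 'rV[R]_n := col' ord0 x.
Definition height n (x : 'rV[R]_n.+1) : R := x ord0 ord0.
Definition epigraph n (f : 'rV[R]_n -> R) : set 'rV[R]_n.+1 :=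
  [set x | f (base x) <= height x].

(* Outward unit normal of the epigraph of f at the point of its graph above y,
   namely (-1, grad f(y)) / sqrt(1 + |grad f(y)|^2). *)
Definition outward_normal n (f : 'rV[R]_n -> R) (y : 'rV[R]_n) : 'rV[R]_n.+1 :=
  (Num.sqrt (1 + \sum_(i < n) ('D_(basis_vec i) f y) ^+ 2))^-1 *:
  \row_(j < n.+1) (if unlift ord0 j is Some i then 'D_(basis_vec i) f y
                   else - 1).

End Euclidean.

(* A chart identifies an open set with a relatively open subset of the epigraph
   of a piecewise smooth function; points on the graph are boundary points.
   The last field says that coord is open onto its image in the epigraph.
   coord is only meaningful on dom. *)
Record chart (R : realType) (T : topologicalType) (n : nat) := Chart {
  dom : set T;
  coord : T -> 'rV[R]_n.+1;
  profile : 'rV[R]_n -> R;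
  chart_open : open dom;
  chart_profile : piecewise_smooth profile;
  chart_continuous : forall p, dom p -> {for p, continuous coord};
  chart_injective : forall p q, dom p -> dom q -> coord p = coord q -> p = q;
  chart_image : forall W : set T, open W -> W `<=` dom ->
    exists2 O : set 'rV[R]_n.+1, open O & coord @` W = O `&` epigraph profile
}.

Section Charts.
Context {R : realType}.

(* Read in the charts c and c', f preserves Euclidean distances near p; on a
   neighbourhood in an epigraph this means being the restriction of a rigid
   motion. *)
Definition locally_isometric (T T' : topologicalType) n n'
    (c : chart R T n) (c' : chart R T' n') (f : T -> T') (p : T) : Prop :=
  exists2 W, nbhs p W &
    forall q r, W q -> W r ->
      sqdist (coord c' (f q)) (coord c' (f r)) = sqdist (coord c q) (coord c r).

Variables (T : topologicalType) (n : nat) (A : set (chart R T n)).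

Definition atlas_interior : set T :=
  [set p | exists c, [/\ A c, dom c p &
                         profile c (base (coord c p)) < height (coord c p)]].

Definition atlas_boundary : set T := ~` atlas_interior.

Definition smooth_profile_at (c : chart R T n) (p : T) : Prop :=
  exists2 h : 'rV[R]_n -> R, smooth h &
    \forall y \near base (coord c p), profile c y = h y.

Definition smooth_boundary_point (p : T) : Prop :=
  atlas_boundary p /\
  exists c, [/\ A c, dom c p & smooth_profile_at c p].

End Charts.

(* A compact flat manifold of dimension (mdim + 1) with piecewise smooth
   boundary, together with the Dirichlet and Neumann parts of the boundary.
   The flat metric is given by an atlas with isometric transition maps. *)
Record flatManifold (R : realType) := FlatManifold {
  carrier :> topologicalType;
  mdim : nat;
  atlas : set (chart R carrier mdim);
  mcompact : compact [set: carrier];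
  mhausdorff : hausdorff_space carrier;
  atlas_cover : forall p, exists2 c, atlas c & dom c p;
  atlas_flat : forall c c', atlas c -> atlas c' ->
    forall p, dom c p -> dom c' p -> locally_isometric c c' id p;
  dirichlet : set carrier;
  neumann : set carrier;
  dirichlet_smooth : dirichlet `<=` smooth_boundary_point atlas;
  neumann_smooth : neumann `<=` smooth_boundary_point atlas;
  dirichlet_open :
    exists2 O, open O & dirichlet = O `&` atlas_boundary atlas;
  neumann_open :
    exists2 O, open O & neumann = O `&` atlas_boundary atlas;
  dirichlet_neumann_disjoint : dirichlet `&` neumann = set0;
  dirichlet_neumann_dense :
    closure (dirichlet `|` neumann) = atlas_boundary atlas
}.

Arguments atlas {R} f _.
Arguments dirichlet {R} f _.
Arguments neumann {R} f _.

Section Spectrum.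
Context {R : realType}.
Implicit Types M : flatManifold R.

Definition interior_of M : set M := atlas_interior (atlas M).
Definition boundary_of M : set M := atlas_boundary (atlas M).

Arguments interior_of M _ : clear implicits.
Arguments boundary_of M _ : clear implicits.

Definition pure_dirichlet M : Prop := neumann M = set0.

(* g is a smooth function on R^(n+1) representing phi near p in the chart c.
   For p on the boundary this is smoothness of phi up to the boundary, and the
   first derivatives of g at the image of p do not depend on the choice of g. *)
Definition smooth_rep M (phi : M -> R) (p : M)
    (c : chart R M (mdim M)) (g : 'rV[R]_(mdim M).+1 -> R) : Prop :=
  [/\ atlas M c, dom c p, smooth g & \forall q \near p, phi q = g (coord c q)].

Definition smooth_at M (phi : M -> R) (p : M) : Prop :=
  exists c g, smooth_rep phi p c g.

Definition laplacian_at M (phi : M -> R) (p : M) (v : R) : Prop :=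
  exists c g, smooth_rep phi p c g /\ laplacian g (coord c p) = v.

Definition normal_derivative_at M (phi : M -> R) (p : M) (v : R) : Prop :=
  exists c g, [/\ smooth_rep phi p c g, smooth_profile_at c p &
    'D_(outward_normal (profile c) (base (coord c p))) g (coord c p) = v].

(* The solutions of the boundary value problem for lambda, including 0. *)
Definition eigenspace M (lambda : R) : set (M -> R) :=
  [set phi | [/\ continuous phi,
    forall p, (interior_of M `|` dirichlet M `|` neumann M) p ->
      smooth_at phi p,
    forall p, interior_of M p -> laplacian_at phi p (lambda * phi p),
    forall p, dirichlet M p -> phi p = 0 &
    forall p, neumann M p -> normal_derivative_at phi p 0]].

Arguments eigenspace M lambda _ : clear implicits.

(* The set E of functions is a linear space of dimension k. *)
Definition has_dim (T : Type) (E : set (T -> R)) (k : nat) : Prop :=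
  exists e : 'I_k -> T -> R,
    (forall a : 'I_k -> R, (forall x, \sum_i a i * e i x = 0) ->
       forall i, a i = 0) /\
    (forall f : T -> R, E f <->
       exists a : 'I_k -> R, forall x, f x = \sum_i a i * e i x).

(* Two families of eigenspaces give the same spectrum with multiplicities.
   Dimension 0 means that lambda is not an eigenvalue. *)
Definition same_spectrum (T T' : Type)
    (E : R -> set (T -> R)) (E' : R -> set (T' -> R)) : Prop :=
  forall (lambda : R) (k : nat),
    has_dim (E lambda) k <-> has_dim (E' lambda) k.

Definition isospectral M M' : Prop :=
  same_spectrum (eigenspace M) (eigenspace M').

Definition neumann_components M : set (set M) :=
  [set connected_component (closure (neumann M)) x
    | x in closure (neumann M)].

End Spectrum.

Arguments interior_of {R} M _.
Arguments boundary_of {R} M _.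
Arguments eigenspace {R} M lambda _.
Arguments neumann_components {R} M _.

Section SimplyConnected.
Context {R : realType}.

Definition connected_space (T : topologicalType) : Prop :=
  [set: T] !=set0 /\ connected [set: T].

Definition path_connected_space (T : topologicalType) : Prop :=
  [set: T] !=set0 /\
  forall x y : T, exists gamma : R -> T,
    [/\ {within `[0, 1], continuous gamma}, gamma 0 = x & gamma 1 = y].

Definition null_homotopic (T : topologicalType) (gamma : R -> T) : Prop :=
  exists H : R * R -> T,
    [/\ {within `[0, 1] `*` `[0, 1], continuous H},
        forall t, 0 <= t <= 1 -> H (t, 0) = gamma t,
        forall t, 0 <= t <= 1 -> H (t, 1) = gamma 0 &
        forall s, 0 <= s <= 1 -> H (0, s) = gamma 0 /\ H (1, s) = gamma 0].

Definition simply_connected (T : topologicalType) : Prop :=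
  path_connected_space T /\
  forall gamma : R -> T, {within `[0, 1], continuous gamma} ->
    gamma 0 = gamma 1 -> null_homotopic gamma.

End SimplyConnected.

Arguments simply_connected R T : clear implicits.

(* The orbifold orb_cover / involution. The involution is nowhere locally the
   identity, so that Z/2 acts effectively near every point and the fixed points
   are precisely those over the singular set (which may include mirrors). *)
Record flatOrbifold (R : realType) := FlatOrbifold {
  orb_cover : flatManifold R;
  orb_cover_dirichlet : pure_dirichlet orb_cover;
  involution : orb_cover -> orb_cover;
  involution_continuous : continuous involution;
  involution_involutive : involutive involution;
  involution_isometric : forall c c', atlas orb_cover c -> atlas orb_cover c' ->
    forall p, dom c p -> dom c' (involution p) ->
      locally_isometric c c' involution p;
  involution_effective : forall p : orb_cover, ~ \forall q \near p, involution q = q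
}.

Section Orbifold.
Context {R : realType}.
Implicit Types X : flatOrbifold R.

Definition orbifold_eigenspace X (lambda : R) : set (orb_cover X -> R) :=
  [set phi | eigenspace (orb_cover X) lambda phi /\ forall p, phi (involution p) = phi p].

(* Preimage in orb_cover of the singular set. *)
Definition singular_points X : set (orb_cover X) := [set p | involution p = p].

Arguments orbifold_eigenspace X lambda _ : clear implicits.

Definition dirichlet_isospectral X (M : flatManifold R) : Prop :=
  same_spectrum (orbifold_eigenspace X) (eigenspace M).

End Orbifold.

Arguments orbifold_eigenspace {R} X lambda _.
Arguments singular_points {R} X _.

(* Main.v *)
(* Flat surfaces are built by gluing four copies of an octagon along some of its
   sides, the remaining sides carrying Dirichlet or Neumann conditions. By the
   reflection principle an eigenfunction is a family of functions on the copies
   which continues smoothly across each side c by the family obtained from the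
   signed permutation mirror c of the copies: glued copies are exchanged, and
   a copy with a free side is kept with sign 1 (Neumann) or -1 (Dirichlet). A
   matrix intertwining these signed permutations for two gluing patterns therefore
   transplants eigenfunctions (a signed version of the Buser-Berard method). A
   Hadamard matrix intertwines a star with two Neumann sides, whose surface is
   contractible, and a pattern without Neumann sides. Doubling the first surface
   along its Neumann sides turns it into the underlying space of an orbifold
   whose mirrors are those sides, with the same spectrum. *)
From HB Require Import structures.
Require Import Defs.
From mathcomp Require Import all_boot all_order all_algebra.
From mathcomp Require Import all_classical all_reals all_analysis.
From mathcomp Require Import ring lra.

Set Implicit Arguments.
Unset Strict Implicit.
Unset Printing Implicit Defensive.
Import Order.TTheory GRing.Theory Num.Theory.
Import numFieldNormedType.Exports.

Local Open Scope classical_set_scope.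
Local Open Scope ring_scope.

(** * Smooth functions *)

(** The octagon is a square with its corners cut off. The cuts carry Dirichlet conditions in every
    copy and keep the four coloured sides apart, so that at most two copies meet at any point and
    the gluing creates no cone points. The price is a reentrant corner of 270 degrees at each end of
    a glued side; but at corners the eigenvalue problem asks for continuity only, which finite
    linear combinations preserve. The analytic obstacle is the reflection principle: an
    eigenfunction is given as smooth up to a free side, and its continuation by the signed mirror
    image has to be smooth across that side. The difference between the function and its mirror
    image has zero Cauchy data on the side, and the equation, differentiated along the side, then
    forces all its derivatives to vanish there. Such a difference can be replaced by 0 on one side
    of the line without loss of smoothness. *)

Section ZeroDifferential.
Context {K : numFieldType} {V W : normedModType K}.
Implicit Types (f : V -> W) (x : V).

(** The little-o form of a vanishing differential. With its converse below it lets [smooth_half]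
    paste a function with 0 by comparing sizes, without new difference quotients. *)
Lemma differentiable_small f x :
  (forall e : K, 0 < e -> \forall y \near x, `|f y - f x| <= e * `|y - x|) ->
  differentiable f x /\ forall v, 'D_v f x = 0.
Proof.
move=> H.
have E : f \o shift x = cst (f x) + (\0 : {linear V -> W}) +o_ 0 id.
  apply/eqaddoP => e e0; rewrite near_simpl.
  have := H _ e0; rewrite (near_shift 0 x); apply: filterS => y /=.
  by rewrite subr0 addrK !fctE /= addr0.
have dE : 'd f x = (\0 : {linear V -> W}) :> (V -> W).
  by apply: diff_unique E => ?; exact: cst_continuous.
have df : differentiable f x.
  apply/diff_locallyP; rewrite dE; split=> // ?; exact: cst_continuous.
by split=> // v; rewrite deriveE// dE.
Qed.

Lemma differentiable_small_inv f x : differentiable f x ->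
  (forall v, 'D_v f x = 0) ->
  forall e : K, 0 < e -> \forall y \near x, `|f y - f x| <= e * `|y - x|.
Proof.
move=> df D0 e e0.
have dE : 'd f x = (\0 : {linear V -> W}) :> (V -> W).
  by apply/funext => v; rewrite -deriveE// D0.
have := diff_locally df; rewrite dE => /eqaddoP/(_ e e0); rewrite near_simpl.
rewrite (near_shift x 0); apply: filterS => y /=.
by rewrite sub0r !fctE/= subrK addr0.
Qed.

Lemma near_eq_differentiable f (g : V -> W) x :
  (\forall y \near x, f y = g y) -> differentiable g x -> differentiable f x.
Proof.
move=> fg dg; have -> : f = g + (f - g) by rewrite addrC subrK.
apply: differentiableD => //.
apply: (differentiable_small _).1 => e e0.
have fgx := nbhs_singleton fg.
near=> y; rewrite !fctE fgx (near fg y)// !subrr normr0.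
by rewrite mulr_ge0// ltW.
Unshelve. all: by end_near. Qed.

End ZeroDifferential.

(** The map [t] is affine with linear part [L], so the difference quotients of both sides coincide
    literally. *)
Lemma derive_affine (K : numFieldType) (U V W : normedModType K) (t : U -> V)
    (L : U -> V) (g : V -> W) v x :
  (forall h v x, t (h *: v + x) = h *: L v + t x) ->
  'D_v (g \o t) x = 'D_(L v) g (t x).
Proof. by move=> tL; rewrite /derive/=; under eq_fun do rewrite tL. Qed.

Lemma derivable_affine (K : numFieldType) (U V W : normedModType K) (t : U -> V)
    (L : U -> V) (g : V -> W) v x :
  (forall h v x, t (h *: v + x) = h *: L v + t x) ->
  derivable g (t x) (L v) -> derivable (g \o t) x v.
Proof.
move=> tL /derivable1P dg; apply/derivable1P.
by under eq_fun do rewrite /= tL.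
Qed.

(** A derivative that exists can be computed from one side. At a side of the octagon, a function on
    the surface gives information on one side only. *)
Lemma derive_side0 (R : realType) (V : normedModType R) (f : V -> R) (y v : V) :
  derivable f y v -> (\forall h \near (0 : R)^'+, f (h *: v + y) = f y) ->
  'D_v f y = 0.
Proof.
move=> df H; rewrite /derive cvg_at_rightE//.
apply: cvg_lim => //; apply: cvg_near_cst.
by near=> h; rewrite /= (near H h)// subrr scaler0.
Unshelve. all: by end_near. Qed.

Lemma continuous_side (R : realType) (V : normedModType R) (f : V -> R)
    (y v : V) (c : R) :
  {for y, continuous f} -> (\forall h \near (0 : R)^'+, f (h *: v + y) = c) ->
  f y = c.
Proof.
move=> cf H.
have /cvg_lim <- // : f (h *: v + y) @[h --> (0 : R)^'+] --> f y.
  apply: cvg_at_right_filter.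
  have -> : f y = (f \o (fun h : R => h *: v + y)) 0.
    by rewrite /= scale0r add0r.
  apply: continuous_comp; last by rewrite /= scale0r add0r.
  by apply: cvgD; [apply: cvgZr_tmp; exact: cvg_id|exact: cvg_cst].
by apply/cvg_lim => //; exact: cvg_near_cst.
Unshelve. all: by end_near. Qed.

Section Smooth.
Context {R : realType} {n : nat}.
Implicit Types (f g : 'rV[R]_n -> R) (v x : 'rV[R]_n).

(** Coinduction: smoothness is the largest class of differentiable functions closed under
    directional derivatives. Each closure property below amounts to finding a suitable class [P]. *)
Lemma smooth_coind (P : ('rV[R]_n -> R) -> Prop) :
  (forall f, P f ->
    (forall x, differentiable f x) /\ forall v, P ('D_v f)) ->
  forall f, P f -> smooth f.
Proof.
move=> PD f Pf vs x.
have : P (foldr (fun v h => 'D_v h) f vs).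
  by elim: vs => //= v vs IH; apply: (PD _ IH).2.
by move=> /PD[].
Qed.

Lemma smooth_differentiable f x : smooth f -> differentiable f x.
Proof. by move=> /(_ [::]). Qed.

Lemma smooth_derivable f x v : smooth f -> derivable f x v.
Proof. by move=> sf; exact/diff_derivable/smooth_differentiable. Qed.

Lemma smooth_derive f v : smooth f -> smooth ('D_v f).
Proof. by move=> sf vs x; have := sf (rcons vs v) x; rewrite foldr_rcons. Qed.

Lemma smooth_foldr f vs : smooth f -> smooth (foldr (fun v h => 'D_v h) f vs).
Proof. by move=> sf; elim: vs => //= v vs; exact: smooth_derive. Qed.

Lemma smooth_continuous f : smooth f -> continuous f.
Proof.
by move=> sf x; exact/differentiable_continuous/smooth_differentiable.
Qed.

Lemma smooth_cst (a : R) : smooth (cst a : 'rV[R]_n -> R).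
Proof.
apply: (smooth_coind (P := fun f => exists a, f = cst a)); last by exists a.
move=> _ [{}a ->]; split=> [x|v]; first exact: differentiable_cst.
by exists 0; apply/funext => x; rewrite derive_cst.
Qed.

Lemma deriveDE f g v : smooth f -> smooth g ->
  'D_v (fun x => f x + g x) = (fun x => 'D_v f x + 'D_v g x).
Proof.
by move=> sf sg; apply/funext => x; rewrite deriveD//; exact: smooth_derivable.
Qed.

Lemma deriveZE (k : R) f v : smooth f ->
  'D_v (fun x => k * f x) = (fun x => k * 'D_v f x).
Proof.
move=> sf; apply/funext => x.
by rewrite (@deriveZ _ _ _ f k x v)//; exact: smooth_derivable.
Qed.

Lemma deriveME f g v : smooth f -> smooth g ->
  'D_v (fun x => f x * g x) = (fun x => 'D_v f x * g x + f x * 'D_v g x).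
Proof.
move=> sf sg; apply/funext => x.
rewrite (@deriveM _ _ f g x v); try exact: smooth_derivable.
by rewrite addrC [X in _ = X]addrC /GRing.scale/= [g x * _]mulrC [X in _ = X]addrC addrC.
Qed.

Lemma smoothD f g : smooth f -> smooth g -> smooth (fun x => f x + g x).
Proof.
move=> sf sg.
apply: (smooth_coind (P := fun h => exists f g, [/\ smooth f, smooth g &
   h = (fun x => f x + g x)])); last by exists f, g.
move=> _ [{sf sg}f [{}g [sf sg ->]]]; split=> [x|v].
  by apply: differentiableD; exact: smooth_differentiable.
exists ('D_v f), ('D_v g); split; [exact: smooth_derive..|].
exact: deriveDE.
Qed.

Lemma smoothZ (k : R) f : smooth f -> smooth (fun x => k * f x).
Proof.
move=> sf.
apply: (smooth_coind (P := fun h => exists2 f, smooth f &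
   h = (fun x => k * f x))); last by exists f.
move=> _ [{sf}f sf ->]; split=> [x|v].
  by apply: (@differentiableZ _ _ _ f k); exact: smooth_differentiable.
exists ('D_v f); [exact: smooth_derive|exact: deriveZE].
Qed.

Lemma smoothB f g : smooth f -> smooth g -> smooth (fun x => f x - g x).
Proof.
move=> sf /(smoothZ (-1)) sg; under eq_fun do rewrite -mulN1r.
exact: smoothD.
Qed.

Lemma smooth_sum (I : Type) (s : seq I) (F : I -> 'rV[R]_n -> R) :
  (forall i, smooth (F i)) -> smooth (fun x => \sum_(i <- s) F i x).
Proof.
move=> sF; elim: s => [|i s IH].
  by under eq_fun do rewrite big_nil; exact: smooth_cst.
by under eq_fun do rewrite big_cons; exact: smoothD.
Qed.

(** Single products are not stable under derivation, but finite sums of products of smooth functions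
    are, by the Leibniz rule; these sums form the class for [smooth_coind]. *)
Lemma smoothM f g : smooth f -> smooth g -> smooth (fun x => f x * g x).
Proof.
move=> sf sg.
pose P h := exists2 s : seq (('rV[R]_n -> R) * ('rV[R]_n -> R)),
   (forall p, List.In p s -> smooth p.1 /\ smooth p.2) &
   h = (fun x => \sum_(p <- s) p.1 x * p.2 x).
apply: (smooth_coind (P := P)); last first.
  exists [:: (f, g)] => [p [<-|]|] //.
  by apply/funext => x; rewrite big_seq1.
move=> _ [s ss ->].
have H : forall s : seq (('rV[R]_n -> R) * ('rV[R]_n -> R)),
   (forall p, List.In p s -> smooth p.1 /\ smooth p.2) ->
   forall x, differentiable (fun x => \sum_(p <- s) p.1 x * p.2 x) x.
  move=> {ss}{}s ss x; elim: s ss => [|p s IH] ss.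
    by under eq_fun do rewrite big_nil; exact: differentiable_cst.
  under eq_fun do rewrite big_cons.
  have [s1 s2] := ss p (or_introl erefl).
  apply: differentiableD; last by apply: IH => q qs; apply: ss; right.
  by apply: differentiableM; exact: smooth_differentiable.
split; first exact: H.
move=> v; exists (flatten [seq [:: ('D_v p.1, p.2); (p.1, 'D_v p.2)] | p <- s]).
  elim: s ss => [|q s IH] ss p //= [<-|[<-|ps]] /=.
  - by have [] := ss q (or_introl erefl) => s1 s2; split=> //; exact: smooth_derive.
  - by have [] := ss q (or_introl erefl) => s1 s2; split=> //; exact: smooth_derive.
  - by apply: IH ps => r rs; apply: ss; right.
elim: s ss => [|p s IH] ss.
  apply/funext => x; rewrite big_nil.
  by under eq_fun do rewrite big_nil; rewrite derive_cst.
have [s1 s2] := ss p (or_introl erefl).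
have {}IH := IH (fun q qs => ss q (or_intror qs)).
apply/funext => x; rewrite [X in derive X _ _](_ : _ = (fun x => p.1 x * p.2 x) \+
  (fun x => \sum_(q <- s) q.1 x * q.2 x)); last first.
  by apply/funext => y; rewrite big_cons.
rewrite deriveD; last 2 first.
- by apply/diff_derivable/differentiableM; exact: smooth_differentiable.
- by apply/diff_derivable/H => q qs; apply: ss; right.
have -> := congr1 (@^~ x) (deriveME v s1 s2).
by have -> := congr1 (@^~ x) IH; rewrite /= !big_cons/= addrA.
Qed.

Lemma near_eq_foldr f g x vs : (\forall y \near x, f y = g y) ->
  foldr (fun v h => 'D_v h) f vs x = foldr (fun v h => 'D_v h) g vs x.
Proof.
elim: vs x => /= [x /nbhs_singleton//|v vs IH x fg].
apply: near_eq_derive; near=> y; apply: IH.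
by near: y; apply: nbhs_interior fg.
Unshelve. all: by end_near. Qed.

Lemma foldrDE f g vs : smooth f -> smooth g ->
  foldr (fun v h => 'D_v h) (fun x => f x + g x) vs =
  (fun x => foldr (fun v h => 'D_v h) f vs x +
            foldr (fun v h => 'D_v h) g vs x).
Proof.
move=> sf sg; elim: vs => //= v vs ->.
by rewrite deriveDE//; exact: smooth_foldr.
Qed.

Lemma foldrZE (k : R) f vs : smooth f ->
  foldr (fun v h => 'D_v h) (fun x => k * f x) vs =
  (fun x => k * foldr (fun v h => 'D_v h) f vs x).
Proof.
move=> sf; elim: vs => //= v vs ->.
by rewrite deriveZE//; exact: smooth_foldr.
Qed.

Lemma deriveDv f v w x : differentiable f x ->
  'D_(v + w) f x = 'D_v f x + 'D_w f x.
Proof. by move=> df; rewrite !deriveE// linearD. Qed.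

Lemma deriveZv f (k : R) v x : differentiable f x ->
  'D_(k *: v) f x = k * 'D_v f x.
Proof. by move=> df; rewrite !deriveE// linearZ. Qed.

End Smooth.

Lemma smooth_affine (R : realType) n m (t : 'rV[R]_n -> 'rV[R]_m)
    (L : 'rV[R]_n -> 'rV[R]_m) (g : 'rV[R]_m -> R) :
  (forall h v x, t (h *: v + x) = h *: L v + t x) ->
  (forall x, differentiable t x) -> smooth g -> smooth (g \o t).
Proof.
move=> tL dt sg.
apply: (smooth_coind (P := fun f => exists2 g, smooth g & f = g \o t));
  last by exists g.
move=> _ [{sg}g sg ->]; split=> [x|v].
  apply: differentiable_comp => //; exact: smooth_differentiable.
exists ('D_(L v) g); first exact: smooth_derive.
by apply/funext => x; exact: derive_affine.
Qed.

(* A one-variable smooth function is given with all its derivatives. *)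
Lemma smooth_comp1 (R : realType) n (th : nat -> R -> R) (h : 'rV[R]_n -> R) :
  (forall k (t : R), is_derive t (1 : R) (th k) (th k.+1 t)) -> smooth h ->
  smooth (th 0%N \o h).
Proof.
move=> dth sh.
have dth' k t : differentiable (th k) t.
  by apply/derivable1_diffP; case: (dth k t).
have dcomp k x : differentiable (th k \o h) x.
  by apply: differentiable_comp => //; exact: smooth_differentiable.
have Dcomp k v x : 'D_v (th k \o h) x = th k.+1 (h x) * 'D_v h x.
  rewrite deriveE// diff_comp//; last exact: smooth_differentiable.
  rewrite /= -(@deriveE _ _ _ h); last exact: smooth_differentiable.
  have [dt dtE] := dth k (h x).
  rewrite -[X in 'd (th k) _ X]mulr1 [LHS]linearZ/= -deriveE//.
  by rewrite dtE /GRing.scale/= mulrC.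
(* Sums of terms [th k (h x) * g x] with [g] smooth are stable under derivation: the chain rule
   raises [k] and multiplies [g] by a derivative of [h], and the product rule differentiates [g]. *)
pose P f := exists2 s : seq (nat * ('rV[R]_n -> R)),
   (forall p, List.In p s -> smooth p.2) &
   f = (fun x => \sum_(p <- s) th p.1 (h x) * p.2 x).
apply: (smooth_coind (P := P)); last first.
  exists [:: (0%N, cst 1)] => [p [<-|]|] //; first exact: smooth_cst.
  by apply/funext => x; rewrite big_seq1/= mulr1.
have H : forall s : seq (nat * ('rV[R]_n -> R)),
   (forall p, List.In p s -> smooth p.2) ->
   forall x, differentiable (fun x => \sum_(p <- s) th p.1 (h x) * p.2 x) x.
  move=> s ss x; elim: s ss => [|p s IH] ss.
    by under eq_fun do rewrite big_nil; exact: differentiable_cst.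
  under eq_fun do rewrite big_cons.
  apply: differentiableD; last by apply: IH => q qs; apply: ss; right.
  apply: differentiableM; first exact: dcomp.
  by apply: smooth_differentiable; apply: ss; left.
move=> _ [s ss ->]; split; first exact: H.
move=> v; exists (flatten [seq [:: (p.1.+1, fun x => 'D_v h x * p.2 x);
                                  (p.1, 'D_v p.2)] | p <- s]).
  elim: s ss => [|q s IH] ss p //= [<-|[<-|ps]] /=.
  - by apply: smoothM; [exact: smooth_derive|apply: ss; left].
  - by apply: smooth_derive; apply: ss; left.
  - by apply: IH ps => r rs; apply: ss; right.
elim: s ss => [|p s IH] ss.
  apply/funext => x; rewrite big_nil.
  by under eq_fun do rewrite big_nil; rewrite derive_cst.
have s2 := ss p (or_introl erefl).
have {}IH := IH (fun q qs => ss q (or_intror qs)).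
apply/funext => x; rewrite [X in derive X _ _](_ : _ =
  (fun x => (th p.1 \o h) x * p.2 x) \+
  (fun x => \sum_(q <- s) th q.1 (h x) * q.2 x)); last first.
  by apply/funext => y; rewrite big_cons.
rewrite deriveD; last 2 first.
- by apply/diff_derivable/differentiableM; [exact: dcomp|exact: smooth_differentiable].
- by apply/diff_derivable/H => q qs; apply: ss; right.
have -> := congr1 (@^~ x) IH.
rewrite (@deriveM _ _ (th p.1 \o h) p.2 x v); last 2 first.
- exact/diff_derivable/dcomp.
- exact: smooth_derivable.
rewrite Dcomp /= !big_cons/= /GRing.scale/= addrA mulrA; congr (_ + _).
by ring.
Qed.

(** * Cutoff functions built from exp(-1/t) *)

Section Bump.
Context {R : realType}.

(** Coefficient by coefficient, from s^i <= i! exp s. With s = 1/t it says that polynomials in 1/t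
    cannot spoil the decay of exp(-1/t) at 0. *)
Lemma horner_le_expR (p : {poly R}) :
  exists2 C : R, 0 < C & forall s, 0 <= s -> `|p.[s]| <= C * expR s.
Proof.
exists (1 + \sum_(i < size p) `|p`_i| * i`!%:R).
  by rewrite ltr_pwDl// sumr_ge0// => i _; rewrite mulr_ge0.
move=> s s0; rewrite horner_coef (le_trans (ler_norm_sum _ _ _))//.
rewrite mulrDl mul1r ler_wpDl ?expR_ge0// mulr_suml ler_sum// => i _.
rewrite normrM -mulrA ler_wpM2l// ger0_norm ?exprn_ge0//.
case: (val i) => [|k]; last first.
  have := expR_ge1Dxn k s0; rewrite -lerBrDl => /le_trans/(_ _) H.
  by rewrite mulrC -ler_pdivrMr ?ltr0n ?fact_gt0// H// gerBl.
by rewrite fact0 mul1r expr0 (le_trans _ (expR_ge1Dx s))// lerDl.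
Qed.

(** The polynomial factor in 1/t makes the family stable under derivation; the classical function is
    the case p = 1. *)
Definition flat_exp (p : {poly R}) (t : R) : R :=
  if 0 < t then p.[t^-1] * expR (- t^-1) else 0.

Lemma is_derive_flat_exp (p : {poly R}) (t : R) :
  is_derive t (1 : R) (flat_exp p) (flat_exp ('X^2 * (p - p^`())) t).
Proof.
have [t0|t0|<-] := ltgtP 0 t.
- have tn0 : t != 0 by rewrite gt_eqF.
  apply: (@near_eq_is_derive _ _ _
    ((horner p \o @GRing.inv R) * (@expR R \o (- @GRing.inv R)))).
    near=> s; rewrite /flat_exp ifT//; near: s; exact: lt_nbhsr.
  have di : is_derive t (1 : R) (@GRing.inv R) (- t ^- 2).
    by have := is_deriveV tn0 (is_derive_id t (1 : R)); rewrite /GRing.scale/= mulr1.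
  have d1 : is_derive t (1 : R) (horner p \o @GRing.inv R)
      (p^`().[t^-1] * - t ^- 2) by exact: is_derive1_comp.
  have d2 : is_derive t (1 : R) (@expR R \o (- @GRing.inv R))
      (expR (- t^-1) * t ^- 2).
    apply: is_derive1_comp; rewrite -[X in is_derive _ _ _ X]opprK.
    exact: is_deriveN.
  apply: is_derive_eq.
  rewrite /flat_exp t0 /= hornerM hornerXn hornerD hornerN /GRing.scale/=.
  by rewrite exprVn; ring.
- have -> : flat_exp ('X^2 * (p - p^`())) t = 0 by rewrite /flat_exp ltNge ltW.
  apply: (@near_eq_is_derive _ _ _ (cst 0 : R -> R)).
    near=> s; rewrite /flat_exp ifF//; apply/negbTE; rewrite -leNgt ltW//.
    near: s; exact: lt_nbhsl.
have -> : flat_exp ('X^2 * (p - p^`())) 0 = 0 by rewrite /flat_exp ltxx.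
(* The extra factor X^2 turns the bound into |[flat_exp p y]| <= C y^2 for y > 0, which is below e
   |y| near 0, so the differential at 0 vanishes. *)
have [C C0 HC] := horner_le_expR ('X^2 * p).
have [e e0|df D0] := @differentiable_small _ _ _ (flat_exp p) (0 : R).
  near=> y; rewrite {2}/flat_exp ltxx !subr0 /flat_exp.
  case: ifPn => [y0|_]; last by rewrite normr0 mulr_ge0// ltW.
  have yi0 : 0 <= y^-1 by rewrite invr_ge0 ltW.
  have := HC _ yi0; rewrite hornerM hornerXn [X in X <= _]normrM.
  rewrite [X in X * _]ger0_norm ?exprn_ge0// exprVn => H.
  have y20 : 0 < y ^+ 2 by rewrite exprn_gt0.
  rewrite ler_pdivrMl// in H.
  rewrite [X in X <= _]normrM (gtr0_norm y0) [X in _ * X]gtr0_norm ?expR_gt0//.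
  rewrite expRN ler_pdivrMr ?expR_gt0// (le_trans H)// mulrA ler_wpM2r ?expR_ge0//.
  rewrite expr2 mulrAC ler_wpM2r ?(ltW y0)//.
  rewrite mulrC -ler_pdivlMl// mulrC ltW//.
  near: y; apply: lt_nbhsl; rewrite divr_gt0//.
by apply: DeriveDef; [exact: diff_derivable|exact: D0].
Unshelve. all: by end_near. Qed.

Fixpoint flat_poly (k : nat) : {poly R} :=
  if k is k'.+1 then 'X^2 * (flat_poly k' - (flat_poly k')^`()) else 1.

Lemma smooth_flat_exp n (h : 'rV[R]_n -> R) :
  smooth h -> smooth (flat_exp 1 \o h).
Proof.
apply: (@smooth_comp1 _ _ (fun k => flat_exp (flat_poly k))) => k t.
exact: is_derive_flat_exp.
Qed.

Lemma flat_exp_eq0 t : t <= 0 -> flat_exp 1 t = 0.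
Proof. by rewrite /flat_exp ltNge => ->. Qed.

Lemma flat_exp_gt0 t : 0 < t -> 0 < flat_exp 1 t.
Proof. by move=> t0; rewrite /flat_exp t0 hornerC mul1r expR_gt0. Qed.

Lemma flat_exp_le (s t : R) : s <= t -> flat_exp 1 s <= flat_exp 1 t.
Proof.
move=> st; have [s0|s0] := leP s 0.
  rewrite flat_exp_eq0//; have [t0|/flat_exp_gt0/ltW//] := leP t 0.
  by rewrite flat_exp_eq0.
have t0 := lt_le_trans s0 st.
by rewrite /flat_exp s0 t0 !hornerC !mul1r ler_expR lerN2 lef_pV2.
Qed.

Lemma smooth_coord n (i : 'I_n) : smooth (fun x : 'rV[R]_n => x ord0 i).
Proof.
pose P (f : 'rV[R]_n -> R) := f = (fun x => x ord0 i) \/ exists a, f = cst a.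
apply: (smooth_coind (P := P)); last by left.
move=> _ [->|[a ->]]; split=> [x|v].
- exact: differentiable_coord.
- right; exists (v ord0 i); apply/funext => x.
  rewrite /derive/=; under eq_fun do rewrite !mxE addrK.
  apply: cvg_lim => //; apply: cvg_near_cst.
  near=> h; rewrite /GRing.scale/= mulrA mulVf ?mul1r//.
  by near: h; exact: nbhs_dnbhs_neq.
- exact: differentiable_cst.
- by right; exists 0; apply/funext => x; rewrite derive_cst.
Unshelve. all: by end_near. Qed.

(* chi(s) = e(a - e(s^2 - 1)) / e(a) with e = flat_exp 1 and a = e(1). *)
Lemma smooth_cutoff n (i : 'I_n) (b r : R) : 0 < r ->
  exists2 eta : 'rV[R]_n -> R, smooth eta &
    (forall x : 'rV[R]_n, r <= `|x ord0 i - b| -> eta x = 0) /\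
    (exists2 r', 0 < r' & forall x : 'rV[R]_n, `|x ord0 i - b| < r' -> eta x = 1).
Proof.
move=> r0.
pose a := flat_exp 1 1; have a0 : 0 < a by apply: flat_exp_gt0.
(* Scaled so that q >= 1 at distance at least r from b, where e(q) >= a makes the quotient 0, and q
   <= 0 within r/2, where e(q) = 0 makes it 1. *)
pose q (x : 'rV[R]_n) := 2 * r^-1 ^+ 2 * ((x ord0 i - b) * (x ord0 i - b)) - 1.
have sq : smooth q.
  apply: smoothB; last exact: smooth_cst.
  apply: smoothZ; apply: smoothM; (apply: smoothB; last exact: smooth_cst);
  exact: smooth_coord.
exists (fun x => (flat_exp 1 a)^-1 *
                 (flat_exp 1 \o (fun x => a - (flat_exp 1 \o q) x)) x).
  apply: smoothZ; apply: smooth_flat_exp; apply: smoothB; first exact: smooth_cst.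
  exact: smooth_flat_exp.
have qE x : q x = 2 * (`|x ord0 i - b| / r) ^+ 2 - 1.
  by rewrite /q expr_div_n real_normK ?num_real// exprVn; ring.
split.
  move=> x xr; rewrite /= (flat_exp_eq0 (t := _ - _)) ?mulr0// subr_le0.
  apply: flat_exp_le; rewrite qE lerBrDr -[1 + 1]mulr1 ler_wpM2l//.
  by rewrite expr_ge1 ?divr_ge0// ?(ltW r0)// ler_pdivlMr// mul1r.
exists (r / 2); first by rewrite divr_gt0.
move=> x xr /=; rewrite (flat_exp_eq0 (t := q x)) ?subr0.
  by rewrite mulVf// gt_eqF// flat_exp_gt0.
rewrite qE subr_le0.
have : `|x ord0 i - b| / r <= 2^-1 by rewrite ler_pdivrMr// mulrC ltW.
have : 0 <= `|x ord0 i - b| / r by rewrite divr_ge0// ltW.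
move: (_ / r) => z z0 z2; rewrite expr2; nra.
Qed.

End Bump.

(** * Symmetry of second derivatives *)

Section Schwarz.
Context {R : realType} {n : nat}.
Implicit Types (f : 'rV[R]_n -> R) (x u v : 'rV[R]_n).

Lemma is_derive_line f x u (s : R) : smooth f ->
  is_derive s (1 : R) (fun s : R => f (s *: u + x)) ('D_u f (s *: u + x)).
Proof.
move=> sf.
have tL (h a s' : R) : (fun s => s *: u + x) (h *: a + s') =
    h *: (a *: u) + (fun s => s *: u + x) s'.
  by rewrite /= scalerDl scalerA addrA.
apply: DeriveDef.
  by apply: (derivable_affine tL); exact: smooth_derivable.
by rewrite (derive_affine _ _ _ tL) scale1r.
Qed.

(** The mean value theorem twice: along [u] for the increment of [f] in direction [v], then along
    [v] for ['D_u f]. The fourth corner [z] is a variable, so that the lemma also applies with [u]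
    and [v] exchanged. *)
Lemma second_difference f x u v z (h : R) : smooth f -> 0 < h ->
  z = h *: v + (h *: u + x) ->
  exists a b : R, [/\ 0 <= a <= h, 0 <= b <= h &
    f z - f (h *: u + x) - (f (h *: v + x) - f x) =
    h * h * 'D_v ('D_u f) (b *: v + (a *: u + x))].
Proof.
move=> sf h0 ->.
pose p s := f (s *: u + (h *: v + x)) - f (s *: u + x).
have dp (s : R) : is_derive s (1 : R) p
    ('D_u f (s *: u + (h *: v + x)) - 'D_u f (s *: u + x)).
  by apply: is_deriveB; exact: is_derive_line.
have cp : continuous p.
  by move=> s; apply/differentiable_continuous/derivable1_diffP; case: (dp s).
have [a /itvP ah pE] := MVT h0 (fun s _ => dp s) (continuous_subspaceT cp).
pose q t := 'D_u f (t *: v + (a *: u + x)).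
have dq (s : R) : is_derive s (1 : R) q
    ('D_v ('D_u f) (s *: v + (a *: u + x))).
  by apply: is_derive_line; exact: smooth_derive.
have cq : continuous q.
  by move=> s; apply/differentiable_continuous/derivable1_diffP; case: (dq s).
have [b /itvP bh qE] := MVT h0 (fun s _ => dq s) (continuous_subspaceT cq).
exists a, b; split; rewrite ?ah ?bh//.
move: pE qE; rewrite /p /q !scale0r !add0r !subr0 => pE qE.
rewrite addrCA pE (addrCA (a *: u)) qE; ring.
Qed.

Lemma dist_half_le (p q r e : R) :
  `|p - r| < e / 2 -> `|q - r| < e / 2 -> `|p - q| <= e.
Proof.
move=> pr qr; rewrite ltW// (le_lt_trans (ler_distD r _ _))//.
by rewrite [e]splitr ltrD// distrC.
Qed.

(** The second difference over the parallelogram spanned by h u and h v is symmetric in u and v.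
    Hence the two mixed derivatives share a value at points that tend to x with h, and continuity
    gives equality at x. *)
Lemma schwarz f u v : smooth f -> 'D_v ('D_u f) = 'D_u ('D_v f).
Proof.
move=> sf; apply/funext => x; apply/eqP; rewrite -subr_eq0 -normr_le0.
apply/ler_addgt0Pl => e e0; rewrite addr0.
pose Q (g : 'rV[R]_n -> R) (h : R) := forall a b : R,
    0 <= a <= h -> 0 <= b <= h ->
    `|g x - g (b *: v + (a *: u + x))| < e / 2.
have near_cont g : smooth g -> \forall h \near (0 : R)^'+, Q g h.
  move=> sg; have e20 : 0 < e / 2 by rewrite divr_gt0.
  have cg : {for x, continuous g} by exact: smooth_continuous.
  have /cvgrPdist_lt/(_ _ e20)/nbhs_ballP[d /= d0 H] := cg.
  near=> h => a b /andP[a0 ah] /andP[b0 bh].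
  apply: H; rewrite -ball_normE/= addrA opprD addrA addrAC subrr sub0r normrN.
  rewrite (le_lt_trans (ler_normD _ _))// !normrZ !ger0_norm//.
  apply: (@le_lt_trans _ _ (h * (`|v| + `|u| + 1))).
    have := normr_ge0 u; have := normr_ge0 v; nra.
  rewrite -ltr_pdivlMr; last by rewrite ltr_wpDl// addr_ge0.
  near: h; apply: nbhs_right_lt; rewrite divr_gt0// ltr_wpDl// addr_ge0//.
have sDvu : smooth ('D_v ('D_u f)) by do 2 apply: smooth_derive.
have sDuv : smooth ('D_u ('D_v f)) by do 2 apply: smooth_derive.
have [h [[N1 N2] h0]] : exists h : R,
    (Q ('D_v ('D_u f)) h /\ Q ('D_u ('D_v f)) h) /\ 0 < h.
  apply: (@filter_ex _ (0 : R)^'+); apply: filterI; last exact: nbhs_right_gt.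
  by apply: filterI; [exact: near_cont sDvu|exact: near_cont sDuv].
pose z := h *: v + (h *: u + x).
have zE : z = h *: u + (h *: v + x) by exact: addrCA.
have [a [b [ah bh E]]] := second_difference sf h0 (erefl z).
have [b' [a' [bh' ah' E']]] := second_difference sf h0 zE.
have hh : h * h != 0 by rewrite mulf_neq0 ?gt_eqF.
have sym (p q r s : R) : p - q - (r - s) = p - r - (q - s) by ring.
have {}E : 'D_v ('D_u f) (b *: v + (a *: u + x)) =
           'D_u ('D_v f) (a' *: u + (b' *: v + x)).
  apply: (mulfI hh); apply: (etrans (esym E)); apply: (etrans _ E').
  exact: sym.
have H1 := N1 _ _ ah bh; have := N2 _ _ ah' bh'.
have -> : b' *: v + (a' *: u + x) = a' *: u + (b' *: v + x) by exact: addrCA.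
rewrite -E => H2.
exact: (dist_half_le H1 H2).
Unshelve. all: by end_near. Qed.

End Schwarz.

(** * Functions vanishing to infinite order *)

Section Flat.
Context {R : realType} {n : nat}.
Implicit Types (f g w : 'rV[R]_n -> R) (x v : 'rV[R]_n).

Definition flat_at f x := forall vs, foldr (fun v h => 'D_v h) f vs x = 0.

Lemma flat_derive f x v : flat_at f x -> flat_at ('D_v f) x.
Proof. by move=> ff vs; have := ff (rcons vs v); rewrite foldr_rcons. Qed.

Lemma flatM f w x : smooth f -> smooth w -> flat_at w x ->
  flat_at (fun x => f x * w x) x.
Proof.
move=> + + + vs; elim/last_ind: vs f w => [|vs v IH] f w sf sw fw.
  by have /= -> := fw [::]; rewrite mulr0.
rewrite foldr_rcons deriveME// foldrDE; last 2 first.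
- by apply: smoothM => //; exact: smooth_derive.
- by apply: smoothM => //; exact: smooth_derive.
rewrite (IH _ _ (smooth_derive v sf) sw fw).
by rewrite (IH _ _ sf (smooth_derive v sw) (flat_derive v fw)) addr0.
Qed.

Lemma near_eq0_flat f x : (\forall y \near x, f y = 0) -> flat_at f x.
Proof.
move=> f0 vs; rewrite (near_eq_foldr (g := cst 0))//.
have E : foldr (fun v h => 'D_v h) (cst 0 : 'rV[R]_n -> R) vs = cst 0.
  by elim: vs => //= v vs ->; apply/funext => y; exact: derive_cst.
exact: (congr1 (@^~ x) E).
Qed.

(** Derivation commutes with truncation: off the hyperplane this is local, and on it [w] and its
    first derivatives vanish, so the truncated function is o(|y - x|) as well. The derivatives of
    [w] are flat on the hyperplane again, which closes the coinduction. *)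
Lemma smooth_half w (i : 'I_n) : smooth w ->
  (forall x, x ord0 i = 0 -> flat_at w x) ->
  smooth (fun x => if 0 <= x ord0 i then w x else 0).
Proof.
move=> sw fw.
apply: (smooth_coind (P := fun f => exists w, [/\ smooth w,
  forall x, x ord0 i = 0 -> flat_at w x &
  f = (fun x => if 0 <= x ord0 i then w x else 0)])); last by exists w.
move=> _ [{sw fw}w [sw fw ->]].
pose F (x : 'rV[R]_n) := if 0 <= x ord0 i then w x else 0.
suff H x : differentiable F x /\
  forall v, 'D_v F x = if 0 <= x ord0 i then 'D_v w x else 0.
  split=> [x|v]; first exact: (H x).1.
  exists ('D_v w); split; first exact: smooth_derive.
    by move=> x x0; apply/flat_derive/fw.
  by apply/funext => x; exact: (H x).2.
have cx : {for x, continuous (fun y : 'rV[R]_n => y ord0 i)}.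
  by apply: smooth_continuous; exact: smooth_coord.
have [x0|x0|x0] := ltgtP 0 (x ord0 i).
- have E : \forall y \near x, F y = w y.
    have N : \forall y \near x, 0 < (y : 'rV[R]_n) ord0 i := cx _ (lt_nbhsr x0).
    apply: filterS N => y /= y0.
    by rewrite /F ifT// ltW.
  split=> [|v]; last exact: near_eq_derive.
  exact/(near_eq_differentiable E)/smooth_differentiable.
- have E : \forall y \near x, F y = 0.
    have N : \forall y \near x, (y : 'rV[R]_n) ord0 i < 0 := cx _ (lt_nbhsl x0).
    apply: filterS N => y /= y0.
    by rewrite /F ifF// leNgt y0.
  split=> [|v]; last by rewrite (near_eq_derive (g := cst 0) _ E)// derive_cst.
  exact/(near_eq_differentiable (g := cst 0) E)/differentiable_cst.
have w0 : w x = 0 by exact: (fw x (esym x0) [::]).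
have Dw v : 'D_v w x = 0 by exact: (fw x (esym x0) [:: v]).
have [|dF DF] := @differentiable_small _ _ _ F x.
  move=> e e0; have := differentiable_small_inv (smooth_differentiable x sw) Dw e0.
  apply: filterS => y; rewrite /F -x0 lexx w0 !subr0 => H.
  by case: ifP => // _; rewrite normr0 mulr_ge0// ltW.
by split=> // v; rewrite DF Dw.
Qed.

End Flat.

(** * Coordinates and the Laplacian in the plane *)

Section Plane.
Context {R : realType}.
Implicit Types (f g w : 'rV[R]_2 -> R) (x y v : 'rV[R]_2).

(** Coordinates are indexed by booleans, so that one argument serves both axes, and later all four
    sides of the octagon, with negation exchanging the axes. *)
Definition crd (s : bool) x : R :=
  if s then x ord0 (lift ord0 ord0) else x ord0 ord0.

Arguments crd : simpl never.

Definition pt (a b : R) : 'rV[R]_2 :=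
  \row_(j < 2) (if unlift ord0 j is Some _ then b else a).

Lemma crd_pt s a b : crd s (pt a b) = if s then b else a.
Proof. by case: s; rewrite /crd mxE ?liftK ?unlift_none. Qed.

Lemma ptP x y : (forall s, crd s x = crd s y) -> x = y.
Proof.
move=> H; apply/rowP => j; have := H false; have := H true; rewrite /crd.
by case: (unliftP ord0 j) => [k|] ->//; rewrite (ord1 k).
Qed.

Lemma pt_crd x : pt (crd false x) (crd true x) = x.
Proof. by apply: ptP => -[]; rewrite crd_pt. Qed.

Lemma crdD s x y : crd s (x + y) = crd s x + crd s y.
Proof. by case: s; rewrite /crd mxE. Qed.

Lemma crdZ s (a : R) x : crd s (a *: x) = a * crd s x.
Proof. by case: s; rewrite /crd mxE. Qed.

Lemma smooth_crd s : smooth (crd s).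
Proof. by case: s; exact: smooth_coord. Qed.

Lemma continuous_crd s : continuous (crd s).
Proof. by apply: smooth_continuous; exact: smooth_crd. Qed.

Lemma nearP2 x (P : set 'rV[R]_2) :
  (\forall y \near x, P y) <->
  exists2 d, 0 < d & forall y, (forall s, `|crd s y - crd s x| < d) -> P y.
Proof.
split=> [/nbhs_ballP[d /= d0 H]|[d d0 H]].
  exists d => // y yx; apply: H; split=> // a j; rewrite (ord1 a).
  rewrite /ball/= distrC; have := yx false; have := yx true; rewrite /crd.
  by case: (unliftP ord0 j) => [k|] ->//; rewrite (ord1 k).
apply/nbhs_ballP; exists d => //= y [_ xy]; apply: H => -[]; rewrite /crd distrC;
exact: xy.
Qed.

Lemma near_side (x v : 'rV[R]_2) (P : set 'rV[R]_2) (d : R) : 0 < d ->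
  (forall y, (forall s, `|crd s y - crd s x| < d) -> P y) ->
  \forall h \near (0 : R)^'+, P (h *: v + x).
Proof.
move=> d0 H; have : \forall y \near x, P y by apply/nearP2; exists d.
move=> {}H; have cv : {for (0 : R), continuous (fun h : R => h *: v + x)}.
  apply: continuousD; last exact: cst_continuous.
  by apply: continuousZr_tmp; exact: cvg_id.
have : \forall h \near (0 : R), P (h *: v + x).
  by apply: cv; rewrite scale0r add0r.
exact: cvg_within.
Qed.

Definition e0 : 'rV[R]_2 := pt 1 0.
Definition e1 : 'rV[R]_2 := pt 0 1.

Lemma basis_vecE (s : bool) :
  basis_vec (if s then lift ord0 ord0 else ord0 : 'I_2) = if s then e1 else e0.
Proof.
apply: ptP => t; case: s t => -[]; rewrite /e0 /e1 crd_pt /crd !mxE ?eqxx//=.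
Qed.

Lemma laplacianE g x :
  laplacian g x = - ('D_e0 ('D_e0 g) x + 'D_e1 ('D_e1 g) x).
Proof.
rewrite /laplacian big_ord_recl big_ord1.
by rewrite (basis_vecE false) (basis_vecE true).
Qed.

Lemma smooth_laplacian g : smooth g -> smooth (laplacian g).
Proof.
move=> sg; have -> : laplacian g =
    (fun x => (-1) * ('D_e0 ('D_e0 g) x + 'D_e1 ('D_e1 g) x)).
  by apply/funext => x; rewrite laplacianE mulN1r.
by apply: smoothZ; apply: smoothD; do 2 apply: smooth_derive.
Qed.

Lemma pt_decomp v : v = crd false v *: e0 + crd true v *: e1.
Proof.
by apply: ptP => -[]; rewrite crdD !crdZ !crd_pt /= ?mulr0 ?mulr1 ?addr0 ?add0r.
Qed.

Lemma laplacianD f g : smooth f -> smooth g ->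
  laplacian (fun x => f x + g x) = (fun x => laplacian f x + laplacian g x).
Proof.
move=> sf sg; apply/funext => x.
have E v := congr1 (@^~ x) (etrans (congr1 (fun h => 'D_v h) (deriveDE v sf sg))
   (deriveDE v (smooth_derive v sf) (smooth_derive v sg))).
apply: (etrans (laplacianE _ _)).
have -> := E e0; have -> := E e1; have -> := laplacianE f x.
have -> := laplacianE g x.
by rewrite -opprD; congr (- _); rewrite [LHS]addrACA.
Qed.

Lemma laplacianZ (a : R) f : smooth f ->
  laplacian (fun x => a * f x) = (fun x => a * laplacian f x).
Proof.
move=> sf; apply/funext => x.
have E v := congr1 (@^~ x) (etrans (congr1 (fun h => 'D_v h) (deriveZE a v sf))
   (deriveZE a v (smooth_derive v sf))).
apply: (etrans (laplacianE _ _)).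
have -> := E e0; have -> := E e1; have -> := laplacianE f x.
by rewrite -mulrDr mulrN.
Qed.

Definition flip x : 'rV[R]_2 := pt (- crd false x) (crd true x).

Lemma flipK : involutive flip.
Proof. by move=> x; rewrite /flip !crd_pt opprK pt_crd. Qed.

Lemma flip_affine (h : R) v x : flip (h *: v + x) = h *: flip v + flip x.
Proof.
by apply: ptP => -[]; rewrite crdD crdZ !crd_pt crdD crdZ// mulrN opprD.
Qed.

Lemma differentiable_pt (f g : 'rV[R]_2 -> R) x :
  differentiable f x -> differentiable g x ->
  differentiable (fun x => pt (f x) (g x)) x.
Proof.
move=> df dg.
have -> : (fun x => pt (f x) (g x)) = (fun x => f x *: e0) + (fun x => g x *: e1).
  apply/funext => y; apply: ptP => -[]; rewrite fctE crdD !crdZ !crd_pt;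
  by rewrite ?mulr0 ?mulr1 ?addr0 ?add0r.
by apply: differentiableD; apply: differentiableZl.
Qed.

Lemma differentiable_flip x : differentiable flip x.
Proof.
apply: differentiable_pt; last exact/smooth_differentiable/smooth_crd.
by apply: differentiableN; exact/smooth_differentiable/smooth_crd.
Qed.

Lemma smooth_flip g : smooth g -> smooth (g \o flip).
Proof. exact: (smooth_affine flip_affine differentiable_flip). Qed.

Lemma derive_flip g v : 'D_v (g \o flip) = 'D_(flip v) g \o flip.
Proof. by apply/funext => x; exact: (derive_affine _ _ _ flip_affine). Qed.

Lemma flip_e0 : flip e0 = - e0.
Proof.
rewrite -scaleN1r; apply: ptP => -[]; rewrite crdZ !crd_pt /=;
by rewrite ?mulr0 ?mulr1.
Qed.

Lemma flip_e1 : flip e1 = e1.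
Proof. by apply: ptP => -[]; rewrite !crd_pt /= ?oppr0. Qed.

Lemma deriveNv g v : smooth g -> 'D_(- v) g = (fun x => -1 * 'D_v g x).
Proof.
move=> sg; apply/funext => x.
by rewrite -scaleN1r deriveZv//; exact: smooth_differentiable.
Qed.

Lemma derive_flip_e0 g : smooth g ->
  'D_e0 (g \o flip) = (fun x => -1 * ('D_e0 g \o flip) x).
Proof.
move=> sg; apply: (etrans (derive_flip g e0)).
by rewrite flip_e0; have -> := deriveNv e0 sg.
Qed.

Lemma derive_flip_e1 g : 'D_e1 (g \o flip) = 'D_e1 g \o flip.
Proof. by apply: (etrans (derive_flip g e1)); rewrite flip_e1. Qed.

Lemma derive_flip_e00 g : smooth g ->
  'D_e0 ('D_e0 (g \o flip)) = 'D_e0 ('D_e0 g) \o flip.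
Proof.
move=> sg; have sg0 := smooth_derive e0 sg.
apply: (etrans (congr1 (fun h => 'D_e0 h) (derive_flip_e0 sg))).
apply: (etrans (deriveZE (-1) e0 (smooth_flip sg0))).
apply/funext => x; have E := congr1 (@^~ x) (derive_flip_e0 sg0).
by apply: (etrans (congr1 ( *%R (-1)) E)); rewrite !mulN1r opprK.
Qed.

Lemma derive_flip_e11 g : 'D_e1 ('D_e1 (g \o flip)) = 'D_e1 ('D_e1 g) \o flip.
Proof.
apply: (etrans (congr1 (fun h => 'D_e1 h) (derive_flip_e1 g))).
exact: derive_flip_e1.
Qed.

Lemma laplacian_flip g : smooth g -> laplacian (g \o flip) = laplacian g \o flip.
Proof.
move=> sg; apply/funext => x; apply: (etrans (laplacianE _ _)).
apply: (etrans _ (esym (laplacianE _ _))).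
have -> := congr1 (@^~ x) (derive_flip_e00 sg).
by have -> := congr1 (@^~ x) (derive_flip_e11 g).
Qed.

End Plane.
Arguments crd {R} s x : simpl never.

(** * The reflection principle across a straight side *)

Section Reflection.
Context {R : realType}.
Implicit Types (f g w k : 'rV[R]_2 -> R) (x y v : 'rV[R]_2).
Variables (b r : R).
Hypothesis r0 : 0 < r.

Lemma crd_dist_lt s y z : `|crd s y - crd s z| < r - `|crd s z - b| ->
  `|crd s y - b| < r.
Proof.
move=> zy; have -> : crd s y - b = (crd s y - crd s z) + (crd s z - b).
  by rewrite addrA subrK.
by rewrite (le_lt_trans (ler_normD _ _))// -ltrBrDr.
Qed.

Lemma near_crd_dist s z : `|crd s z - b| < r ->
  \forall y \near z, `|crd s y - b| < r.
Proof.
move=> zb; apply/nearP2; exists (r - `|crd s z - b|); first by rewrite subr_gt0.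
by move=> y /(_ s); exact: crd_dist_lt.
Qed.

Let line y := crd false y = 0 /\ `|crd true y - b| < r.

Local Notation "'Ds' vs f" := (foldr (fun v h => 'D_v h) f vs)
  (at level 10, vs at level 8, f at level 8).

Lemma line_derive_e1 f : smooth f -> (forall y, line y -> f y = 0) ->
  forall y, line y -> 'D_e1 f y = 0.
Proof.
move=> sf f0 y ly; apply: derive_side0; first exact: smooth_derivable.
have d0 : 0 < r - `|crd true y - b| by rewrite subr_gt0 ly.2.
have H : \forall h \near (0 : R)^'+,
    [set z | `|crd true z - b| < r] (h *: e1 + y).
  by apply: near_side d0 _ => z /(_ true); exact: crd_dist_lt.
apply: filterS H => h /= H; rewrite (f0 y)// f0//; split=> //.
by rewrite crdD crdZ crd_pt /= mulr0 add0r ly.1.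
Qed.

(** Every derivative of [k] vanishes in the open half box to the right of the line, hence on the
    line by continuity from the right. *)
Lemma line_limit k : smooth k ->
  (forall y, 0 < crd false y < r -> `|crd true y - b| < r -> k y = 0) ->
  forall y, line y -> flat_at k y.
Proof.
move=> sk k0 y [y0 yb] vs.
have F z : 0 < crd false z < r -> `|crd true z - b| < r -> flat_at k z.
  move=> z0 zb; apply: near_eq0_flat.
  have c0 : {for z, continuous (crd false)} by exact: continuous_crd.
  case/andP: z0 => z0 zr.
  have N1 : \forall y \near z, 0 < crd false y := c0 _ (lt_nbhsr z0).
  have N2 : \forall y \near z, crd false y < r := c0 _ (lt_nbhsl zr).
  have N3 : \forall y \near z, `|crd true y - b| < r.
    by apply: near_crd_dist.
  apply: filterS (filterI (filterI N1 N2) N3) => u [[u0 ur] ub].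
  by apply: k0 => //; rewrite u0.
apply: (@continuous_side _ _ _ y e0).
  by apply: smooth_continuous; exact: smooth_foldr.
near=> h; apply: F; rewrite crdD crdZ crd_pt /=.
  rewrite mulr1 y0 addr0; apply/andP; split; near: h.
    exact: nbhs_right_gt.
  exact: nbhs_right_lt.
by rewrite mulr0 add0r.
Unshelve. all: by end_near. Qed.

Lemma foldr_derive vs v f : Ds vs ('D_v f) = Ds (rcons vs v) f.
Proof. by rewrite foldr_rcons. Qed.

Lemma foldr_e0_derive a v f : smooth f ->
  Ds (nseq a e0) ('D_v f) = 'D_v (Ds (nseq a e0) f).
Proof.
move=> sf; elim: a => [//|a IH].
apply: (etrans (congr1 (fun h => 'D_e0 h) IH)).
by apply: schwarz; exact: smooth_foldr.
Qed.

(** Uniqueness in the Cauchy problem at the level of Taylor coefficients: up to a flat term the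
    equation reads D_0^2 w = - l w - D_1^2 w, so normal derivatives of order a + 2 are tangential
    derivatives and multiples of those of order a. *)
Lemma line_normal_derivatives l w : smooth w ->
  (forall y, line y -> w y = 0) -> (forall y, line y -> 'D_e0 w y = 0) ->
  (forall y, line y -> flat_at (fun x => laplacian w x - l * w x) y) ->
  forall a y, line y -> Ds (nseq a e0) w y = 0.
Proof.
move=> sw w0 Dw0 K0.
have sD v : smooth ('D_v w) by exact: smooth_derive.
have sDD u v : smooth ('D_u ('D_v w)) by exact: smooth_derive.
have sL := smooth_laplacian sw.
have E : 'D_e0 ('D_e0 w) = (fun x => -1 * ((laplacian w x - l * w x)
    + (l * w x + 'D_e1 ('D_e1 w) x))).
  have aux (p q s : R) : p = -1 * (- (p + q) - s + (s + q)) by ring.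
  by apply/funext => x; have -> := laplacianE w x; exact: aux.
(* The recursion lowers the order by two, so two consecutive orders are carried through the
   induction. *)
move=> a; suff : (forall y, line y -> Ds (nseq a e0) w y = 0) /\
  (forall y, line y -> Ds (nseq a.+1 e0) w y = 0) by case.
elim: a => [//|a [IH1 IH2]]; split=> // y ly.
have -> : Ds (nseq a.+2 e0) w = Ds (nseq a e0) ('D_e0 ('D_e0 w)).
  apply: esym; apply: (etrans (foldr_e0_derive a e0 (sD e0))).
  exact: (congr1 (fun h => 'D_e0 h) (foldr_e0_derive a e0 sw)).
have sK := smoothB sL (smoothZ l sw); have sS := smoothD (smoothZ l sw) (sDD e1 e1).
rewrite E (foldrZE _ _ (smoothD sK sS)) (foldrDE _ sK sS).
rewrite (foldrDE _ (smoothZ l sw) (sDD e1 e1)) (foldrZE _ _ sw).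
have -> := K0 _ ly (nseq a e0).
rewrite add0r (IH1 _ ly) mulr0 add0r.
have -> := congr1 (@^~ y) (foldr_e0_derive a e1 (sD e1)).
rewrite [X in -1 * X](_ : _ = 0) ?mulr0//; move: y ly; apply: line_derive_e1.
  by apply: smooth_foldr; exact: smooth_derive.
move=> y ly; have -> := congr1 (@^~ y) (foldr_e0_derive a e1 sw).
by move: y ly; apply: line_derive_e1 => //; exact: smooth_foldr.
Qed.

(** By [schwarz] an arbitrary iterated derivative of [w] is a combination of the functions [F c a],
    taken a times along the normal and then c times along the line. Tangential derivatives of a
    function vanishing on the line vanish there too. *)
Lemma line_flat l w : smooth w ->
  (forall y, line y -> w y = 0) -> (forall y, line y -> 'D_e0 w y = 0) ->
  (forall y, line y -> flat_at (fun x => laplacian w x - l * w x) y) ->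
  forall y, line y -> flat_at w y.
Proof.
move=> sw w0 Dw0 K0.
pose F c a := Ds (nseq c e1) (Ds (nseq a e0) w).
have sF c a : smooth (F c a) by do 2 apply: smooth_foldr.
have F0 c a y : line y -> F c a y = 0.
  elim: c y => [|c IH] y ly; first exact: (line_normal_derivatives sw w0 Dw0 K0).
  exact: (line_derive_e1 (sF c a) IH ly).
have Fe0 c a : 'D_e0 (F c a) = F c a.+1.
  elim: c => [//|c IH].
  apply: (etrans _ (congr1 (fun h => 'D_e1 h) IH)).
  by apply: schwarz; exact: sF.
suff H vs c a y : line y -> Ds vs (F c a) y = 0.
  by move=> y ly vs; exact: (H vs 0%N 0%N).
elim/last_ind: vs c a y => [|vs v IH] c a y ly; first exact: F0.
rewrite -foldr_derive.
have -> : 'D_v (F c a) =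
    (fun x => crd false v * F c a.+1 x + crd true v * F c.+1 a x).
  apply/funext => x; rewrite {1}(pt_decomp v) deriveDv; last first.
    exact: smooth_differentiable.
  rewrite !deriveZv; [|exact: smooth_differentiable..].
  by have -> := congr1 (@^~ x) (Fe0 c a).
rewrite foldrDE; [|exact: smoothZ..].
by rewrite !foldrZE// !IH// !mulr0 addr0.
Qed.

Lemma foldr_flip k vs : Ds vs (k \o flip) = Ds (map flip vs) k \o flip.
Proof.
elim: vs => [//|v vs IH].
apply: (etrans (congr1 (fun h => 'D_v h) IH)); exact: derive_flip.
Qed.

Lemma flat_flip k y : crd false y = 0 -> flat_at k y -> flat_at (k \o flip) y.
Proof.
move=> y0 fk vs; rewrite foldr_flip /=.
by have -> : flip y = y by rewrite /flip y0 oppr0 -y0 pt_crd.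
Qed.

Definition sgn (t : bool) : R := if t then 1 else -1.

Lemma sgn_mul t : sgn t * sgn t = 1.
Proof. by case: t; rewrite /sgn ?mulr1// mulrNN mulr1. Qed.

Lemma flip_line y : line y -> flip y = y.
Proof. by move=> [y0 _]; rewrite /flip y0 oppr0 -y0 pt_crd. Qed.

(** The case [t = true] is Neumann. One half of the Cauchy data of the difference vanishes by the
    parity of the reflection, the other half by the boundary condition. The defect of its equation
    is k - [sgn t] (k o flip), where k, the defect for [g], vanishes to the right of the line and so
    is flat on it. *)
Lemma reflection_flat (t : bool) l g : smooth g ->
  (forall y, 0 < crd false y < r -> `|crd true y - b| < r ->
     laplacian g y = l * g y) ->
  (forall y, line y -> if t then 'D_e0 g y = 0 else g y = 0) ->
  forall y, line y -> flat_at (fun x => g x + - sgn t * (g \o flip) x) y.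
Proof.
move=> sg eqg bg.
have sf := smooth_flip sg; have sL := smooth_laplacian sg.
have sw := smoothD sg (smoothZ (- sgn t) sf).
pose k x := laplacian g x - l * g x.
have sk : smooth k := smoothB sL (smoothZ l sg).
have k0 : forall y, line y -> flat_at k y.
  by apply: line_limit => // y y0 yb; rewrite /k eqg// subrr.
apply: (line_flat (l := l) sw) => y ly.
- rewrite /= flip_line//; have := bg y ly; case: t {sw bg} => [_|->].
    by rewrite mulN1r subrr.
  by rewrite mulr0 addr0.
- have -> := congr1 (@^~ y) (deriveDE e0 sg (smoothZ (- sgn t) sf)).
  have -> := congr1 (@^~ y) (deriveZE (- sgn t) e0 sf).
  have -> := congr1 (@^~ y) (derive_flip_e0 sg).
  rewrite /= flip_line//; have := bg y ly; case: t {sw bg} => [->|_].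
    by rewrite !mulr0 addr0.
  by rewrite opprK mul1r mulN1r subrr.
have E : (fun x => laplacian (fun x => g x + - sgn t * (g \o flip) x) x -
    l * (g x + - sgn t * (g \o flip) x)) =
    (fun x => k x + - sgn t * (k \o flip) x).
  apply/funext => x.
  have -> := congr1 (@^~ x) (laplacianD sg (smoothZ (- sgn t) sf)).
  have -> := congr1 (@^~ x) (laplacianZ (- sgn t) sf).
  have -> := congr1 (@^~ x) (laplacian_flip sg).
  by rewrite /k /= mulrBr mulrDr opprD addrACA [l * (_ * _)]mulrCA.
rewrite E => vs; rewrite foldrDE//; last first.
  by apply: smoothZ; exact: smooth_flip.
rewrite foldrZE; last exact: smooth_flip.
by rewrite (k0 _ ly) (flat_flip ly.1 (k0 _ ly)) mulr0 addr0.
Qed.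

(** The signed mirror image of [g] is kept in the whole plane, and the difference, flat on the line
    and cut off in the tangential direction, is added on the right half only. *)
Lemma reflection_ext (t : bool) l g : smooth g ->
  (forall y, 0 < crd false y < r -> `|crd true y - b| < r ->
     laplacian g y = l * g y) ->
  (forall y, line y -> if t then 'D_e0 g y = 0 else g y = 0) ->
  exists2 G, smooth G & exists2 d, 0 < d & forall y, `|crd true y - b| < d ->
    (0 <= crd false y -> G y = g y) /\
    (crd false y <= 0 -> G y = sgn t * g (flip y)).
Proof.
move=> sg eqg bg; have fw := reflection_flat sg eqg bg.
have sf := smooth_flip sg.
have sw := smoothD sg (smoothZ (- sgn t) sf).
set w := (fun x => _) in fw sw.
have r20 : 0 < r / 2 by rewrite divr_gt0.
have [eta seta [eta0 [r' r'0 eta1]]] :=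
  smooth_cutoff (lift ord0 ord0 : 'I_2) b r20.
have few x : x ord0 ord0 = 0 -> flat_at (fun x => eta x * w x) x.
  move=> x0; have [xb|xb] := ltP `|crd true x - b| r.
    by apply: flatM => //; exact: fw.
  (* The cutoff has radius r/2, so around a point of the line at distance at least r from b it
     vanishes in a box of size r/2. *)
  apply: near_eq0_flat; apply/nearP2; exists (r / 2) => // y /(_ true) yx.
  rewrite eta0 ?mul0r//; rewrite leNgt; apply/negP => yb.
  move: xb; rewrite leNgt => /negP; apply.
  rewrite [r]splitr (le_lt_trans (ler_distD (crd true y) _ _))// ltrD//.
  by rewrite distrC.
exists (fun x => (if 0 <= x ord0 ord0 then eta x * w x else 0) +
                 sgn t * (g \o flip) x).
  apply: smoothD; last exact: smoothZ.
  exact: (smooth_half (smoothM seta sw) few).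
exists (Num.min r' r); first by rewrite lt_min r'0.
move=> y; rewrite lt_min => /andP[yr' yr].
have etay : eta y = 1 by exact: eta1.
split=> y0.
  by rewrite ifT// etay mul1r /w mulNr subrK.
have [yE|yn] := eqVneq (crd false y) 0.
  have /= -> := fw y (conj yE yr) [::].
  by rewrite mulr0 if_same add0r.
by rewrite ifF ?add0r//; apply/negbTE; rewrite -ltNge lt_neqAle yn.
Qed.

End Reflection.

(** * The octagon *)

Section Rigid.
Context {R : realType}.
Implicit Types (x y v : 'rV[R]_2) (g : 'rV[R]_2 -> R).

(** A symmetry of the coordinate cross followed by a translation; [s] tells whether the axes are
    exchanged. These motions suffice because all glued sides are parallel to the axes. *)
Definition rig (s a b : bool) (p q : R) x : 'rV[R]_2 :=
  pt (sgn a * crd s x + p) (sgn b * crd (~~ s) x + q).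

Definition rigid (t : 'rV[R]_2 -> 'rV[R]_2) :=
  exists s a b p q, t = rig s a b p q.

Lemma rig_affine s a b p q (h : R) v x :
  rig s a b p q (h *: v + x) = h *: rig s a b 0 0 v + rig s a b p q x.
Proof.
by apply: ptP => -[]; rewrite crdD crdZ !crd_pt crdD crdZ addr0 mulrDr addrA mulrCA.
Qed.

Lemma rig_inv s a b p q : exists2 t, rigid t &
  cancel (rig s a b p q) t /\ cancel t (rig s a b p q).
Proof.
have aa := @sgn_mul R a; have bb := @sgn_mul R b.
case: s.
  exists (rig true b a (- (sgn b * q)) (- (sgn a * p))).
    by exists true, b, a, (- (sgn b * q)), (- (sgn a * p)).
  split=> x; apply: ptP => -[]; rewrite /rig !crd_pt /= mulrDr ?mulrN !mulrA ?aa ?bb;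
  by rewrite !mul1r ?addrK ?subrK.
exists (rig false a b (- (sgn a * p)) (- (sgn b * q))).
  by exists false, a, b, (- (sgn a * p)), (- (sgn b * q)).
split=> x; apply: ptP => -[]; rewrite /rig !crd_pt /= mulrDr ?mulrN !mulrA ?aa ?bb;
by rewrite !mul1r ?addrK ?subrK.
Qed.

Lemma rigid_inv t : rigid t -> exists2 t', rigid t' & cancel t t' /\ cancel t' t.
Proof. by move=> [s [a [b [p [q ->]]]]]; exact: rig_inv. Qed.

Lemma differentiable_rig s a b p q x : differentiable (rig s a b p q) x.
Proof.
have H c k r : differentiable (fun x : 'rV[R]_2 => sgn c * crd k x + r) x.
  apply: smooth_differentiable; apply: smoothD; last exact: smooth_cst.
  by apply: smoothZ; exact: smooth_crd.
by apply: differentiable_pt; exact: H.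
Qed.

Lemma rigid_continuous t : rigid t -> continuous t.
Proof.
move=> [s [a [b [p [q ->]]]]] x.
exact/differentiable_continuous/differentiable_rig.
Qed.

Lemma smooth_rigid g t : rigid t -> smooth g -> smooth (g \o t).
Proof.
move=> [s [a [b [p [q ->]]]]].
exact: (smooth_affine (rig_affine s a b p q) (differentiable_rig s a b p q)).
Qed.

Lemma sqdistE x y : sqdist x y =
  (crd false x - crd false y) ^+ 2 + (crd true x - crd true y) ^+ 2.
Proof. by rewrite /sqdist big_ord_recl big_ord1. Qed.

Lemma sqdist_rigid t x y : rigid t -> sqdist (t x) (t y) = sqdist x y.
Proof.
move=> [s [a [b [p [q ->]]]]]; rewrite !sqdistE /rig !crd_pt.
have E c (u w r : R) : (sgn c * u + r - (sgn c * w + r)) ^+ 2 = (u - w) ^+ 2.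
  rewrite opprD addrACA subrr addr0 -mulrBr exprMn.
  by rewrite [sgn c ^+ 2]expr2 sgn_mul mul1r.
by case: s; rewrite /= !E// addrC.
Qed.

Lemma derive_rig g s a b p q v :
  'D_v (g \o rig s a b p q) = 'D_(rig s a b 0 0 v) g \o rig s a b p q.
Proof. by apply/funext => x; exact: (derive_affine _ _ _ (rig_affine _ _ _ _ _)). Qed.

Definition ax (s : bool) : 'rV[R]_2 := if s then e1 else e0.

Lemma rig_ax s a b k : rig s a b 0 0 (ax k) =
  sgn (if k == s then a else b) *: ax (k != s).
Proof.
apply: ptP => j; rewrite crdZ /rig crd_pt !addr0 /ax /e0 /e1.
by case: s k j => -[] []; rewrite /= !crd_pt /= ?mulr0 ?mulr1.
Qed.

Lemma derive2_sgn g (a : bool) v : smooth g ->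
  'D_(sgn a *: v) ('D_(sgn a *: v) g) = 'D_v ('D_v g).
Proof.
move=> sg.
have E (f : 'rV[R]_2 -> R) : smooth f -> 'D_(sgn a *: v) f = (fun x => sgn a * 'D_v f x).
  by move=> sf; apply/funext => x; apply: deriveZv; exact: smooth_differentiable.
apply: (etrans (E _ (smooth_derive _ sg))).
apply/funext => x; have -> := congr1 (fun h : 'rV[R]_2 -> R => 'D_v h x) (E _ sg).
have -> := congr1 (@^~ x) (deriveZE (sgn a) v (smooth_derive v sg)).
by rewrite mulrA sgn_mul mul1r.
Qed.

Lemma derive2_rig g s a b p q k : smooth g ->
  'D_(ax k) ('D_(ax k) (g \o rig s a b p q)) =
  'D_(ax (k != s)) ('D_(ax (k != s)) g) \o rig s a b p q.
Proof.
move=> sg; apply: (etrans (congr1 (fun h => 'D_(ax k) h) (derive_rig g s a b p q (ax k)))).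
apply: (etrans (derive_rig ('D_(rig s a b 0 0 (ax k)) g) s a b p q (ax k))).
apply: (etrans (congr1 (fun v => 'D_v ('D_v g) \o rig s a b p q)
  (rig_ax s a b k))).
exact: (congr1 (fun h => h \o rig s a b p q)
  (derive2_sgn (if k == s then a else b) (ax (k != s)) sg)).
Qed.

Lemma laplacian_rigid g t : rigid t -> smooth g ->
  laplacian (g \o t) = laplacian g \o t.
Proof.
move=> [s [a [b [p [q ->]]]]] sg; apply/funext => x.
apply: (etrans (laplacianE _ _)); apply: (etrans _ (esym (laplacianE _ _))).
have E0 := congr1 (@^~ x) (derive2_rig s a b p q false sg).
have E1 := congr1 (@^~ x) (derive2_rig s a b p q true sg).
apply: (congr1 -%R); apply: (etrans (f_equal2 +%R E0 E1)).
case: s {E0 E1}; first exact: addrC.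
exact: erefl.
Qed.

End Rigid.

(** * The octagon, its coloured sides and the reflections in them *)

Section Octagon.
Context {R : realType}.
Implicit Types (x y : 'rV[R]_2) (c : bool * bool) (u v : R).

(* The side c = (s, e) of the octagon lies on the line where the coordinate s
   equals 2 or -2; ucr c and vcr c are the normal and tangential coordinates. *)
Definition ucr c x := sgn c.2 * crd c.1 x.
Definition vcr c x := crd (~~ c.1) x.

Definition pl c u v : 'rV[R]_2 :=
  if c.1 then pt v (sgn c.2 * u) else pt (sgn c.2 * u) v.

Lemma ucr_pl c u v : ucr c (pl c u v) = u.
Proof. by case: c => -[] e; rewrite /ucr /pl crd_pt /= mulrA sgn_mul mul1r. Qed.

Lemma vcr_pl c u v : vcr c (pl c u v) = v.
Proof. by case: c => -[] e; rewrite /vcr /pl crd_pt. Qed.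

Lemma pl_cr c x : pl c (ucr c x) (vcr c x) = x.
Proof.
by case: c => -[] e; rewrite /pl /ucr /vcr /= mulrA sgn_mul mul1r pt_crd.
Qed.

Lemma crP c x y : ucr c x = ucr c y -> vcr c x = vcr c y -> x = y.
Proof. by move=> xu xv; rewrite -(pl_cr c x) -(pl_cr c y) xu xv. Qed.

Definition oct x : bool :=
  [&& `|crd false x| <= 2, `|crd true x| <= 2 &
      `|crd false x| + `|crd true x| <= 3].

Definition octi x : bool :=
  [&& `|crd false x| < 2, `|crd true x| < 2 &
      `|crd false x| + `|crd true x| < 3].

Lemma norm_ucr c x : `|ucr c x| = `|crd c.1 x|.
Proof.
by rewrite /ucr normrM; case: c.2; rewrite /sgn ?normrN normr1 mul1r.
Qed.

Lemma octE c x : oct x =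
  [&& `|ucr c x| <= 2, `|vcr c x| <= 2 & `|ucr c x| + `|vcr c x| <= 3].
Proof. by rewrite norm_ucr /oct /vcr; case: c.1 => //=; rewrite andbCA addrC. Qed.

Lemma octiE c x : octi x =
  [&& `|ucr c x| < 2, `|vcr c x| < 2 & `|ucr c x| + `|vcr c x| < 3].
Proof. by rewrite norm_ucr /octi /vcr; case: c.1 => //=; rewrite andbCA addrC. Qed.

Definition edge c x : bool := oct x && (ucr c x == 2).

Lemma edge_vcr c x : edge c x -> `|vcr c x| <= 1.
Proof.
rewrite /edge (octE c) => /andP[/and3P[_ _ H] /eqP E].
by move: H; rewrite E ger0_norm//; lra.
Qed.

Lemma edge_disj c c' x : edge c x -> edge c' x -> c = c'.
Proof.
move=> ec /andP[_ /eqP u']; have v1 := edge_vcr ec.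
case/andP: ec => _ /eqP u; move: u u' v1.
case: c c' => [[] []] [[] []]; rewrite /ucr /vcr /sgn /= ?mul1r ?mulN1r //;
  rewrite ler_norml => ? ? /andP[? ?]; exfalso; lra.
Qed.

(** The reflection in the line u = 2, which carries the side [c]. *)
Definition sigma c x := pl c (4 - ucr c x) (vcr c x).

Lemma sigma_rigid c : rigid (sigma c).
Proof.
case: c => -[] e.
  exists false, true, false, 0, (sgn e * 4); apply/funext => x.
  apply: ptP => -[]; rewrite /sigma /pl /rig !crd_pt /ucr /vcr /sgn /=.
    by case: e; ring.
  by rewrite mul1r addr0.
exists false, false, true, (sgn e * 4), 0; apply/funext => x.
apply: ptP => -[]; rewrite /sigma /pl /rig !crd_pt /ucr /vcr /sgn /=.
  by rewrite mul1r addr0.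
by case: e; ring.
Qed.

Lemma sigmaK c : involutive (sigma c).
Proof.
move=> x; apply: (@crP c); rewrite /sigma ?ucr_pl ?vcr_pl //.
by rewrite opprB addrC subrK.
Qed.

Lemma sigma_edge c x : edge c x -> sigma c x = x.
Proof.
move=> /andP[_ /eqP xu]; apply: (@crP c); rewrite /sigma ?ucr_pl ?vcr_pl //.
by rewrite xu; lra.
Qed.

Lemma ucr_continuous c : continuous (ucr c).
Proof. by apply: smooth_continuous; apply: smoothZ; exact: smooth_crd. Qed.

Lemma vcr_continuous c : continuous (vcr c).
Proof. exact: continuous_crd. Qed.

Lemma near_lt (f : 'rV[R]_2 -> R) x (a : R) : {for x, continuous f} -> f x < a ->
  \forall y \near x, f y < a.
Proof. by move=> cf fa; exact: (cf _ (lt_nbhsl fa)). Qed.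

Lemma near_gt (f : 'rV[R]_2 -> R) x (a : R) : {for x, continuous f} -> a < f x ->
  \forall y \near x, a < f y.
Proof. by move=> cf fa; exact: (cf _ (lt_nbhsr fa)). Qed.

Lemma norm_crd_continuous s : continuous (fun x => `|crd s x|).
Proof.
move=> x; apply: (@continuous_comp _ _ _ (crd s) Num.norm).
  exact: continuous_crd.
exact: norm_continuous.
Qed.

Lemma sum_crd_continuous : continuous (fun x => `|crd false x| + `|crd true x|).
Proof.
move=> x.
have c0 := @norm_crd_continuous false x; have c1 := @norm_crd_continuous true x.
exact: (cvgD c0 c1).
Qed.

Lemma near_octi x : octi x -> \forall y \near x, octi y.
Proof.
move=> /and3P[x0 x1 x2].
have N0 := near_lt (@norm_crd_continuous false x) x0.
have N1 := near_lt (@norm_crd_continuous true x) x1.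
have N2 := near_lt (@sum_crd_continuous x) x2.
by apply: filterS (filterI (filterI N0 N1) N2) => y [[? ?] ?]; apply/and3P.
Qed.

Lemma near_not_oct x : ~~ oct x -> \forall y \near x, ~~ oct y.
Proof.
rewrite /oct !negb_and -!ltNge => /or3P[] H.
- have N := near_gt (@norm_crd_continuous false x) H.
  by apply: filterS N => y; rewrite negb_and -ltNge => ->.
- have N := near_gt (@norm_crd_continuous true x) H.
  by apply: filterS N => y; rewrite !negb_and -!ltNge => ->; rewrite orbT.
- have N := near_gt (@sum_crd_continuous x) H.
  by apply: filterS N => y; rewrite !negb_and -!ltNge => ->; rewrite !orbT.
Qed.

Lemma near_not_edge c x : ~~ edge c x -> \forall y \near x, ~~ edge c y.
Proof.
rewrite negb_and => /orP[/near_not_oct|].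
  by apply: filterS => y ny; rewrite /edge negb_and ny.
rewrite neq_lt => /orP[] H.
  have N := near_lt (@ucr_continuous c x) H.
  by apply: filterS N => y ny; rewrite /edge negb_and neq_lt ny orbT.
have N := near_gt (@ucr_continuous c x) H.
by apply: filterS N => y ny; rewrite /edge negb_and neq_lt ny !orbT.
Qed.

End Octagon.
Arguments oct {R} x : simpl never.
Arguments octi {R} x : simpl never.
Arguments edge {R} c x : simpl never.

(* A gluing pattern for copies of the octagon: act c i is the copy glued to the
   copy i along the side c, or i itself if that side is left free, in which
   case neu c i tells whether the side is a Neumann side. *)
Record pattern := Pattern {
  tile : finType;
  tile0 : tile;
  act : bool * bool -> tile -> tile;
  actK : forall c, involutive (act c);
  neu : bool * bool -> tile -> bool
}.

(** * Glued octagons *)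

Section Gluing.
Context {R : realType} (G : pattern).
Implicit Types (x y : 'rV[R]_2) (i j k : tile G) (c : bool * bool).

(** The coloured sides are disjoint, so a point lies on at most one of them and is shared by at most
    two tiles: one step across a side already gives the whole equivalence class. *)
Definition cls i x : {set tile G} :=
  [set j | (j == i) || [exists c, edge c x && (j == act c i)]]%SET.

Lemma mem_cls i x : i \in cls i x.
Proof. by rewrite inE eqxx. Qed.

Lemma clsP i j x :
  reflect (j = i \/ exists2 c, edge c x & j = act c i) (j \in cls i x).
Proof.
rewrite inE; apply: (iffP orP) => [[/eqP|/existsP[c /andP[xc /eqP ->]]]|].
- by left.
- by right; exists c.
move=> [->|[c xc ->]]; first by left.
by right; apply/existsP; exists c; rewrite xc eqxx.
Qed.

Lemma mem_cls_act i c x : edge c x -> act c i \in cls i x.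
Proof. by move=> xc; apply/clsP; right; exists c. Qed.

Lemma cls_edge i c x : edge c x -> cls i x = [set i; act c i]%SET.
Proof.
move=> xc; apply/finset.setP => j; rewrite !inE; congr (_ || _).
apply/existsP/eqP => [[c' /andP[xc' /eqP ->]]|->]; last by exists c; rewrite xc/=.
by rewrite (edge_disj xc xc').
Qed.

Lemma cls_eq i j x : j \in cls i x -> cls j x = cls i x.
Proof.
case/clsP => [->//|[c xc ->]].
by rewrite !(cls_edge _ xc) actK finset.setUC.
Qed.

Definition glue_pred (p : 'rV[R]_2 * {set tile G}) : bool :=
  oct p.1 && [exists i, p.2 == cls i p.1].

(** A point is recorded as its position in the octagon together with the set of all tiles containing
    it. This canonical form realises the quotient of the disjoint union of the tiles. *)
Definition glued : Type := {p : 'rV[R]_2 * {set tile G} | glue_pred p}.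
HB.instance Definition _ := SubChoice.copy glued {p | glue_pred p}.

Definition fold (p : glued) : 'rV[R]_2 := (val p).1.
Definition blk (p : glued) : {set tile G} := (val p).2.

Lemma oct0 : oct (0 : 'rV[R]_2).
Proof. by rewrite /oct /crd !mxE !normr0 addr0 !ler0n. Qed.

Lemma glue_pred_cls i x : oct x -> glue_pred (x, cls i x).
Proof. by move=> ox; rewrite /glue_pred ox; apply/existsP; exists i. Qed.

Definition glue0 : glued := exist (fun p => glue_pred p) (0, cls (tile0 G) 0)
  (glue_pred_cls (tile0 G) oct0).

(** Meaningful for [x] in the octagon; any other [x] is sent to the default point [glue0]. *)
Definition glue i x : glued := insubd glue0 (x, cls i x).

Lemma val_glue i x : oct x -> val (glue i x) = (x, cls i x).
Proof. by move=> ox; rewrite val_insubd glue_pred_cls. Qed.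

Lemma fold_glue i x : oct x -> fold (glue i x) = x.
Proof. by move=> ox; rewrite /fold val_glue. Qed.

Lemma blk_glue i x : oct x -> blk (glue i x) = cls i x.
Proof. by move=> ox; rewrite /blk val_glue. Qed.

Lemma oct_fold p : oct (fold p).
Proof. by case/andP: (valP p). Qed.

Lemma glueP p : exists2 i, i \in blk p & p = glue i (fold p).
Proof.
case/andP: (valP p) => op /existsP[i /eqP pE]; exists i.
  by rewrite /blk pE mem_cls.
by apply/val_inj; rewrite val_glue// /fold -pE; case: (val p).
Qed.

Lemma glue_fold i p : i \in blk p -> p = glue i (fold p).
Proof.
have [j jp pE] := glueP p; have op := oct_fold p.
rewrite [in blk p]pE blk_glue// => ij; rewrite [LHS]pE.
by apply/val_inj; rewrite !val_glue// (cls_eq ij).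
Qed.

Lemma glue_eq i j x : oct x -> j \in cls i x -> glue j x = glue i x.
Proof. by move=> ox ji; apply/val_inj; rewrite !val_glue// (cls_eq ji). Qed.

Lemma glue_act i c x : edge c x -> glue (act c i) x = glue i x.
Proof. by move=> xc; case/andP: (xc) => ox _; apply/glue_eq/mem_cls_act. Qed.

(** The quotient topology of the disjoint union of octagons, tested tile by tile. *)
Definition glue_open (U : set glued) : Prop :=
  forall i x, oct x -> U (glue i x) -> \forall y \near x, oct y -> U (glue i y).

Program Definition glued_topology := @isOpenTopological.Build glued glue_open _ _ _.
Next Obligation. by move=> i x _ _; apply: filterS filterT. Qed.
Next Obligation.
move=> A B oA oB i x ox [Ax Bx].
apply: filterS (filterI (oA i x ox Ax) (oB i x ox Bx)) => y [Ay By] oy.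
by split; [exact: Ay|exact: By].
Qed.
Next Obligation.
move=> J f of_ i x ox [j _ fx].
by apply: filterS (of_ j i x ox fx) => y fy oy; exists j => //; exact: fy.
Qed.
HB.instance Definition _ := glued_topology.

Lemma near_glue p (W : set glued) i : nbhs p W -> i \in blk p ->
  \forall y \near fold p, oct y -> W (glue i y).
Proof.
rewrite nbhsE => -[U [oU Up] UW] ip; rewrite (glue_fold ip) in Up.
by apply: filterS (oU i _ (oct_fold p) Up) => y Uy oy; apply/UW/Uy.
Qed.

Lemma glue_continuous (T : topologicalType) (D : set glued) (f : glued -> T) :
  open D ->
  (forall i x, oct x -> D (glue i x) -> exists2 g, {for x, continuous g} &
    g x = f (glue i x) /\
    \forall y \near x, oct y -> D (glue i y) -> f (glue i y) = g y) ->
  forall p, D p -> {for p, continuous f}.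
Proof.
move=> oD H p Dp B; rewrite nbhsE => -[V [oV Vp] VB].
suff oU : open (D `&` (f @^-1` V)).
  by rewrite nbhsE; exists (D `&` (f @^-1` V)) => // q [_] /VB.
move=> i x ox [Dx Vx]; have [g cg [gx fg]] := H i x ox Dx.
have N : \forall y \near x, V (g y).
  by apply: cg; rewrite gx; apply: open_nbhs_nbhs.
apply: filterS (filterI (filterI N fg) (oD i x ox Dx)) => y [[Vgy fgy] Dy] oy.
by split; [exact: Dy|rewrite /= fgy//; exact: Dy].
Qed.

Lemma fold_continuous : continuous fold.
Proof.
move=> p; apply: (@glue_continuous _ setT) => //; first exact: openT.
move=> i x ox _; exists id; first exact: cvg_id.
split; first by rewrite fold_glue.
by apply: filterS filterT => y _ oy _; rewrite fold_glue.
Qed.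

Lemma glue_cvg i x : oct x ->
  glue i @ within [set y | oct y] (nbhs x) --> glue i x.
Proof.
move=> ox W; rewrite nbhsE => -[U [oU Ux] UW].
apply: filterS (oU i x ox Ux) => y Uy oy; exact/UW/Uy.
Qed.

Lemma glue_within_continuous i : {within [set x | oct x], continuous (glue i)}.
Proof. by apply/subspace_continuousP => x ox; exact: glue_cvg. Qed.

Lemma glue_comp_continuous (S : topologicalType) (h : S -> 'rV[R]_2) i :
  continuous h -> (forall s, oct (h s)) -> continuous (fun s => glue i (h s)).
Proof.
move=> ch oh s W Ws.
have N : \forall t \near s, oct (h t) -> W (glue i (h t)) :=
  ch s _ (@glue_cvg i _ (oh s) W Ws).
by apply: filterS N => t /(_ (oh t)).
Qed.

(** Lying off a closed side is an open condition, so nearby points belong to no further tile. *)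
Lemma near_blk p : \forall q \near p, blk q \subset blk p.
Proof.
pose U := [set q | blk q \subset blk p /\
                   forall c, edge c (fold q) -> edge c (fold p)].
suff oU : open U.
  by rewrite -nbhs_nearE nbhsE; exists U => // q [].
move=> i x ox [ip xp].
have N : \forall y \near x, forall c, edge c y -> edge c x.
  have F := @filter_forall _ _ (fun c y => edge c y -> edge c x) (nbhs x) _.
  apply: F => c.
  have [xc|/near_not_edge] := boolP (edge c x).
    by apply: filterS filterT.
  by apply: filterS => y /negbTE ->.
rewrite blk_glue// in ip; rewrite fold_glue// in xp.
apply: filterS N => y yx oy; split; last by move=> c; rewrite fold_glue// => /yx/xp.
rewrite blk_glue//; apply/fintype.subsetP => j /clsP[->|[c /yx xc ->]].
  by apply: (fintype.subsetP ip); exact: mem_cls.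
by apply: (fintype.subsetP ip); exact: mem_cls_act.
Qed.

(** Points with different positions are separated by [fold]. Distinct points with the same position
    have no tile in common, and then neither do their neighbourhoods from [near_blk]. *)
Lemma glued_hausdorff : hausdorff_space glued.
Proof.
rewrite open_hausdorff => p q pq.
have [fpq|fpq] := eqVneq (fold p) (fold q); last first.
  have H : hausdorff_space 'rV[R]_2 by exact: norm_hausdorff.
  rewrite open_hausdorff in H.
  have [[A B] /= [Ap Bq] [oA oB AB]] := H _ _ fpq.
  exists (fold @^-1` A, fold @^-1` B); first by split; rewrite inE/= -in_setE.
  split=> /=.
  - by apply: open_comp => // ? _; exact: fold_continuous.
  - by apply: open_comp => // ? _; exact: fold_continuous.
  - by rewrite -preimage_setI (eqP AB) preimage_set0.
have [U [oU Up] Us] : exists2 U, open_nbhs p U & U `<=` [set r | blk r \subset blk p].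
  by have := near_blk p; rewrite -nbhs_nearE nbhsE.
have [V [oV Vq] Vs] : exists2 U, open_nbhs q U & U `<=` [set r | blk r \subset blk q].
  by have := near_blk q; rewrite -nbhs_nearE nbhsE.
exists (U, V); first by rewrite !inE.
split=> //=; apply/eqP/seteqP; split=> // r [/Us /= rp /Vs /= rq].
have [i ir _] := glueP r.
have ip := fintype.subsetP rp _ ir; have iq := fintype.subsetP rq _ ir.
by move/eqP: pq; apply; rewrite (glue_fold ip) (glue_fold iq) fpq.
Qed.

Lemma oct_closed : closed [set x : 'rV[R]_2 | oct x].
Proof.
rewrite -openC openE => x /= /negP/near_not_oct.
by apply: filterS => y /= /negP.
Qed.

Lemma oct_compact : compact [set x : 'rV[R]_2 | oct x].
Proof.
have C : compact [set v : 'rV[R]_2 | forall a, `[(- 2 : R), 2]%classic (v ord0 a)].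
  by apply: (@rV_compact _ _ (fun=> `[(- 2 : R), 2]%classic)) => _; exact: segment_compact.
apply: subclosed_compact oct_closed C _ => v /= /and3P[v0 v1 _] a.
rewrite /= in_itv /= -ler_norml.
by case: (unliftP ord0 a) v0 v1 => [k|] ->; rewrite ?(ord1 k).
Qed.

Lemma glued_compact : compact [set: glued].
Proof.
have -> : [set: glued] = \big[setU/set0]_(i : tile G) (glue i @` [set x | oct x]).
  apply/seteqP; split=> // p _; have [i _ pE] := glueP p.
  by rewrite -bigcup_seq; exists i; [exact: mem_index_enum|exists (fold p); [exact: oct_fold|]].
elim/big_ind: _ => [|A B cA cB|i _]; first exact: compact0.
  exact: compactU.
apply: continuous_compact; last exact: oct_compact.
exact: glue_within_continuous.
Qed.

End Gluing.
Arguments glue {R G} i x.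

(** * Charts assembled from rigid motions on tiles *)

Section Plaques.
Context {R : realType} {G : pattern}.
Implicit Types (x y z : 'rV[R]_2) (i j k : tile G) (c : bool * bool).

(* The data of a chart which reads each tile j of pJ by a rigid motion ptau j;
   only the part of the coordinate plane in pwin is used. *)
Record plaque := Plaque {
  pJ : pred (tile G);
  ptau : tile G -> 'rV[R]_2 -> 'rV[R]_2;
  pwin : set 'rV[R]_2;
  pprof : 'rV[R]_1 -> R;
  p_rigid : forall j, rigid (ptau j);
  p_open : open pwin;
  p_profile : piecewise_smooth pprof;
  p_act : forall c j x, edge c x -> pJ j -> pwin (ptau j x) -> act c j != j ->
    pJ (act c j) /\ forall y, ptau (act c j) (sigma c y) = ptau j y;
  p_epi1 : forall j x, pJ j -> oct x -> pwin (ptau j x) ->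
    epigraph pprof (ptau j x);
  p_epi2 : forall z, pwin z -> epigraph pprof z ->
    exists j x, [/\ pJ j, oct x & ptau j x = z];
  p_inj : forall j k x y, pJ j -> pJ k -> oct x -> oct y -> pwin (ptau j x) ->
    ptau j x = ptau k y -> glue j x = glue k y
}.

Variable P : plaque.

Definition pdom : set (@glued R G) :=
  [set q | exists j, [/\ j \in blk q, pJ P j & pwin P (ptau P j (fold q))]].

Definition pcoord (q : @glued R G) : 'rV[R]_2 :=
  ptau P (odflt (tile0 G) [pick j in blk q | pJ P j]) (fold q).

(** Independence of the representing tile: a second tile at the same point lies across a glued side,
    and [p_act] makes both readings agree there because [sigma] fixes that side. *)
Lemma cls_win i k x : oct x -> k \in cls i x -> pJ P k -> pwin P (ptau P k x) ->
  pJ P i /\ ptau P i x = ptau P k x.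
Proof.
move=> ox ki Jk wk; case/clsP: ki => [ki|[c xc ki]]; first by rewrite ki in Jk *.
have ik : i = act c k by rewrite ki actK.
have [kE|kn] := eqVneq (act c k) k; first by rewrite ik kE.
have [Ji tauE] := p_act xc Jk wk kn.
by rewrite ik; split=> //; rewrite -tauE sigma_edge.
Qed.

Lemma pdom_glue i x : oct x ->
  pdom (glue i x) <-> pJ P i /\ pwin P (ptau P i x).
Proof.
move=> ox; split=> [[j []]|[Ji wi]]; last first.
  by exists i; rewrite blk_glue// mem_cls fold_glue.
rewrite blk_glue// fold_glue// => ji Jj wj.
by have [Ji E] := cls_win ox ji Jj wj; rewrite E.
Qed.

Lemma pcoord_glue i x : oct x -> pdom (glue i x) -> pcoord (glue i x) = ptau P i x.
Proof.
move=> ox /(pdom_glue i ox)[Ji wi]; rewrite /pcoord blk_glue// fold_glue//.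
case: pickP => [j /andP[ji Jj]|/(_ i)]; last by rewrite mem_cls Ji.
have ij : i \in cls j x by rewrite (cls_eq ji) mem_cls.
by have [_] := cls_win ox ij Ji wi.
Qed.

Lemma ptau_continuous i : continuous (ptau P i).
Proof. by apply: rigid_continuous; exact: p_rigid. Qed.

Lemma near_win i x : pwin P (ptau P i x) -> \forall y \near x, pwin P (ptau P i y).
Proof.
move=> wx; apply: (@ptau_continuous i x); apply: open_nbhs_nbhs.
by split=> //; exact: p_open.
Qed.

Lemma pdom_open : open pdom.
Proof.
move=> i x ox /(pdom_glue i ox)[Ji wi].
by apply: filterS (near_win wi) => y wy oy; apply/pdom_glue.
Qed.

Lemma pcoord_continuous p : pdom p -> {for p, continuous pcoord}.
Proof.
apply: glue_continuous pdom_open _ _ => i x ox Dx.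
exists (ptau P i); first exact: ptau_continuous.
split; first by rewrite pcoord_glue.
by apply: filterS filterT => y _ oy Dy; rewrite pcoord_glue.
Qed.

Lemma pcoord_injective p q : pdom p -> pdom q -> pcoord p = pcoord q -> p = q.
Proof.
have [i _ ->] := glueP p; have [j _ ->] := glueP q.
have op := oct_fold p; have oq := oct_fold q.
move=> Dp Dq; rewrite !pcoord_glue// => E.
have /(pdom_glue _ op)[Ji wi] := Dp; have /(pdom_glue _ oq)[Jj wj] := Dq.
exact: (p_inj Ji Jj).
Qed.

Lemma pcoord_epi p : pdom p -> epigraph (pprof P) (pcoord p).
Proof.
have [i _ ->] := glueP p; have op := oct_fold p => Dp.
have /(pdom_glue _ op)[Ji wi] := Dp; rewrite pcoord_glue//.
exact: p_epi1.
Qed.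

(** A coordinate near that of p can be reached from any of finitely many tiles k. If the preimage of
    the coordinate of p in k lies in the octagon, it represents p by [p_inj], and [W] contains its
    neighbours in k; otherwise the preimages of nearby coordinates stay outside the closed
    octagon. *)
Lemma pcoord_image_near (W : set (@glued R G)) p : open W -> W `<=` pdom -> W p ->
  \forall z \near pcoord p, epigraph (pprof P) z -> (pcoord @` W) z.
Proof.
move=> oW WD Wp; have Dp := WD _ Wp.
have [i _ pE] := glueP p; have op := oct_fold p.
set x := fold p in pE op; rewrite pE in Wp Dp *; rewrite pcoord_glue//.
have /(pdom_glue _ op)[Ji wi] := Dp; set z0 := ptau P i x.
have Nw : \forall z \near z0, pwin P z.
  by apply: open_nbhs_nbhs; split=> //; exact: p_open.
have NJ k : \forall z \near z0, forall y, pJ P k -> oct y -> ptau P k y = z ->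
    (pcoord @` W) z.
  have [Jk|nJk] := boolP (pJ P k); last first.
    by apply: filterS filterT.
  have [t rt [tK Kt]] := rigid_inv (p_rigid P k).
  have ct := rigid_continuous rt.
  have [oy0|noy0] := boolP (oct (t z0)).
    have E : glue i x = glue k (t z0) by apply: (p_inj Ji Jk) => //; rewrite Kt.
    have Wk : W (glue k (t z0)) by rewrite -E.
    have N : \forall z \near z0, oct (t z) -> W (glue k (t z)) :=
      ct z0 _ (oW k _ oy0 Wk).
    apply: filterS N => z Wz y _ oy yz; have ty : t z = y by rewrite -yz tK.
    rewrite ty in Wz; exists (glue k y); first exact: Wz.
    by rewrite pcoord_glue//; apply/WD/Wz.
  have N : \forall z \near z0, ~~ oct (t z) := ct z0 _ (near_not_oct noy0).
  by apply: filterS N => z nz y _ oy yz; move: nz; rewrite -yz tK oy.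
have F := @filter_forall _ _ (fun k z => forall y, pJ P k -> oct y ->
  ptau P k y = z -> (pcoord @` W) z) (nbhs z0) _ NJ.
have {}F : \forall z \near z0, forall k y, pJ P k -> oct y -> ptau P k y = z ->
  (pcoord @` W) z.
  apply: F; exact: nbhs_filter.
near=> z => ez; have wz : pwin P z by near: z.
have Fz : forall k y, pJ P k -> oct y -> ptau P k y = z -> (pcoord @` W) z.
  by near: z.
by have [k [y [Jk oy yz]]] := p_epi2 wz ez; exact: (Fz k y).
Unshelve. all: by end_near. Qed.

Lemma pcoord_image (W : set (@glued R G)) : open W -> W `<=` pdom ->
  exists2 U : set 'rV[R]_2, open U & pcoord @` W = U `&` epigraph (pprof P).
Proof.
move=> oW WD.
exists (interior [set z | epigraph (pprof P) z -> (pcoord @` W) z]).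
  exact: open_interior.
apply/seteqP; split=> z.
  move=> [p Wp <-]; split; last exact/pcoord_epi/WD.
  exact: pcoord_image_near.
by move=> [/interior_subset].
Qed.

Definition plaque_chart : chart R (@glued R G) 1 :=
  Chart pdom_open (p_profile P) pcoord_continuous pcoord_injective pcoord_image.

End Plaques.
Arguments pdom {R G} P _.
Arguments pcoord {R G} P q.

(** * Maps induced by permutations of the tiles *)

Section Symmetry.
Context {R : realType} {G : pattern}.
Variable a : tile G -> tile G.
Hypothesis a_act : forall c i, a (act c i) = act c (a i).
Hypothesis a_inj : injective a.

Definition glue_map (p : @glued R G) : @glued R G :=
  glue (a (odflt (tile0 G) [pick j in blk p])) (fold p).

Lemma cls_map i j (x : 'rV[R]_2) : j \in cls i x -> a j \in cls (a i) x.
Proof.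
case/clsP => [->|[c xc ->]]; first exact: mem_cls.
by rewrite a_act; exact: mem_cls_act.
Qed.

Lemma glue_map_glue i (x : 'rV[R]_2) : oct x -> glue_map (glue i x) = glue (a i) x.
Proof.
move=> ox; rewrite /glue_map blk_glue// fold_glue//.
case: pickP => [j ji|/(_ i)]; last by rewrite mem_cls.
by apply: glue_eq => //; exact: cls_map.
Qed.

Lemma glue_map_continuous : continuous glue_map.
Proof.
move=> p W; rewrite nbhsE => -[U [oU Up] UW].
rewrite nbhsE; exists (glue_map @^-1` U) => [|q /UW//]; split=> //.
move=> i x ox /=; rewrite glue_map_glue// => Ux.
by apply: filterS (oU _ x ox Ux) => y Uy oy; rewrite /= glue_map_glue//; exact: Uy.
Qed.

(** Two points near a common point lie in the same tile or in two tiles adjacent across one side; in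
    the second case one of them is unfolded by [sigma]. The right-hand side mentions neither the
    plaque nor [b], so applying this to two plaques, with [b] the identity and [b] the permutation,
    yields an isometry. *)
Lemma sqdist_tau (P : @plaque R G) (b : tile G -> tile G) x0 j k (x y : 'rV[R]_2) :
  (forall c i, b (act c i) = act c (b i)) -> injective b ->
  oct x0 -> k \in cls j x0 -> pJ P (b j) -> pwin P (ptau P (b j) x0) ->
  sqdist (ptau P (b j) x) (ptau P (b k) y) =
  sqdist x (if k == j then y else if [pick c | edge c x0] is Some c then sigma c y
            else y).
Proof.
move=> b_act b_inj ox /clsP kj Jj wj.
have [->|kn] := eqVneq k j; first by rewrite sqdist_rigid//; exact: p_rigid.
case: kj => [/eqP|[c xc kE]]; first by rewrite (negbTE kn).
case: pickP => [c' xc'|/(_ c)]; last by rewrite xc.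
rewrite (edge_disj xc' xc) {c' xc'}.
have bn : act c (b j) != b j.
  by rewrite -b_act -kE; apply: contra_neq kn => /b_inj.
have [_ E] := p_act xc Jj wj bn.
by rewrite kE b_act -(sigmaK c y) E sigmaK sqdist_rigid//; exact: p_rigid.
Qed.

Lemma glue_map_isometric (P P' : @plaque R G) p : pdom P p ->
  pdom P' (glue_map p) ->
  locally_isometric (plaque_chart P) (plaque_chart P') glue_map p.
Proof.
move=> Dp Dp'.
exists [set q | (pdom P q /\ pdom P' (glue_map q)) /\ blk q \subset blk p].
  apply: filterI; last exact: near_blk.
  apply: filterI; first by apply: open_nbhs_nbhs; split=> //; exact: pdom_open.
  apply: (glue_map_continuous (x := p)); apply: open_nbhs_nbhs.
  by split=> //; exact: pdom_open.
move=> q r [[Dq Dq'] qp] [[Dr Dr'] rp] /=.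
have [j jq qE] := glueP q; have [k kr rE] := glueP r.
have op := oct_fold p; have oq := oct_fold q; have or_ := oct_fold r.
have jp := fintype.subsetP qp _ jq; have kp := fintype.subsetP rp _ kr.
have pE := glue_fold jp; have kc : k \in cls j (fold p).
  by rewrite -blk_glue// -pE.
move: Dq Dq' Dr Dr' Dp Dp'; rewrite qE rE pE.
rewrite !glue_map_glue// => Dq Dq' Dr Dr' Dp Dp'.
rewrite !pcoord_glue//.
have /(pdom_glue _ _ op)[Jj wj] := Dp; have /(pdom_glue _ _ op)[Jj' wj'] := Dp'.
rewrite (sqdist_tau (b := a) _ _ a_act a_inj op kc)//.
by rewrite (sqdist_tau (b := id) (fold q) (fold r) _ _ op kc).
Qed.

End Symmetry.

(** * Boundary profiles of the charts *)

Section Profiles.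
Context {R : realType}.
Implicit Types (y : 'rV[R]_1).

(** The boundary at an end of a glued side: two octagon angles of 135 degrees form a reentrant angle
    of 270 degrees. *)
Definition cusp y : R := - 1 - `|y ord0 ord0|.
(** The boundary around a free side: the side at height -2 between its two neighbouring
    diagonals. *)
Definition trough y : R := Num.max (- 2) (`|y ord0 ord0| - 3).

Lemma smooth_line1 (a b : R) : smooth (fun y : 'rV[R]_1 => a * y ord0 ord0 + b).
Proof.
by apply: smoothD; [apply: smoothZ; exact: smooth_coord|exact: smooth_cst].
Qed.

Lemma coord1_continuous : continuous (fun y : 'rV[R]_1 => y ord0 ord0).
Proof. by apply: smooth_continuous; exact: smooth_coord. Qed.

Lemma norm1_continuous : continuous (fun y : 'rV[R]_1 => `|y ord0 ord0|).
Proof.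
move=> y; apply: (@continuous_comp _ _ _ (fun y : 'rV[R]_1 => y ord0 ord0) Num.norm).
  exact: coord1_continuous.
exact: norm_continuous.
Qed.

Lemma cst_piecewise_smooth (a : R) : piecewise_smooth (cst a : 'rV[R]_1 -> R).
Proof.
split; first by move=> y; exact: cst_continuous.
exists 1%N, (fun _ => cst a); split=> [_|y]; first exact: smooth_cst.
by exists ord0.
Qed.

Lemma cusp_piecewise_smooth : piecewise_smooth cusp.
Proof.
split.
  by move=> y; have cn := @norm1_continuous y; exact: (cvgB (cvg_cst _) cn).
exists 2%N, (fun i y => (if i == ord0 then 1 else -1) * y ord0 ord0 + - 1).
split=> [i|y]; first exact: smooth_line1.
rewrite /cusp; have [y0|y0] := leP 0 (y ord0 ord0).
  by exists (lift ord0 ord0); rewrite /= ger0_norm// mulN1r addrC.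
by exists ord0; rewrite /= ltr0_norm// mul1r opprK addrC.
Qed.

Lemma trough_piecewise_smooth : piecewise_smooth trough.
Proof.
split.
  move=> y; have cn := @norm1_continuous y.
  have c2 : {for y, continuous (cst (- 2) : 'rV[R]_1 -> R^o)} by exact: cst_continuous.
  have c3 : {for y, continuous (fun y : 'rV[R]_1 => `|y ord0 ord0| - 3 : R^o)}.
    exact: (cvgB cn (cvg_cst _)).
  exact: (continuous_max c2 c3).
exists 3%N, (fun i y => (if i == 0%N :> nat then 0 else if i == 1%N :> nat then 1 else -1)
   * y ord0 ord0 + (if i == 0%N :> nat then - 2 else - 3)).
split=> [i|y]; first exact: smooth_line1.
rewrite /trough; have [y3|y3] := leP (`|y ord0 ord0| - 3) (- 2).
  by exists (@Ordinal 3 0 isT); rewrite /= mul0r add0r.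
have [y0|y0] := leP 0 (y ord0 ord0).
  by exists (@Ordinal 3 1 isT); rewrite /= ger0_norm// mul1r.
by exists (@Ordinal 3 2 isT); rewrite /= ltr0_norm// mulN1r.
Qed.

Lemma trough_smooth_flat (y : 'rV[R]_1) : `|y ord0 ord0| < 1 ->
  \forall z \near y, trough z = - 2.
Proof.
move=> y1; have N : \forall z \near y, `|(z : 'rV[R]_1) ord0 ord0| < 1 :=
  @norm1_continuous y _ (lt_nbhsl y1).
by apply: filterS N => z z1; rewrite /trough max_l//; lra.
Qed.

Lemma trough_smooth_at (y : 'rV[R]_1) : `|y ord0 ord0| != 1 ->
  exists2 h, smooth h & \forall z \near y, trough z = h z.
Proof.
rewrite neq_lt => /orP[y1|y1].
  by exists (cst (- 2)); [exact: smooth_cst|exact: trough_smooth_flat].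
have N : \forall z \near y, 1 < `|(z : 'rV[R]_1) ord0 ord0| :=
  @norm1_continuous y _ (lt_nbhsr y1).
have [y0|y0] := leP 0 (y ord0 ord0).
  have yp : 0 < y ord0 ord0 by move: y1; rewrite ger0_norm//; lra.
  have M : \forall z \near y, 0 < (z : 'rV[R]_1) ord0 ord0 :=
    @coord1_continuous y _ (lt_nbhsr yp).
  exists (fun z => 1 * z ord0 ord0 + - 3); first exact: smooth_line1.
  apply: filterS (filterI N M) => z [z1 z0].
  by rewrite /trough max_r ?gtr0_norm ?mul1r//; move: z1; rewrite gtr0_norm//; lra.
have M : \forall z \near y, (z : 'rV[R]_1) ord0 ord0 < 0 :=
  @coord1_continuous y _ (lt_nbhsl y0).
exists (fun z => -1 * z ord0 ord0 + - 3); first exact: smooth_line1.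
apply: filterS (filterI N M) => z [z1 z0].
by rewrite /trough max_r ?ltr0_norm ?mulN1r//; move: z1; rewrite ltr0_norm//; lra.
Qed.

Lemma cusp_smooth_at (y : 'rV[R]_1) : y ord0 ord0 != 0 ->
  exists2 h, smooth h & \forall z \near y, cusp z = h z.
Proof.
rewrite neq_lt => /orP[y0|y0].
  have M : \forall z \near y, (z : 'rV[R]_1) ord0 ord0 < 0 :=
    @coord1_continuous y _ (lt_nbhsl y0).
  exists (fun z => 1 * z ord0 ord0 + - 1); first exact: smooth_line1.
  apply: filterS M => z z0.
  by rewrite /cusp ltr0_norm// mul1r opprK addrC.
have M : \forall z \near y, 0 < (z : 'rV[R]_1) ord0 ord0 :=
  @coord1_continuous y _ (lt_nbhsr y0).
exists (fun z => -1 * z ord0 ord0 + - 1); first exact: smooth_line1.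
by apply: filterS M => z z0; rewrite /cusp gtr0_norm// mulN1r addrC.
Qed.

Lemma base_crd (z : 'rV[R]_2) : base z ord0 ord0 = crd true z.
Proof. by rewrite /base mxE. Qed.

Lemma height_crd (z : 'rV[R]_2) : height z = crd false z.
Proof. by []. Qed.

End Profiles.

(** * The three kinds of charts: open tiles, free sides and glued sides *)

Section Sites.
Context {R : realType} {G : pattern}.
Implicit Types (x y z : 'rV[R]_2) (i j k : tile G) (c : bool * bool).

Lemma rig_id x : rig false true true 0 0 x = x.
Proof. by apply: ptP => -[]; rewrite /rig crd_pt /sgn mul1r addr0. Qed.

Lemma edge_octi c x : edge c x -> octi x = false.
Proof.
case/andP => _ /eqP u2; apply/negbTE; rewrite (octiE c) u2 ger0_norm//.
by rewrite ltxx.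
Qed.

Lemma ucr_le2 c x : oct x -> ucr c x <= 2.
Proof. by rewrite (octE c) => /and3P[/(le_trans (ler_norm _))]. Qed.

Lemma edge_gt1 c c' x : edge c' x -> 1 < ucr c x -> c' = c.
Proof.
move=> ec'; have := edge_vcr ec'; case/andP: ec' => _ /eqP.
case: c c' => [[] []] [[] []]; rewrite /ucr /vcr /sgn /= ?mul1r ?mulN1r //;
  rewrite ler_norml => ? /andP[? ?] ?; exfalso; lra.
Qed.

Lemma octi_oct x : octi x -> oct x.
Proof. by move=> /and3P[/ltW a /ltW b /ltW c]; exact/and3P. Qed.

Lemma int_act c j x : edge c x -> octi (rig false true true 0 0 x) -> False.
Proof. by rewrite rig_id => /edge_octi ->. Qed.

Lemma octi_open : open [set z : 'rV[R]_2 | octi z].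
Proof. by rewrite openE => z; exact: near_octi. Qed.

(** The profile -2 lies strictly below the open octagon, so this chart contains interior points
    only. *)
Program Definition int_plaque i : plaque :=
  @Plaque R G (pred1 i) (fun _ => rig false true true 0 0) [set z | octi z]
    (cst (- 2)) _ octi_open (cst_piecewise_smooth _) _ _ _ _.
Next Obligation. by move=> i j; exists false, true, true, 0, 0. Qed.
Next Obligation. by move=> i c j x /int_act H _ /H. Qed.
Next Obligation.
move=> i j x _ _ /= /and3P[x0 _ _]; rewrite /epigraph /= height_crd ltW//.
by move: x0; rewrite ltr_norml => /andP[].
Qed.
Next Obligation.
by move=> i z zo _; exists i, z; rewrite /= eqxx rig_id octi_oct.
Qed.
Next Obligation.
by move=> i j k x y /eqP -> /eqP -> _ _ _; rewrite !rig_id => ->.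
Qed.

Definition loop_tau c x : 'rV[R]_2 := pt (- ucr c x) (vcr c x).

(** The window u > 1 contains the side [c] and the two adjacent diagonals up to their far ends, and
    meets no other coloured side by [edge_gt1]. *)
Program Definition loop_plaque i c (h : act c i == i) : plaque :=
  @Plaque R G (pred1 i) (fun _ => loop_tau c) [set z | crd false z < - 1]
    trough _ _ trough_piecewise_smooth _ _ _ _.
Next Obligation.
move=> i c h j; exists c.1, (~~ c.2), true, 0, 0; apply/funext => x.
rewrite /loop_tau /rig /ucr /vcr /sgn !addr0 mul1r -mulNr.
by case: c.2 => //=; rewrite opprK.
Qed.
Next Obligation.
move=> i c h; rewrite openE => z /= z1; apply: near_lt => //.
exact: continuous_crd.
Qed.
Next Obligation.
move=> i c h c' j x xc' /eqP -> /=; rewrite crd_pt => u1.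
have -> : c' = c by apply: (edge_gt1 xc'); lra.
by rewrite h.
Qed.
Next Obligation.
move=> i c h j x _; rewrite (octE c) => /and3P[u2 v2 uv] /=.
rewrite crd_pt /epigraph /= height_crd /trough base_crd !crd_pt => u1.
rewrite ge_max; move: u2 uv; rewrite ler_norml gtr0_norm; last by lra.
by move=> /andP[? ?] ?; apply/andP; split; lra.
Qed.
Next Obligation.
move=> i c h z /= z1; rewrite /epigraph /= height_crd /trough base_crd ge_max.
move=> /andP[z2 z3]; exists i, (pl c (- crd false z) (crd true z)).
rewrite /= eqxx /loop_tau ucr_pl vcr_pl opprK pt_crd; split=> //.
rewrite (octE c) ucr_pl vcr_pl ger0_norm; last by lra.
by apply/and3P; split; lra.
Qed.
Next Obligation.
move=> i c h j k x y /eqP -> /eqP -> _ _ _ E.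
have := congr1 (crd false) E; have := congr1 (crd true) E.
by rewrite !crd_pt => Ev /oppr_inj Eu; rewrite (crP Eu Ev).
Qed.

(** The height runs along the seam, and the base coordinate is the signed distance from it,
    nonpositive on the tile [i]. Since a chart has its boundary below only, each seam needs two
    charts; [e] selects which end of the seam is at the bottom. *)
Definition seam_tau i c (e : bool) j x : 'rV[R]_2 :=
  pt (sgn e * vcr c x) (if j == i then ucr c x - 2 else 2 - ucr c x).

Program Definition seam_plaque i c (e : bool) (h : act c i != i) : plaque :=
  @Plaque R G [pred j | (j == i) || (j == act c i)] (seam_tau i c e)
    [set z | crd false z < 1 /\ `|crd true z| < 1]
    cusp _ _ cusp_piecewise_smooth _ _ _ _.
Next Obligation.
move=> i c e h j; rewrite /seam_tau.
have E (b : bool) (x : 'rV[R]_2) : pt (sgn e * vcr c x)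
    (if b then ucr c x - 2 else 2 - ucr c x) =
    rig (~~ c.1) e (b == c.2) 0 (if b then - 2 else 2) x.
  rewrite /rig /vcr /ucr negbK addr0; congr pt.
  by case: b c.2 => -[]; rewrite /sgn /=; ring.
by exists (~~ c.1), e, ((j == i) == c.2), 0, (if j == i then - 2 else 2);
  apply/funext => x; rewrite E.
Qed.
Next Obligation.
move=> i c e h; rewrite openE => z /= [z0 z1].
by apply: filterI; apply: near_lt => //; [exact: continuous_crd|exact: norm_crd_continuous].
Qed.
Next Obligation.
move=> i c e h c' j x xc' Jj /=; rewrite !crd_pt => -[_ w1] _.
have -> : c' = c.
  apply: (edge_gt1 xc'); move: w1; case: ifP => _;
  by rewrite ltr_norml => /andP[? ?]; lra.
case/orP: Jj => /eqP ->; rewrite ?actK !eqxx ?orbT; split=> // y.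
  rewrite /seam_tau (negbTE h) eqxx /sigma ucr_pl vcr_pl; congr pt; ring.
by rewrite /seam_tau (negbTE h) eqxx /sigma ucr_pl vcr_pl; congr pt; ring.
Qed.
Next Obligation.
move=> i c e h j x _; rewrite (octE c) => /and3P[u2 v2 uv] /=.
rewrite !crd_pt /epigraph /= height_crd /cusp base_crd !crd_pt => -[v1 w1].
move: u2; rewrite ler_norml => /andP[_ u2].
have E : `|if j == i then ucr c x - 2 else 2 - ucr c x| = 2 - ucr c x.
  by case: ifP => _; [rewrite distrC|]; rewrite ger0_norm//; lra.
rewrite E in w1 *; move: uv; rewrite gtr0_norm; last by lra.
have : - `|vcr c x| <= sgn e * vcr c x.
  by rewrite /sgn; case: e {v1}; rewrite ?mul1r ?mulN1r ?lerN2 ?ler_norm// lerNl -normrN ler_norm.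
by lra.
Qed.
Next Obligation.
move=> i c e h z /= [z1 w1]; rewrite /epigraph /= height_crd /cusp base_crd => z2.
exists (if crd true z <= 0 then i else act c i).
exists (pl c (2 - `|crd true z|) (sgn e * crd false z)).
rewrite /seam_tau ucr_pl vcr_pl mulrA sgn_mul mul1r; split.
- by case: ifP => _; rewrite /= eqxx ?orbT.
- rewrite (octE c) ucr_pl vcr_pl normrM (_ : `|sgn e| = 1); last first.
    by case: e; rewrite /sgn ?normrN normr1.
  have w0 := normr_ge0 (crd true z).
  rewrite mul1r [`|2 - _|]ger0_norm; last by lra.
  have : `|crd false z| <= 1 + `|crd true z| by rewrite ler_norml; apply/andP; split; lra.
  by move=> ?; apply/and3P; split; lra.
have [w0|w0] := leP (crd true z) 0.
  by rewrite eqxx ler0_norm// (_ : _ - 2 = crd true z) ?pt_crd//; ring.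
by rewrite (negbTE h) gtr0_norm// (_ : 2 - _ = crd true z) ?pt_crd//; ring.
Qed.
Next Obligation.
move=> i c e h j k x y Jj Jk ox oy _ E.
have := congr1 (crd false) E; have := congr1 (crd true) E.
rewrite !crd_pt => Eu Ev.
have {}Ev : vcr c x = vcr c y.
  by move: Ev => /(congr1 ( *%R (sgn e))); rewrite !mulrA sgn_mul !mul1r.
have := ucr_le2 c ox; have := ucr_le2 c oy.
have act_i : act c (act c i) = i by rewrite actK.
have S : ucr c x = ucr c y -> x = y by move=> Eu'; exact: (crP Eu' Ev).
have edge2 u : oct u -> 2 <= ucr c u -> ucr c u <= 2 -> edge c u.
  by move=> ou u1 u2; rewrite /edge ou; apply/eqP/le_anti; rewrite u1 u2.
case/orP: Jj Eu => /eqP ->; case/orP: Jk => /eqP ->; rewrite ?eqxx ?(negbTE h) => Eu uy ux.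
- by rewrite S//; lra.
- rewrite S; last by lra.
  by rewrite glue_act//; apply: edge2 => //; lra.
- rewrite S; last by lra.
  by rewrite glue_act//; apply: edge2 => //; lra.
- by rewrite S//; lra.
Qed.

End Sites.

(** * The flat manifold of a gluing pattern *)

Section Manifold.
Context {R : realType} {G : pattern}.
Implicit Types (x y z : 'rV[R]_2) (i j k : tile G) (c : bool * bool).
Implicit Types (p q : @glued R G).

Inductive site :=
  | Inner of tile G
  | Loop i c of act c i == i
  | Seam i c (e : bool) of act c i != i.

Definition site_plaque (s : site) : @plaque R G :=
  match s with
  | Inner i => int_plaque i
  | Loop i c h => loop_plaque h
  | Seam i c e h => seam_plaque e h
  end.

Definition glued_atlas : set (chart R (@glued R G) 1) :=
  range (fun s => plaque_chart (site_plaque s)).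

Definition free_neumann c i := (act c i == i) && neu c i.

(** The manifold interior described without charts: open tiles and glued sides without their
    ends. *)
Definition inner p : Prop :=
  octi (fold p) \/
  exists c i, [/\ i \in blk p, edge c (fold p), `|vcr c (fold p)| < 1 & act c i != i].

Lemma side_of_boundary x : oct x -> ~~ octi x -> exists c, 1 < ucr c x.
Proof.
move=> ox nx.
have : (1 < `|crd false x|) || (1 < `|crd true x|).
  case/and3P: ox => x0 x1 x2; move: nx; rewrite /octi !negb_and -!leNgt.
  by move=> /or3P[] ?; apply/orP; [left|right|case: (ltP 1 `|crd false x|) => ?; [left|right]];
     lra.
case/orP; rewrite ltr_normr => /orP[] H.
- by exists (false, true); rewrite /ucr /sgn mul1r.
- by exists (false, false); rewrite /ucr /sgn mulN1r.
- by exists (true, true); rewrite /ucr /sgn mul1r.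
- by exists (true, false); rewrite /ucr /sgn mulN1r.
Qed.

Lemma inner_dom i x : octi x -> pdom (site_plaque (Inner i)) (glue i x).
Proof.
by move=> ox; apply/pdom_glue; [exact: octi_oct|rewrite /= eqxx rig_id].
Qed.

Lemma loop_dom i c (h : act c i == i) x : oct x -> 1 < ucr c x ->
  pdom (site_plaque (Loop h)) (glue i x).
Proof.
by move=> ox ux; apply/pdom_glue => //; rewrite /= eqxx /loop_tau crd_pt ltrN2.
Qed.

Lemma seam_dom i c (h : act c i != i) x : oct x -> 1 < ucr c x ->
  pdom (site_plaque (Seam (vcr c x <= 0) h)) (glue i x).
Proof.
move=> ox ux; apply/pdom_glue => //.
rewrite /= eqxx /seam_tau !crd_pt eqxx; split=> //; split.
  by rewrite /sgn; have [v0|v0] := leP (vcr c x) 0; rewrite ?mul1r ?mulN1r; lra.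
by have := ucr_le2 c ox; rewrite ltr_norml => u2; apply/andP; split; lra.
Qed.

Lemma pdom_site s i x : oct x -> pdom (site_plaque s) (glue i x) ->
  match s with
  | Inner j => j = i /\ octi x
  | @Loop j c _ => j = i /\ 1 < ucr c x
  | @Seam j c e _ => (i = j \/ i = act c j) /\ 1 < ucr c x
  end.
Proof.
move=> ox /(pdom_glue _ _ ox); case: s => [j|j c h|j c e h] /=.
- by rewrite rig_id => -[/eqP -> ?].
- by rewrite /loop_tau crd_pt ltrN2 => -[/eqP -> ?].
rewrite /seam_tau !crd_pt => -[Ji [_ w1]]; split.
  by case/orP: Ji => /eqP ->; [left|right].
by move: w1; case: ifP => _; rewrite ltr_norml => /andP[? ?]; lra.
Qed.

Lemma inner_of_chart s p : pdom (site_plaque s) p ->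
  pprof (site_plaque s) (base (pcoord (site_plaque s) p)) <
    height (pcoord (site_plaque s) p) -> inner p.
Proof.
have [i ip pE] := glueP p; have ox := oct_fold p.
move: (fold p) pE ox => x -> ox Dp; rewrite pcoord_glue//.
rewrite /inner fold_glue// blk_glue//.
have := pdom_site ox Dp; case: s Dp => [j|j c h|j c e h] /= Dp.
- by case=> _ ?; left.
- move=> [_ u1]; rewrite height_crd /trough base_crd /loop_tau !crd_pt.
  rewrite gt_max => /andP[H1 H2]; left; rewrite (octiE c) gtr0_norm; last by lra.
  by apply/and3P; split; lra.
move=> [ij u1]; rewrite height_crd /cusp base_crd /seam_tau !crd_pt => H.
have u2 := ucr_le2 c ox.
have ai : act c i != i.
  by case: ij => ->; rewrite ?actK // eq_sym.
have /(pdom_glue _ _ ox)[_ /=] := Dp; rewrite /seam_tau !crd_pt => -[v1 _].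
have v2 : `|vcr c x| < 3 - ucr c x.
  have -> : `|vcr c x| = `|sgn e * vcr c x|.
    by rewrite normrM /sgn; case: (e); rewrite ?normrN normr1 mul1r.
  have E : `|if i == j then ucr c x - 2 else 2 - ucr c x| = 2 - ucr c x.
    by case: ifP => _; [rewrite distrC|]; rewrite ger0_norm//; lra.
  by move: H; rewrite E ltr_norml => H; apply/andP; split; lra.
have [uE|un] := eqVneq (ucr c x) 2.
  right; exists c, i; rewrite mem_cls /edge ox uE eqxx; split=> //; lra.
have {}u2 : ucr c x < 2 by rewrite lt_neqAle un.
left; rewrite (octiE c) gtr0_norm; last by lra.
by apply/and3P; split; lra.
Qed.

Lemma chart_of_inner p : inner p -> exists s, pdom (site_plaque s) p /\
  pprof (site_plaque s) (base (pcoord (site_plaque s) p)) <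
    height (pcoord (site_plaque s) p).
Proof.
have [i ip pE] := glueP p; have ox := oct_fold p.
case=> [xi|[c [j [jp xc v1 aj]]]].
  exists (Inner i); rewrite pE; have D := inner_dom i xi; split=> //.
  rewrite pcoord_glue//= rig_id height_crd.
  by case/and3P: xi => + _ _; rewrite ltr_norml => /andP[].
have u2 : ucr c (fold p) = 2 by case/andP: xc => _ /eqP.
exists (Seam (vcr c (fold p) <= 0) aj); rewrite (glue_fold jp).
set x := fold p in xc v1 ox u2 *; rewrite fold_glue//.
have D : pdom (site_plaque (Seam (vcr c x <= 0) aj)) (glue j x).
  by apply: seam_dom => //; lra.
split=> //; rewrite pcoord_glue//= /seam_tau height_crd /cusp base_crd !crd_pt eqxx.
rewrite u2 subrr normr0 subr0.
move: v1; rewrite ltr_norml => /andP[? ?].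
by rewrite /sgn; case: ifP => _; rewrite ?mul1r ?mulN1r; lra.
Qed.

Lemma glued_interior : atlas_interior glued_atlas = inner.
Proof.
apply/seteqP; split=> p.
  by move=> [_ [[s _ <-] Dp]]; exact: inner_of_chart.
move=> /chart_of_inner[s [Dp H]]; exists (plaque_chart (site_plaque s)).
by split=> //; exists s.
Qed.

Lemma glued_boundary : atlas_boundary glued_atlas = ~` inner.
Proof. by rewrite /atlas_boundary glued_interior. Qed.

Lemma glued_cover p : exists2 ch, glued_atlas ch & dom ch p.
Proof.
have [i ip pE] := glueP p; have ox := oct_fold p.
have [xi|xn] := boolP (octi (fold p)).
  exists (plaque_chart (site_plaque (Inner i))); first by exists (Inner i).
  by rewrite /= [X in pdom _ X]pE; exact: inner_dom.
have [c uc] := side_of_boundary ox xn.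
have [h|h] := boolP (act c i == i).
  exists (plaque_chart (site_plaque (Loop h))); first by exists (Loop h).
  by rewrite /= [X in pdom _ X]pE; exact: (loop_dom h).
exists (plaque_chart (site_plaque (Seam (vcr c (fold p) <= 0) h))).
  by exists (Seam (vcr c (fold p) <= 0) h).
by rewrite /= [X in pdom _ X]pE; exact: (seam_dom h).
Qed.

Lemma glue_map_id p : glue_map id p = p.
Proof. by have [i _ ->] := glueP p; rewrite glue_map_glue// oct_fold. Qed.

Lemma glued_flat ch ch' : glued_atlas ch -> glued_atlas ch' ->
  forall p, dom ch p -> dom ch' p -> locally_isometric ch ch' id p.
Proof.
move=> [s _ <-] [s' _ <-] p Dp Dp'.
have [|W Wp H] := @glue_map_isometric R G id (fun _ _ => erefl) (fun _ _ e => e)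
  (site_plaque s) (site_plaque s') p Dp; first by rewrite glue_map_id.
by exists W => // q r Wq Wr; have := H q r Wq Wr; rewrite !glue_map_id.
Qed.

(** Within the boundary this leaves the free Dirichlet sides and the diagonals, all without their
    end points: the ends of a diagonal are the ends |v| = 1 of coloured sides. *)
Definition dirichlet_open_set : set (@glued R G) :=
  [set p | forall i c, i \in blk p -> edge c (fold p) ->
     `|vcr c (fold p)| < 1 /\ ~~ free_neumann c i].

Definition neumann_open_set : set (@glued R G) :=
  [set p | exists i c, [/\ i \in blk p, 1 < ucr c (fold p),
     `|vcr c (fold p)| < 1 & free_neumann c i]].

Lemma dirichlet_open_setP : open dirichlet_open_set.
Proof.
move=> i x ox; rewrite /dirichlet_open_set /= fold_glue// blk_glue// => H.
have N : \forall y \near x, forall c, edge c y -> edge c x /\ `|vcr c y| < 1.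
  have F := @filter_forall _ _ (fun c y => edge c y -> edge c x /\ `|vcr c y| < 1)
    (nbhs x) _.
  apply: F => c; have [xc|/near_not_edge] := boolP (edge c x); last first.
    by apply: filterS => y /negbTE ->.
  have [v1 _] := H _ _ (mem_cls i x) xc.
  have M : \forall y \near x, `|vcr c y| < 1.
    by apply: near_lt v1; exact: norm_crd_continuous.
  by apply: filterS M => y yv yc.
apply: filterS N => y N oy j c; rewrite fold_glue// blk_glue// => jy yc.
have [xc v1] := N _ yc; split=> //.
case/clsP: jy => [->|[c' yc' ->]]; first exact: (H i c (mem_cls i x) xc).2.
by rewrite (edge_disj yc' yc); apply: (H _ c _ xc).2; exact: mem_cls_act.
Qed.

Lemma ucr_affine c (h : R) w x : ucr c (h *: w + x) = h * ucr c w + ucr c x.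
Proof. by rewrite /ucr crdD crdZ mulrDr mulrCA. Qed.

Lemma vcr_affine c (h : R) w x : vcr c (h *: w + x) = h * vcr c w + vcr c x.
Proof. by rewrite /vcr crdD crdZ. Qed.

Lemma blk_cls i p : i \in blk p -> blk p = cls i (fold p).
Proof. by move=> ip; rewrite [in LHS](glue_fold ip) blk_glue// oct_fold. Qed.

Lemma free_neumann_cls i j c x : j \in cls i x -> 1 < ucr c x ->
  free_neumann c j -> j = i.
Proof.
case/clsP => [//|[c' xc' ->]] uc; rewrite (edge_gt1 xc' uc) /free_neumann actK.
by move=> /andP[/eqP].
Qed.

Lemma neumann_open_setP : open neumann_open_set.
Proof.
move=> i x ox [j [c]]; rewrite fold_glue// blk_glue// => -[ji uc v1 jc].
have E := free_neumann_cls ji uc jc; rewrite {}E {ji} in jc.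
have N1 := near_gt (@ucr_continuous _ c x) uc.
have N2 := near_lt (@norm_crd_continuous _ (~~ c.1) x) v1.
apply: filterS (filterI N1 N2) => y [uy vy] oy; exists i, c.
by rewrite fold_glue// blk_glue// mem_cls.
Qed.

Definition glued_dirichlet := dirichlet_open_set `&` atlas_boundary glued_atlas.
Definition glued_neumann := neumann_open_set `&` atlas_boundary glued_atlas.

Lemma boundary_octi p : (~` inner) p -> ~~ octi (fold p).
Proof. by move=> np; apply/negP => op; apply: np; left. Qed.

Lemma boundary_act p i c : (~` inner) p -> i \in blk p -> edge c (fold p) ->
  `|vcr c (fold p)| < 1 -> act c i = i.
Proof.
move=> np ip pc v1; apply/eqP/negPn/negP => ai.
by apply: np; right; exists c, i.
Qed.

Lemma glued_neumannP p : glued_neumann p <-> exists i c,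
  [/\ i \in blk p, edge c (fold p), `|vcr c (fold p)| < 1 & free_neumann c i].
Proof.
rewrite /glued_neumann glued_boundary; have op := oct_fold p; split.
  move=> [[i [c [ip uc v1 ic]]] /boundary_octi np]; exists i, c; split=> //.
  rewrite /edge op /=; have := ucr_le2 c op; rewrite le_eqVlt => /orP[//|u2].
  case/negP: np; rewrite (octiE c) gtr0_norm; last by lra.
  by apply/and3P; split; lra.
move=> [i [c [ip pc v1 ic]]]; have uc : ucr c (fold p) = 2 by case/andP: pc => _ /eqP.
split; first by exists i, c; split=> //; rewrite uc; lra.
case=> [|[c' [j [jp pc' _ aj]]]]; first by rewrite (edge_octi pc).
rewrite (edge_disj pc' pc) in aj.
move: jp; rewrite (blk_cls ip) (cls_edge _ pc) (eqP (andP ic).1) !inE orbb.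
by move=> /eqP jE; rewrite jE (andP ic).1 in aj.
Qed.

Lemma glued_dirichletP p : glued_dirichlet p <->
  (~` inner) p /\ forall i c, i \in blk p -> edge c (fold p) ->
     `|vcr c (fold p)| < 1 /\ ~~ free_neumann c i.
Proof. by rewrite /glued_dirichlet glued_boundary; split=> -[]. Qed.

(** The profiles have their corners over |v| = 1 for [trough] and over u = 2 for [cusp]. A boundary
    point there would be an end of a coloured side, which the hypothesis excludes; all remaining
    points of the octagon there are interior points of the surface. *)
Lemma boundary_smooth p : (~` inner) p ->
  (forall i c, i \in blk p -> edge c (fold p) -> `|vcr c (fold p)| < 1) ->
  smooth_boundary_point glued_atlas p.
Proof.
move=> np v1; split; first by rewrite glued_boundary.
have [i ip pE] := glueP p; have op := oct_fold p.
have nxi := boundary_octi np.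
have [c uc] := side_of_boundary op nxi.
have u2 := ucr_le2 c op.
have [h|h] := boolP (act c i == i).
  exists (plaque_chart (site_plaque (Loop h))).
  have D : pdom (site_plaque (Loop h)) p by rewrite [X in pdom _ X]pE; exact: loop_dom.
  split=> //; first by exists (Loop h).
  apply: trough_smooth_at; rewrite base_crd /= /loop_tau crd_pt; apply/eqP => vE.
  have [uE|un] := eqVneq (ucr c (fold p)) 2.
    have := v1 i c ip; rewrite /edge op uE eqxx => /(_ isT).
    by rewrite vE ltxx.
  case/negP: nxi; rewrite (octiE c) vE gtr0_norm; last by lra.
  have {}u2 : ucr c (fold p) < 2 by rewrite lt_neqAle un.
  by apply/and3P; split; lra.
exists (plaque_chart (site_plaque (Seam (vcr c (fold p) <= 0) h))).
have D : pdom (site_plaque (Seam (vcr c (fold p) <= 0) h)) p.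
  by rewrite [X in pdom _ X]pE; exact: seam_dom.
split=> //; first by exists (Seam (vcr c (fold p) <= 0) h).
have E : pcoord (site_plaque (Seam (vcr c (fold p) <= 0) h)) p =
    seam_tau i c (vcr c (fold p) <= 0) i (fold p).
  by rewrite [X in pcoord _ X]pE pcoord_glue// -pE.
apply: cusp_smooth_at; rewrite base_crd /= in E *.
rewrite E /seam_tau crd_pt eqxx subr_eq0; apply/eqP => uE.
have pc : edge c (fold p) by rewrite /edge op uE eqxx.
by move: (h); rewrite (boundary_act np ip pc (v1 _ _ ip pc)) eqxx.
Qed.

Lemma glued_dirichlet_smooth : glued_dirichlet `<=` smooth_boundary_point glued_atlas.
Proof.
move=> p /glued_dirichletP[np H]; apply: boundary_smooth => // i c ip pc.
by have [] := H i c ip pc.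
Qed.

Lemma glued_neumann_smooth : glued_neumann `<=` smooth_boundary_point glued_atlas.
Proof.
move=> p np; have [_] := np; rewrite glued_boundary => bp.
apply: boundary_smooth => // i c ip pc.
have /glued_neumannP[j [c' [jp pc' v1 _]]] := np.
by rewrite (edge_disj pc pc').
Qed.

Lemma glued_disjoint : glued_dirichlet `&` glued_neumann = set0.
Proof.
apply/seteqP; split=> // p [/glued_dirichletP[_ H] /glued_neumannP].
move=> [i [c [ip pc v1 ic]]].
by have [_] := H i c ip pc; rewrite ic.
Qed.

Lemma inner_open : open inner.
Proof.
move=> i x ox; rewrite /inner fold_glue// blk_glue//.
case=> [xi|[c [j [jx xc v1 aj]]]].
  by apply: filterS (near_octi xi) => y yi oy; left; rewrite fold_glue.
have ai : act c i != i.
  case/clsP: jx aj => [->//|[c' xc' ->]].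
  by rewrite (edge_disj xc' xc) actK eq_sym.
have uc : 1 < ucr c x by case/andP: xc => _ /eqP ->; lra.
have N1 := near_gt (@ucr_continuous _ c x) uc.
have N2 := near_lt (@norm_crd_continuous _ (~~ c.1) x) v1.
apply: filterS (filterI N1 N2) => y [uy vy] oy.
rewrite fold_glue// blk_glue//.
have [yc|yc] := boolP (edge c y); first by right; exists c, i; rewrite mem_cls.
left; have := ucr_le2 c oy; rewrite le_eqVlt => /orP[uE|u2].
  by move: yc; rewrite /edge oy uE.
rewrite (octiE c) gtr0_norm; last by lra.
rewrite /vcr; apply/and3P; split; lra.
Qed.

Lemma boundary_closed : closed (atlas_boundary glued_atlas).
Proof. by rewrite glued_boundary; apply: open_closedC; exact: inner_open. Qed.

(** The boundary points left out by both parts are ends of coloured sides, and each of these is a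
    limit of points of the adjacent diagonal, which is Dirichlet. *)
Lemma glued_dense :
  closure (glued_dirichlet `|` glued_neumann) = atlas_boundary glued_atlas.
Proof.
apply/seteqP; split.
  rewrite [X in _ `<=` X](closure_id _).1; last exact: boundary_closed.
  by apply: closureS => p [[_]|[_]].
move=> p; rewrite glued_boundary => np.
have [v1|] := pselect (forall i c, i \in blk p -> edge c (fold p) ->
  `|vcr c (fold p)| < 1).
  apply: subset_closure.
  have [H|] := pselect (glued_neumann p); [by right|move=> nN].
  left; apply/glued_dirichletP; split=> // i c ip pc; split; first exact: (v1 i c ip pc).
  apply/negP => ic; apply: nN; apply/glued_neumannP; exists i, c; split=> //.
  exact: (v1 i c ip pc).
move=> /existsNP[i /existsNP[c /not_implyP[ip /not_implyP[pc /negP]]]].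
rewrite -leNgt => v1; set x := fold p in pc v1 *.
have {}v1 : `|vcr c x| = 1 by apply/le_anti; rewrite v1 (edge_vcr pc).
have u2 : ucr c x = 2 by move: pc => /andP[_ /eqP].
move=> B Bp; have := near_glue Bp ip; rewrite -/x => /nearP2[d d0 Hd].
(* The direction decreases u and increases |v| at the same rate, so it follows the diagonal; h < 1
   stops before its far end. *)
have [h [[h0 h1] Hh]] : exists h : R, (0 < h /\ h < 1) /\
    (oct (h *: pl c (- 1) (vcr c x) + x) -> B (glue i (h *: pl c (- 1) (vcr c x) + x))).
  apply: (@filter_ex _ (0 : R)^'+); apply: filterI.
    by apply: filterI; [exact: nbhs_right_gt|exact: nbhs_right_lt].
  exact: (@near_side _ x (pl c (- 1) (vcr c x)) (fun y => oct y -> B (glue i y)) d d0 Hd).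
set y := _ + x in Hh.
have yu : ucr c y = 2 - h by rewrite /y ucr_affine ucr_pl u2; ring.
have yv : `|vcr c y| = 1 + h.
  rewrite /y vcr_affine vcr_pl -[X in _ + X]mul1r -mulrDl normrM v1 mulr1.
  by rewrite ger0_norm; [ring|lra].
have oy : oct y.
  by rewrite (octE c) yu yv ger0_norm; [apply/and3P; split; lra|lra].
have ne c' : edge c' y = false.
  apply/negbTE/negP => /andP[_ /eqP E].
  have E' : `|crd c'.1 y| = 2 by rewrite -norm_ucr E ger0_norm.
  have U : `|crd c.1 y| = 2 - h by rewrite -norm_ucr yu ger0_norm//; lra.
  move: yv; rewrite /vcr; case: (eqVneq c'.1 c.1) E' => [->|]; first by rewrite U; lra.
  by move=> /eqP; case: (c'.1) (c.1) => -[] //= _ ->; lra.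
exists (glue i y); split; last exact: Hh.
left; apply/glued_dirichletP; rewrite fold_glue// blk_glue//; split.
  rewrite /inner /= fold_glue// => -[|[c' [j [_]]]]; last by rewrite ne.
  by rewrite (octiE c) yu yv => /and3P[_ _]; rewrite ger0_norm; lra.
by move=> j c' _; rewrite ne.
Qed.

Definition glued_manifold : flatManifold R := FlatManifold
  (@glued_compact R G) (@glued_hausdorff R G) glued_cover glued_flat
  glued_dirichlet_smooth glued_neumann_smooth
  (ex_intro2 _ _ dirichlet_open_set dirichlet_open_setP erefl)
  (ex_intro2 _ _ neumann_open_set neumann_open_setP erefl)
  glued_disjoint glued_dense.

End Manifold.
Arguments glued_manifold R G : clear implicits.

(** * Eigenfunctions as families on the tiles *)

Section Modes.
Context {R : realType} {G : pattern}.
Implicit Types (x y z : 'rV[R]_2) (i j k : tile G) (c : bool * bool).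
Implicit Types (p q : @glued R G) (phi : tile G -> 'rV[R]_2 -> R).
Local Notation M := (glued_manifold R G).

(* What one sees from the tile i behind its side c: the neighbouring tile, or
   the even or odd mirror image of the tile itself. *)
Definition mirror c (w : tile G -> R) i : R :=
  if act c i == i then sgn (neu c i) * w i else w (act c i).

(* The tilewise form of the eigenvalue problem. The boundary conditions enter
   only through the smoothness of the reflected function, which makes all the
   conditions linear in phi and mirror c phi. *)
Record modes (l : R) phi : Prop := Modes {
  modes_cvg : forall i x, oct x ->
    phi i @ within [set y | oct y] (nbhs x) --> phi i x;
  modes_edge : forall i c x, edge c x -> phi i x = mirror c (phi^~ x) i;
  modes_octi : forall i x, octi x -> exists g, [/\ smooth g,
    \forall y \near x, phi i y = g y & laplacian g x = l * g x];
  modes_smooth : forall i c x, edge c x -> `|vcr c x| < 1 ->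
    exists2 g, smooth g & \forall y \near x, oct y ->
      phi i y = g y /\ mirror c (phi^~ y) i = g (sigma c y);
  modes_diagonal : forall i x, oct x -> ~~ octi x -> (forall c, ~~ edge c x) ->
    phi i x = 0 /\ exists2 g, smooth g &
      \forall y \near x, oct y -> phi i y = g y
}.

Lemma near_octi_oct x : octi x -> \forall y \near x, oct y.
Proof. by move=> /near_octi; apply: filterS => y; exact: octi_oct. Qed.

Lemma near_eq_laplacian (g h : 'rV[R]_2 -> R) x : (\forall y \near x, g y = h y) ->
  laplacian g x = laplacian h x.
Proof.
move=> gh; apply: (etrans (laplacianE _ _)); apply: (etrans _ (esym (laplacianE _ _))).
have E u v := near_eq_foldr [:: u; v] gh.
by have /= -> := E e0 e0; have /= -> := E e1 e1.
Qed.

Lemma interior_laplacian l phi i g x :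
  (forall z, octi z -> exists g, [/\ smooth g,
    \forall y \near z, phi i y = g y & laplacian g z = l * g z]) ->
  (\forall y \near x, oct y -> phi i y = g y) ->
  \forall z \near x, octi z -> laplacian g z = l * g z.
Proof.
move=> H /nbhs_interior N; apply: filterS N => z Nz zi.
have [h [sh ph hz]] := H z zi.
have E : \forall y \near z, g y = h y.
  by apply: filterS (filterI (filterI Nz ph) (near_octi_oct zi)) => y [[gy <-] /gy].
by rewrite (near_eq_laplacian E) hz (nbhs_singleton E).
Qed.

Lemma pl_affine c (h : R) x (a b : R) : h *: pl c a b + x =
  pl c (h * a + ucr c x) (h * b + vcr c x).
Proof.
by apply: (@crP _ c); rewrite ?ucr_affine ?vcr_affine ?ucr_pl ?vcr_pl.
Qed.

Lemma near_inward c x (P : set 'rV[R]_2) : edge c x -> `|vcr c x| < 1 ->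
  (\forall y \near x, octi y -> P y) ->
  \forall h \near (0 : R)^'+, P (h *: pl c (-1) 0 + x).
Proof.
move=> xc v1 /nearP2[d d0 H].
have N := @near_side _ x (pl c (-1) 0) (fun y => octi y -> P y) d d0 H.
have N2 : \forall h \near (0 : R)^'+, h < 1 by exact: nbhs_right_lt.
have N3 : \forall h \near (0 : R)^'+, 0 < h by exact: nbhs_right_gt.
apply: filterS (filterI (filterI N N2) N3) => h [[Ph h1] h0]; apply: Ph.
have [_ /eqP u2] := andP xc.
rewrite pl_affine (octiE c) ucr_pl vcr_pl u2 mulr0 add0r ger0_norm; last by lra.
by apply/and3P; split; lra.
Qed.

Lemma edge_laplacian l phi i g c x : edge c x -> `|vcr c x| < 1 -> smooth g ->
  (forall z, octi z -> exists g, [/\ smooth g,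
    \forall y \near z, phi i y = g y & laplacian g z = l * g z]) ->
  (\forall y \near x, oct y -> phi i y = g y) ->
  laplacian g x = l * g x.
Proof.
move=> xc v1 sg H pg; apply/eqP; rewrite -subr_eq0; apply/eqP.
have sk := smoothB (smooth_laplacian sg) (smoothZ l sg).
apply: (@continuous_side _ _ (fun x => laplacian g x - l * g x) x (pl c (-1) 0)).
  exact: smooth_continuous.
apply: (@near_inward c x (fun y => laplacian g y - l * g y = 0) xc v1).
apply: filterS (interior_laplacian H pg) => y gy /gy ->.
exact: subrr.
Qed.

(** Coordinates in which the side [c] lies on the axis of [flip] and the octagon to its right, as
    the reflection principle requires. *)
Definition frame c x : 'rV[R]_2 := pt (2 - ucr c x) (vcr c x).
Definition unframe c y : 'rV[R]_2 := pl c (2 - crd false y) (crd true y).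

Lemma frameK c : cancel (frame c) (unframe c).
Proof.
by move=> x; rewrite /unframe /frame !crd_pt opprB addrC subrK pl_cr.
Qed.

Lemma unframeK c : cancel (unframe c) (frame c).
Proof.
move=> y; rewrite /frame /unframe ucr_pl vcr_pl opprB addrC subrK; exact: pt_crd.
Qed.

Lemma frame_rigid c : rigid (frame c).
Proof.
exists c.1, (~~ c.2), true, 2, 0; apply/funext => x.
rewrite /frame /rig /ucr /vcr /sgn addr0 mul1r; congr pt.
by case: c.2 => /=; ring.
Qed.

Lemma unframe_rigid c : rigid (unframe c).
Proof.
have [t rt [Kt _]] := rigid_inv (frame_rigid c).
suff -> : unframe c = t by [].
by apply/funext => y; rewrite -[in RHS](unframeK c y) Kt.
Qed.

Lemma frame_sigma c x : frame c (sigma c x) = flip (frame c x).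
Proof.
rewrite /frame /flip !crd_pt /sigma ucr_pl vcr_pl; congr pt; ring.
Qed.

Lemma unframe_affine c (h : R) v y :
  unframe c (h *: v + y) = h *: pl c (- crd false v) (crd true v) + unframe c y.
Proof.
apply: (@crP _ c); rewrite ?ucr_affine ?vcr_affine /unframe ?ucr_pl ?vcr_pl crdD crdZ//.
by ring.
Qed.

Lemma derive_unframe c (g : 'rV[R]_2 -> R) y :
  'D_e0 (g \o unframe c) y = 'D_(pl c (-1) 0) g (unframe c y).
Proof.
apply: (etrans (derive_affine _ _ _ (unframe_affine c))).
have E : pl c (- crd false e0) (crd true e0) = pl c (-1) 0 :> 'rV[R]_2.
  by rewrite /e0 !crd_pt.
exact: (congr1 (fun v => 'D_v g (unframe c y)) E).
Qed.

(** The classical boundary condition is traded for smoothness of the reflected function, the form in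
    which [modes] states it, by applying [reflection_ext] in the coordinates of [frame]. *)
Lemma free_side_smooth l phi i c x (g : 'rV[R]_2 -> R) :
  act c i == i -> edge c x -> `|vcr c x| < 1 -> smooth g ->
  (forall z, octi z -> exists g, [/\ smooth g,
    \forall y \near z, phi i y = g y & laplacian g z = l * g z]) ->
  (\forall y \near x, oct y -> phi i y = g y) ->
  (\forall z \near x, edge c z ->
     if neu c i then 'D_(pl c (-1) 0) g z = 0 else g z = 0) ->
  exists2 h, smooth h & \forall y \near x, oct y ->
      phi i y = h y /\ mirror c (phi^~ y) i = h (sigma c y).
Proof.
move=> ai xc v1 sg H pg bc.
have Nl := interior_laplacian H pg.
have xF : unframe c (frame c x) = x by exact: frameK.
have [d d0 Hd] : exists2 d : R, 0 < d & forall y,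
    (forall s, `|crd s y - crd s (frame c x)| < d) ->
    (octi (unframe c y) -> laplacian g (unframe c y) = l * g (unframe c y)) /\
    (edge c (unframe c y) -> if neu c i then 'D_(pl c (-1) 0) g (unframe c y) = 0
      else g (unframe c y) = 0).
  apply/nearP2; have cu := rigid_continuous (unframe_rigid c).
  have NI : nbhs (unframe c (frame c x)) [set z |
      (octi z -> laplacian g z = l * g z) /\
      (edge c z -> if neu c i then 'D_(pl c (-1) 0) g z = 0 else g z = 0)].
    by rewrite xF; exact: filterI.
  exact: (cu (frame c x) _ NI).
(* The bound [d] keeps the half box where the equation and the boundary condition are known; 1 - |b|
   keeps it inside the octagon and its edge on the open side. *)
pose b := vcr c x; pose r := Num.min d (1 - `|b|).
have r0 : 0 < r by rewrite lt_min d0 subr_gt0.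
have rd : r <= d by rewrite ge_min lexx.
have rb : r <= 1 - `|b| by rewrite ge_min lexx orbT.
have [_ /eqP u2] := andP xc.
have F0 : crd false (frame c x) = 0 by rewrite /frame crd_pt u2 subrr.
have F1 : crd true (frame c x) = b by rewrite /frame crd_pt.
have box y : 0 <= crd false y < r -> `|crd true y - b| < r ->
    forall s, `|crd s y - crd s (frame c x)| < d.
  move=> /andP[y0 yr] yb [].
    by rewrite F1 (lt_le_trans yb).
  by rewrite F0 subr0 ger0_norm// (lt_le_trans yr).
have vlt y : `|crd true y - b| < r -> `|crd true y| < 1.
  move=> yb; have := ler_normD (crd true y - b) b; rewrite subrK; lra.
have sg0 := smooth_rigid (unframe_rigid c) sg.
have eqg y : 0 < crd false y < r -> `|crd true y - b| < r ->
    laplacian (g \o unframe c) y = l * (g \o unframe c) y.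
  move=> y0 yb; have -> := congr1 (@^~ y) (laplacian_rigid (unframe_rigid c) sg).
  case/andP: y0 => y0 yr; have := normr_ge0 b => b0; have vy := vlt _ yb.
  apply: (Hd y _).1; first by apply: box; rewrite ?(ltW y0).
  rewrite (octiE c) /unframe ucr_pl vcr_pl ger0_norm; last by lra.
  by apply/and3P; split; lra.
have bg y : crd false y = 0 /\ `|crd true y - b| < r ->
    if neu c i then 'D_e0 (g \o unframe c) y = 0 else (g \o unframe c) y = 0.
  move=> [y0 yb]; have vy := vlt _ yb.
  have ey : edge c (unframe c y).
    rewrite /edge (octE c) /unframe ucr_pl vcr_pl y0 subr0 eqxx andbT.
    by rewrite ger0_norm//; apply/and3P; split; lra.
  have bY : forall s, `|crd s y - crd s (frame c x)| < d.
    by apply: box; rewrite // y0 lexx.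
  have := (Hd y bY).2 ey; have E := derive_unframe c g y.
  by case: (neu c i) => // Dg; rewrite E.
have [h sh [d' d'0 Hh]] := reflection_ext r0 sg0 eqg bg.
exists (h \o frame c); first exact: smooth_rigid (frame_rigid c) sh.
have Nb : \forall y \near x, `|vcr c y - b| < d'.
  by apply/nearP2; exists d' => // y; apply.
apply: filterS (filterI pg Nb) => y [py yb] oy; have {}py := py oy.
have fy : 0 <= crd false (frame c y).
  by rewrite /frame crd_pt subr_ge0 ucr_le2.
have fb : `|crd true (frame c y) - b| < d' by rewrite /frame crd_pt.
split.
  by rewrite /= (Hh _ fb).1//= frameK.
rewrite /mirror ai py /= frame_sigma.
have gb : `|crd true (flip (frame c y)) - b| < d' by rewrite /flip crd_pt.
rewrite (Hh _ gb).2; last by rewrite /flip crd_pt oppr_le0.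
by rewrite flipK /= frameK.
Qed.

Section Pull.
Variables (f : M -> R) (s : @site G) (i : tile G) (x : 'rV[R]_2).
Variable g : 'rV[R]_2 -> R.
Hypotheses (ox : oct x) (Dx : pdom (site_plaque s) (glue i x)).
Hypothesis fg : \forall q \near (glue i x : M), f q = g (pcoord (site_plaque s) q).

Lemma rep_pull_tile k : k \in cls i x -> \forall y \near x, oct y ->
  f (glue k y) = g (ptau (site_plaque s) k y).
Proof.
move=> ki.
have ND : \forall q \near (glue i x : M), pdom (site_plaque s) q.
  by apply: open_nbhs_nbhs; split=> //; exact: pdom_open.
have NF : \forall q \near (glue i x : M), f q = g (pcoord (site_plaque s) q) /\
    pdom (site_plaque s) q by exact: filterI.
have := @near_glue R G (glue i x) _ k NF; rewrite blk_glue// fold_glue// => /(_ ki).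
by apply: filterS => y H oy; have [-> D] := H oy; rewrite pcoord_glue.
Qed.

Lemma rep_pull : \forall y \near x, oct y ->
  f (glue i y) = (g \o ptau (site_plaque s) i) y.
Proof. by apply: rep_pull_tile; exact: mem_cls. Qed.

Lemma rep_pull_seam c : edge c x -> act c i != i -> \forall y \near x, oct y ->
  f (glue (act c i) y) = (g \o ptau (site_plaque s) i) (sigma c y).
Proof.
move=> xc ai; have [Ji wi] := (pdom_glue (site_plaque s) i ox).1 Dx.
have [_ E] := p_act xc Ji wi ai.
apply: filterS (rep_pull_tile (mem_cls_act i xc)) => y H oy.
by rewrite H// -[in LHS](sigmaK c y) E.
Qed.

End Pull.

Lemma outward_normal_flat (f : 'rV[R]_1 -> R) (u : 'rV[R]_1) (a : R) :
  (\forall z \near u, f z = a) -> outward_normal f u = - e0.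
Proof.
move=> fa.
have D0 a' : 'D_(basis_vec a') f u = 0.
  by rewrite (near_eq_derive (g := cst a))// derive_cst.
rewrite /outward_normal big1 => [|a' _]; last by rewrite D0 expr0n.
rewrite addr0 sqrtr1 invr1 scale1r; apply/rowP => a'.
rewrite /e0 !mxE; case: (unliftP ord0 a') => [k|] _ //; by rewrite D0 oppr0.
Qed.

Lemma loop_tau_affine c (h : R) v x :
  loop_tau c (h *: v + x) = h *: loop_tau c v + loop_tau c x.
Proof.
apply: ptP => -[]; rewrite crdD crdZ /loop_tau !crd_pt.
  by rewrite vcr_affine.
by rewrite ucr_affine opprD mulrN.
Qed.

Lemma loop_tau_rigid c : @rigid R (loop_tau c).
Proof.
exists c.1, (~~ c.2), true, 0, 0; apply/funext => x.
rewrite /loop_tau /rig /ucr /vcr /sgn !addr0 mul1r -mulNr.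
by case: c.2 => //=; rewrite opprK.
Qed.

(** The inward derivative sees only points of the octagon, where [g] and [h] agree. *)
Lemma eq_inward_derive c x (g h : 'rV[R]_2 -> R) : edge c x -> `|vcr c x| < 1 ->
  smooth g -> smooth h -> (\forall y \near x, oct y -> g y = h y) ->
  'D_(pl c (-1) 0) g x = 'D_(pl c (-1) 0) h x.
Proof.
move=> xc v1 sg sh gh; have ox : oct x by case/andP: xc.
have sd := smoothB sg sh.
have gx : g x - h x = 0 by rewrite (nbhs_singleton gh)// subrr.
have D0 : 'D_(pl c (-1) 0) (fun x => g x - h x) x = 0.
  apply: derive_side0; first exact: smooth_derivable.
  rewrite gx; apply: (@near_inward c x (fun y => g y - h y = 0) xc v1).
  by apply: filterS gh => y gy yi; rewrite gy ?subrr// octi_oct.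
have E : 'D_(pl c (-1) 0) (fun x => g x - h x) x =
    'D_(pl c (-1) 0) g x - 'D_(pl c (-1) 0) h x.
  by apply: (@deriveB R _ _ g h x (pl c (-1) 0)); exact: smooth_derivable.
by apply/eqP; rewrite -subr_eq0; apply/eqP; exact: (etrans (esym E) D0).
Qed.

(** The chart in [normal_derivative_at] is an arbitrary one around the point. At an open free side
    it can only be the chart of that side, since the point is not in an open tile and the side is
    not a seam; there the outward normal is - [e0]. *)
Lemma neumann_derivative (f : M -> R) i c x g : oct x -> edge c x ->
  `|vcr c x| < 1 -> act c i == i -> smooth g ->
  (\forall y \near x, oct y -> f (glue i y) = g y) ->
  normal_derivative_at f (glue i x : M) 0 -> 'D_(pl c (-1) 0) g x = 0.
Proof.
move=> ox xc v1 ai sg fg [ch [g' [[[s _ <-] Dx sg' fg'] _ D0]]].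
have pg := rep_pull ox Dx fg'.
have ux : 1 < ucr c x by have [_ /eqP ->] := andP xc; lra.
have := pdom_site ox Dx; case: s Dx pg D0 {fg'} => [j|j c' h|j c' e h] Dx pg D0.
- by rewrite (edge_octi xc) => -[].
- move=> [ji uc']; rewrite {j}ji in h Dx pg D0.
  have cE := edge_gt1 xc uc'; rewrite -{c'}cE in h Dx pg D0 uc' *.
  have E : \forall y \near x, oct y -> g y = (g' \o loop_tau c) y.
    by apply: filterS (filterI fg pg) => y [fy gy] oy; rewrite -fy// gy.
  rewrite (eq_inward_derive xc v1 sg (smooth_rigid (loop_tau_rigid c) sg') E).
  apply: (etrans (derive_affine _ _ _ (loop_tau_affine c))).
  have Lw : loop_tau c (pl c (-1) 0) = e0 :> 'rV[R]_2.
    by rewrite /loop_tau ucr_pl vcr_pl opprK.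
  apply: (etrans (congr1 (fun v => 'D_v g' (loop_tau c x)) Lw)).
  have N : outward_normal trough (base (pcoord (site_plaque (Loop h)) (glue i x)))
      = - e0.
    apply: (@outward_normal_flat _ _ (- 2)); apply: trough_smooth_flat.
    by rewrite base_crd (pcoord_glue ox Dx) /= /loop_tau crd_pt.
  have C : pcoord (site_plaque (Loop h)) (glue i x) = loop_tau c x.
    by rewrite pcoord_glue.
  have {}D0 : 'D_(outward_normal trough (base (pcoord (site_plaque (Loop h))
    (glue i x)))) g' (pcoord (site_plaque (Loop h)) (glue i x)) = 0 := D0.
  rewrite N C in D0.
  have := congr1 (@^~ (loop_tau c x)) (deriveNv e0 sg'); rewrite D0.
  by move=> /esym/eqP; rewrite mulN1r oppr_eq0 => /eqP.
move=> [ij uc']; move: ij (h); rewrite -(edge_gt1 xc uc') => ij.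
have -> : j = i by case: ij => [->//|E]; rewrite -(eqP ai) E actK.
by rewrite ai.
Qed.

Lemma mirror_seam c (w : tile G -> R) i : act c i != i -> mirror c w i = w (act c i).
Proof. by rewrite /mirror => /negbTE ->. Qed.

Lemma side_dirichlet i c x : edge c x -> `|vcr c x| < 1 -> act c i == i ->
  ~~ neu c i -> glued_dirichlet (glue i x).
Proof.
move=> xc v1 ai nc; have ox : oct x by case/andP: xc.
apply/glued_dirichletP; rewrite /setC /= /inner fold_glue// blk_glue//; split.
  case=> [|[c' [j [ji xc' _ aj]]]]; first by rewrite (edge_octi xc).
  move: ji; rewrite (cls_edge _ xc) (eqP ai) !inE orbb => /eqP jE.
  by rewrite jE (edge_disj xc' xc) ai in aj.
move=> j c' ji xc'; rewrite (edge_disj xc' xc); split=> //.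
move: ji; rewrite (cls_edge _ xc) (eqP ai) !inE orbb => /eqP ->.
by rewrite /free_neumann negb_and nc orbT.
Qed.

Lemma side_neumann i c x : edge c x -> `|vcr c x| < 1 -> act c i == i ->
  neu c i -> glued_neumann (glue i x).
Proof.
move=> xc v1 ai nc; have ox : oct x by case/andP: xc.
apply/glued_neumannP; exists i, c.
by rewrite fold_glue// blk_glue// mem_cls /free_neumann ai nc.
Qed.

Lemma side_inner i c x : edge c x -> `|vcr c x| < 1 -> act c i != i ->
  inner (glue i x).
Proof.
move=> xc v1 ai; have ox : oct x by case/andP: xc.
by right; exists c, i; rewrite fold_glue// blk_glue// mem_cls.
Qed.

Lemma diagonal_dirichlet i x : oct x -> ~~ octi x -> (forall c, ~~ edge c x) ->
  glued_dirichlet (glue i x).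
Proof.
move=> ox xi nx; apply/glued_dirichletP; rewrite /setC /= /inner fold_glue// blk_glue//.
split; first by case=> [|[c [j [_]]]]; [exact/negP|rewrite (negbTE (nx c))].
by move=> j c _; rewrite (negbTE (nx c)).
Qed.

(** * From eigenfunctions to modes *)

Section EigenModes.
Variables (l : R) (f : M -> R).
Hypothesis ef : Defs.eigenspace M l f.

Let cf : continuous f. Proof. by case: ef. Qed.

Let smooth_f p : (interior_of M `|` dirichlet M `|` neumann M) p -> smooth_at f p.
Proof. by have [_ H _ _ _] := ef; exact: H. Qed.

Lemma eigen_cvg i x : oct x ->
  (fun y => f (glue i y)) @ within [set y | oct y] (nbhs x) --> f (glue i x).
Proof.
move=> ox W Wf; have N := @cf (glue i x) _ Wf.
exact: (@glue_cvg R G i x ox _ N).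
Qed.

Lemma eigen_smooth i x : oct x -> smooth_at f (glue i x : M) ->
  exists2 g, smooth g & (\forall y \near x, oct y -> f (glue i y) = g y) /\
    forall c, edge c x -> act c i != i ->
      \forall y \near x, oct y -> f (glue (act c i) y) = g (sigma c y).
Proof.
move=> ox [ch [g [[s _ <-] Dx sg fg]]].
exists (g \o ptau (site_plaque s) i).
  by apply: smooth_rigid sg; exact: p_rigid.
split; first exact: rep_pull.
by move=> c xc ai; exact: (rep_pull_seam ox Dx fg).
Qed.

Lemma eigen_octi i x : octi x -> exists g, [/\ smooth g,
  \forall y \near x, f (glue i y) = g y & laplacian g x = l * g x].
Proof.
move=> xi; have ox := octi_oct xi.
have Ip : interior_of M (glue i x).
  by rewrite /interior_of glued_interior; left; rewrite fold_glue.
have [_ _ Lf _ _] := ef.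
have [ch [g [[[s _ <-] Dx sg fg] Lg]]] := Lf _ Ip.
have rt : rigid (ptau (site_plaque s : @plaque R G) i) by exact: p_rigid.
have pg := rep_pull ox Dx fg.
exists (g \o ptau (site_plaque s) i); split.
- exact: smooth_rigid rt sg.
- by apply: filterS (filterI pg (near_octi_oct xi)) => y [] /[apply].
have -> := congr1 (@^~ x) (laplacian_rigid rt sg).
have <- : f (glue i x) = (g \o ptau (site_plaque s) i) x.
  exact: (nbhs_singleton pg).
by rewrite -Lg; congr laplacian; rewrite /= pcoord_glue.
Qed.

(** The ends of the side belong to neither part of the boundary, so the value 0 there has to come
    from continuity along the side. *)
Lemma eigen_side_zero i c x : edge c x -> act c i == i -> ~~ neu c i ->
  f (glue i x) = 0.
Proof.
move=> xc ai nc; have [_ _ _ D0 _] := ef.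
have [v1|v1] := ltP `|vcr c x| 1; first exact: (D0 _ (side_dirichlet xc v1 ai nc)).
have ox : oct x by case/andP: xc.
have {}v1 : `|vcr c x| = 1 by apply/le_anti; rewrite v1 (edge_vcr xc).
apply: contrapT => /eqP fx; have [_ /eqP u2] := andP xc.
have N : \forall y \near x, oct y -> f (glue i y) != 0.
  apply: (@eigen_cvg i x ox [set z | z != 0]).
  by apply: open_nbhs_nbhs; split=> //; exact: open_neq.
have /nearP2[d d0 Hd] := N.
(* The direction runs along the side from its end |v| = 1 towards the midpoint, so that |v| becomes
   1 - h. *)
have [h [[h0 h1] Hh]] : exists h : R, (0 < h /\ h < 1) /\
    (oct (h *: pl c 0 (- vcr c x) + x) ->
     f (glue i (h *: pl c 0 (- vcr c x) + x)) != 0).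
  apply: (@filter_ex _ (0 : R)^'+); apply: filterI.
    by apply: filterI; [exact: nbhs_right_gt|exact: nbhs_right_lt].
  exact: (@near_side _ x (pl c 0 (- vcr c x))
    (fun y => oct y -> f (glue i y) != 0) d d0 Hd).
move: Hh; rewrite pl_affine mulr0 add0r u2.
have vy : `|h * - vcr c x + vcr c x| = 1 - h.
  have -> : h * - vcr c x + vcr c x = (1 - h) * vcr c x by ring.
  by rewrite normrM v1 mulr1 ger0_norm//; lra.
set v := _ + vcr c x in vy *.
have yc : edge c (pl c 2 v).
  rewrite /edge (octE c) ucr_pl vcr_pl vy eqxx andbT ger0_norm//.
  by apply/and3P; split; lra.
have oy : oct (pl c 2 v) by case/andP: yc.
move=> /(_ oy); rewrite D0 ?eqxx//; apply: (side_dirichlet yc) => //.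
by rewrite vcr_pl vy; lra.
Qed.

Lemma eigen_edge i c x : edge c x -> f (glue i x) = mirror c (fun j => f (glue j x)) i.
Proof.
move=> xc; rewrite /mirror; case: ifPn => ai; last by rewrite glue_act.
have [nc|nc] := boolP (neu c i); first by rewrite mul1r.
by rewrite (eigen_side_zero xc ai nc) mulr0.
Qed.

Lemma eigen_modes : modes l (fun i x => f (glue i x)).
Proof.
have [_ _ _ D0 N0] := ef.
split.
- exact: eigen_cvg.
- exact: eigen_edge.
- exact: eigen_octi.
- move=> i c x xc v1; have ox : oct x by case/andP: xc.
  have ux : 1 < ucr c x by have [_ /eqP ->] := andP xc; lra.
  have [ai|ai] := boolP (act c i == i); last first.
    have [|g sg [fg fg']] := @eigen_smooth i x ox.
      apply: smooth_f; left; left; rewrite /interior_of glued_interior.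
      exact: (side_inner xc).
    exists g => //; apply: filterS (filterI fg (fg' c xc ai)) => y [H1 H2] oy.
    by rewrite H1// mirror_seam// H2.
  have [|g sg [fg _]] := @eigen_smooth i x ox.
    apply: smooth_f; have [nc|nc] := boolP (neu c i).
      by right; exact: (side_neumann xc v1 ai nc).
    by left; right; exact: (side_dirichlet xc v1 ai nc).
  apply: (free_side_smooth ai xc v1 sg (eigen_octi i) fg).
  have Nv : \forall z \near x, `|vcr c z| < 1.
    by apply: near_lt v1; exact: norm_crd_continuous.
  apply: filterS (filterI (nbhs_interior fg) Nv) => z [fz vz] zc.
  have oz : oct z by case/andP: zc.
  have [nc|nc] := boolP (neu c i).
    exact: (neumann_derivative oz zc vz ai sg fz (N0 _ (side_neumann zc vz ai nc))).
  by rewrite -(nbhs_singleton fz)//; exact: (eigen_side_zero zc ai nc).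
- move=> i x ox xi nx; have D := diagonal_dirichlet i ox xi nx; split; first exact: D0.
  have [|g sg [fg _]] := @eigen_smooth i x ox; last by exists g.
  by apply: smooth_f; left; right.
Qed.

End EigenModes.

End Modes.

(** * From modes to eigenfunctions *)

Section ModesEigen.
Context {R : realType} {G : pattern}.
Implicit Types (x y z : 'rV[R]_2) (i j k : tile G) (c : bool * bool).
Local Notation M := (glued_manifold R G).
Variables (l : R) (phi : tile G -> 'rV[R]_2 -> R).
Hypothesis mp : modes l phi.

Definition assemble (p : M) : R :=
  phi (odflt (tile0 G) [pick i in blk p]) (fold p).

Lemma assemble_glue i x : oct x -> assemble (glue i x) = phi i x.
Proof.
move=> ox; rewrite /assemble blk_glue// fold_glue//.
case: pickP => [j|/(_ i)]; last by rewrite mem_cls.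
case/clsP => [->//|[c xc ->]] /=.
have [->//|ai] := eqVneq (act c i) i.
by rewrite (modes_edge mp i xc) mirror_seam.
Qed.

Lemma assemble_continuous : continuous assemble.
Proof.
move=> p W; rewrite nbhsE => -[V [oV Vp] VW].
rewrite nbhsE; exists (assemble @^-1` V) => [|q /VW//]; split=> //.
move=> i x ox /=; rewrite assemble_glue// => Vx.
have N : \forall y \near x, oct y -> V (phi i y).
  have NV : nbhs (phi i x) V by apply: open_nbhs_nbhs.
  exact: (modes_cvg mp ox NV).
by apply: filterS N => y Vy oy; rewrite /= assemble_glue//; exact: Vy.
Qed.

(** On a seam one plane function has to represent both adjacent tiles: [g] does so directly on the
    tile [i], and through the reflection [sigma] on its neighbour. Then [p_act] identifies the two
    readings in the chart. *)
Lemma assemble_rep (s : site) i x (g t : 'rV[R]_2 -> _) : oct x ->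
  pdom (site_plaque s) (glue i x) -> rigid t -> cancel (ptau (site_plaque s) i) t ->
  smooth g -> (\forall y \near x, oct y -> phi i y = g y) ->
  (forall c, edge c x -> act c i != i ->
     \forall y \near x, oct y -> phi (act c i) y = g (sigma c y)) ->
  smooth_rep assemble (glue i x : M) (plaque_chart (site_plaque s)) (g \o t).
Proof.
move=> ox Dx rt tK sg pg pg'; split; [by exists s|exact: Dx|exact: smooth_rigid|].
have [Ji wi] := (pdom_glue (site_plaque s) i ox).1 Dx.
have N k : k \in cls i x -> \forall y \near x, oct y ->
    phi k y = g (t (ptau (site_plaque s) k y)).
  case/clsP => [->|[c xc ->]].
    by apply: filterS pg => y H oy; rewrite tK H.
  have [->|ai] := eqVneq (act c i) i.
    by apply: filterS pg => y H oy; rewrite tK H.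
  have [_ E] := p_act xc Ji wi ai.
  apply: filterS (pg' c xc ai) => y H oy.
  by rewrite H// -[in RHS](sigmaK c y) E tK.
have NA : \forall y \near x, forall k, k \in cls i x -> oct y ->
    phi k y = g (t (ptau (site_plaque s) k y)).
  have F := @filter_forall _ _ (fun k y => k \in cls i x -> oct y ->
    phi k y = g (t (ptau (site_plaque s) k y))) (nbhs x) _.
  apply: F => k; have [ki|ki] := boolP (k \in cls i x).
    by apply: filterS (N k ki) => y H _.
  by apply: filterS filterT.
have Nq : \forall q \near (glue i x : M), forall k, k \in cls i x ->
    phi k (fold q) = g (t (ptau (site_plaque s) k (fold q))).
  have cF := @fold_continuous R G (glue i x).
  have NA' : nbhs (fold (glue i x)) [set y | forall k, k \in cls i x -> oct y ->
      phi k y = g (t (ptau (site_plaque s) k y))] by rewrite fold_glue.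
  have NF : \forall q \near (glue i x : M), forall k, k \in cls i x ->
      oct (fold q) -> phi k (fold q) = g (t (ptau (site_plaque s) k (fold q))) :=
    cF _ NA'.
  apply: filterS NF => q Hq k ki; exact: (Hq k ki (oct_fold q)).
have ND : \forall q \near (glue i x : M), pdom (site_plaque s) q.
  by apply: open_nbhs_nbhs; split=> //; exact: pdom_open.
have NB : \forall q \near (glue i x : M), blk q \subset blk (glue i x).
  exact: near_blk.
apply: filterS (filterI (filterI Nq ND) NB) => q [[Hq Dq] Bq].
have [k kq qE] := glueP q.
have ki : k \in cls i x by rewrite -(blk_glue i ox); exact: (fintype.subsetP Bq).
have oq := oct_fold q.
rewrite /= [in LHS]qE assemble_glue// (Hq k ki).
by rewrite [in RHS]qE pcoord_glue// -qE.
Qed.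

Lemma assemble_laplacian (s : @site G) i x (g t : 'rV[R]_2 -> _) : oct x ->
  pdom (site_plaque s) (glue i x) -> rigid t -> cancel (ptau (site_plaque s) i) t ->
  smooth g -> laplacian g x = l * g x -> phi i x = g x ->
  laplacian (g \o t) (Defs.coord (plaque_chart (site_plaque s)) (glue i x)) =
  l * assemble (glue i x).
Proof.
move=> ox Dx rt tK sg Lg pg; rewrite /= pcoord_glue//.
have -> := congr1 (@^~ (ptau (site_plaque s) i x)) (laplacian_rigid rt sg).
by rewrite /= tK Lg assemble_glue// pg.
Qed.

Lemma site_inv (s : @site G) i : exists2 t : 'rV[R]_2 -> 'rV[R]_2, rigid t &
  cancel (ptau (site_plaque s) i) t.
Proof.
have [t rt [tK _]] := rigid_inv (p_rigid (site_plaque s : @plaque R G) i).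
by exists t.
Qed.

Definition unloop c y : 'rV[R]_2 := pl c (- crd false y) (crd true y).

Lemma loop_tauK c : cancel (loop_tau c) (unloop c).
Proof. by move=> x; rewrite /unloop /loop_tau !crd_pt opprK pl_cr. Qed.

Lemma unloopK c : cancel (unloop c) (loop_tau c).
Proof.
move=> y; rewrite /loop_tau /unloop ucr_pl vcr_pl opprK; exact: pt_crd.
Qed.

Lemma unloop_rigid c : rigid (unloop c).
Proof.
have [t rt [Kt _]] := rigid_inv (@loop_tau_rigid R c).
suff -> : unloop c = t by [].
by apply/funext => y; rewrite -[in RHS](unloopK c y) Kt.
Qed.

Lemma unloop_affine c (h : R) v y :
  unloop c (h *: v + y) = h *: unloop c v + unloop c y.
Proof.
apply: (@crP _ c); rewrite ?ucr_affine ?vcr_affine /unloop ?ucr_pl ?vcr_pl crdD crdZ//.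
by ring.
Qed.

Lemma sigma_affine c (h : R) v x :
  sigma c (h *: v + x) = h *: pl c (- ucr c v) (vcr c v) + sigma c x.
Proof.
apply: (@crP _ c); rewrite /sigma ?ucr_affine ?vcr_affine ?ucr_pl ?vcr_pl ?ucr_affine ?vcr_affine//.
by ring.
Qed.

Lemma plN c (a : R) : pl c (- a) 0 = - pl c a 0.
Proof.
apply: (@crP _ c); rewrite -[in RHS]scaleN1r -[in RHS](addr0 (_ *: _)).
  by rewrite ucr_affine !ucr_pl /ucr /crd; case: c.1; rewrite !mxE mulr0 addr0 mulN1r.
by rewrite vcr_affine !vcr_pl /vcr /crd; case: (~~ c.1); rewrite !mxE mulr0 addr0.
Qed.

(** The Neumann condition is recovered from evenness: composing with [sigma] reverses the normal, so
    the normal derivative equals its own negative. *)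
Lemma even_derive c x (g : 'rV[R]_2 -> R) : edge c x -> `|vcr c x| < 1 -> smooth g ->
  (\forall y \near x, oct y -> g y = g (sigma c y)) -> 'D_(pl c 1 0) g x = 0.
Proof.
move=> xc v1 sg gs.
have E := eq_inward_derive xc v1 sg (smooth_rigid (sigma_rigid c) sg) gs.
have E2 : 'D_(pl c (-1) 0) (g \o sigma c) x = 'D_(pl c 1 0) g x.
  apply: (etrans (derive_affine _ _ _ (sigma_affine c))).
  rewrite sigma_edge// ucr_pl vcr_pl.
  by have -> : - (-1) = 1 :> R by rewrite opprK.
have E3 : 'D_(pl c (-1) 0) g x = - 'D_(pl c 1 0) g x.
  apply: (etrans (congr1 (fun v => 'D_v g x) (plN c 1))).
  by have -> := congr1 (@^~ x) (deriveNv (pl c 1 0) sg); rewrite mulN1r.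
have E4 : - 'D_(pl c 1 0) g x = 'D_(pl c 1 0) g x.
  by apply: (etrans (esym E3)); apply: (etrans E).
by move: E4; move: ('D_(pl c 1 0) g x) => a; lra.
Qed.

Lemma assemble_side i c x (h : act c i == i) : edge c x -> `|vcr c x| < 1 ->
  exists g, smooth_rep assemble (glue i x : M) (plaque_chart (site_plaque (Loop h))) g /\
  (neu c i -> 'D_(- e0) g (loop_tau c x) = 0).
Proof.
move=> xc v1; have ox : oct x by case/andP: xc.
have ux : 1 < ucr c x by have [_ /eqP ->] := andP xc; lra.
have Dx : pdom (site_plaque (Loop h)) (glue i x) := loop_dom h ox ux.
have [g sg pg] := modes_smooth mp i xc v1.
exists (g \o unloop c); split.
  apply: assemble_rep => //.
  - exact: unloop_rigid.
  - exact: loop_tauK.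
  - by apply: filterS pg => y H /H[].
  - by move=> c' xc'; rewrite (edge_disj xc' xc) (eqP h) eqxx.
move=> nc; apply: (etrans (derive_affine _ _ _ (unloop_affine c))).
rewrite loop_tauK; have -> : unloop c (- e0) = pl c 1 0.
  by rewrite /unloop -[- e0]scaleN1r !crdZ /e0 !crd_pt mulr1 mulr0 opprK.
apply: (even_derive xc v1 sg).
apply: filterS pg => y H oy; have [<- <-] := H oy.
by rewrite /mirror h nc mul1r.
Qed.

Lemma assemble_eigen : Defs.eigenspace M l assemble.
Proof.
have smooth_in p : interior_of M p -> laplacian_at assemble p (l * assemble p).
  rewrite /interior_of glued_interior.
  have [i _ pE] := glueP p; have := oct_fold p; move: (fold p) pE => x -> ox.
  rewrite {1}/inner fold_glue// blk_glue//.
  case=> [xi|[c [j [ji xc v1 aj]]]].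
    have Dx := inner_dom (R := R) i xi.
    have [g [sg pg Lg]] := modes_octi mp i xi.
    have [t rt tK] := site_inv (Inner i) i.
    exists (plaque_chart (site_plaque (Inner i))), (g \o t); split.
      apply: assemble_rep => //; first by apply: filterS pg => y.
      by move=> c xc; rewrite (edge_octi xc) in xi.
    by apply: assemble_laplacian => //; exact: (nbhs_singleton pg).
  have xE : glue i x = glue j x :> glued G by rewrite (glue_eq ox ji).
  rewrite xE; have ux : 1 < ucr c x by have [_ /eqP ->] := andP xc; lra.
  have Dx := seam_dom aj ox ux.
  have [g sg pg] := modes_smooth mp j xc v1.
  have pg1 : \forall y \near x, oct y -> phi j y = g y.
    by apply: filterS pg => y H /H[].
  have [t rt tK] := site_inv (Seam (vcr c x <= 0) aj) j.
  exists (plaque_chart (site_plaque (Seam (vcr c x <= 0) aj))), (g \o t); split.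
    apply: assemble_rep => // c' xc' _; rewrite (edge_disj xc' xc).
    by apply: filterS pg => y H /H[_]; rewrite mirror_seam.
  apply: assemble_laplacian => //; last exact: (nbhs_singleton pg1).
  exact: (edge_laplacian xc v1 sg (modes_octi mp j) pg1).
have dir p : dirichlet M p -> smooth_at assemble p /\ assemble p = 0.
  move=> /glued_dirichletP; have [i _ pE] := glueP p; have := oct_fold p.
  move: (fold p) pE => x -> ox.
  rewrite /setC /= /inner fold_glue// blk_glue// => -[np H].
  have [[c xc]|nx] := pselect (exists c, edge c x).
    have [v1] := H i c (mem_cls i x) xc; rewrite /free_neumann => nc.
    have ai : act c i == i.
      by apply/negPn/negP => ai; apply: np; right; exists c, i; rewrite mem_cls.
    split; last first.
      (* On a free Dirichlet side [mirror] gives - phi, so the edge condition reads phi = - phi. *)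
      rewrite assemble_glue//; have := modes_edge mp i xc.
      move: nc; rewrite /mirror ai /= => /negbTE ->.
      by rewrite mulN1r; lra.
    have [g [rg _]] := assemble_side ai xc v1.
    by exists (plaque_chart (site_plaque (Loop ai))), g.
  have {}nx c : ~~ edge c x by apply/negP => xc; apply: nx; exists c.
  have xi : ~~ octi x by apply/negP => xi; apply: np; left.
  have [p0 [g sg pg]] := modes_diagonal mp i ox xi nx.
  split; last by rewrite assemble_glue.
  have [c uc] := side_of_boundary ox xi.
  have nf c' : edge c' x -> act c' i != i -> \forall y \near x, oct y ->
      phi (act c' i) y = g (sigma c' y) by rewrite (negbTE (nx c')).
  have [h|h] := boolP (act c i == i).
    have [t rt tK] := site_inv (Loop h) i.
    exists (plaque_chart (site_plaque (Loop h))), (g \o t).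
    by apply: assemble_rep => //; exact: loop_dom.
  have [t rt tK] := site_inv (Seam (vcr c x <= 0) h) i.
  exists (plaque_chart (site_plaque (Seam (vcr c x <= 0) h))), (g \o t).
  by apply: assemble_rep => //; exact: seam_dom.
have neum p : neumann M p -> smooth_at assemble p /\ normal_derivative_at assemble p 0.
  move=> /glued_neumannP[i [c [ip pc v1 /andP[ai nc]]]].
  have op := oct_fold p; rewrite (glue_fold ip).
  have [g [rg Dg]] := assemble_side ai pc v1.
  split; first by exists (plaque_chart (site_plaque (Loop ai))), g.
  have uc : 1 < ucr c (fold p) by have [_ /eqP ->] := andP pc; lra.
  have Dx := loop_dom ai op uc.
  have N : \forall z \near base (pcoord (site_plaque (Loop ai)) (glue i (fold p))),
      trough z = - 2.
    apply: trough_smooth_flat.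
    by rewrite base_crd (pcoord_glue op Dx) /= /loop_tau crd_pt.
  exists (plaque_chart (site_plaque (Loop ai))), g; split=> //.
    by exists (cst (- 2)); [exact: smooth_cst|exact: N].
  have -> : outward_normal (profile (plaque_chart (site_plaque (Loop ai))))
    (base (Defs.coord (plaque_chart (site_plaque (Loop ai))) (glue i (fold p)))) = - e0.
    exact: (outward_normal_flat N).
  have -> : Defs.coord (plaque_chart (site_plaque (Loop ai))) (glue i (fold p)) =
    loop_tau c (fold p) := pcoord_glue op Dx.
  exact: Dg.
split.
- exact: assemble_continuous.
- move=> p [[/smooth_in|/dir[]//]|/neum[]//].
  by move=> [ch [g [rg _]]]; exists ch, g.
- exact: smooth_in.
- by move=> p /dir[].
- by move=> p /neum[].
Qed.

End ModesEigen.

(** * Transplantation *)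

Section Dimension.
Context {R : realType}.

(** Linearity in the form used by [has_dim]; the case k = 0 says that the zero function is sent to
    the zero function. *)
Definition combination_map (T T' : Type) (F : (T -> R) -> T' -> R) :=
  forall k (a : 'I_k -> R) (e : 'I_k -> T -> R),
    F (fun x => \sum_i a i * e i x) = (fun y => \sum_i a i * F (e i) y).

Lemma has_dim_map (T T' : Type) (E : set (T -> R)) (E' : set (T' -> R))
    (F : (T -> R) -> T' -> R) (H : (T' -> R) -> T -> R) (k : nat) :
  combination_map F -> combination_map H ->
  (forall f, E f -> E' (F f)) -> (forall f, E' f -> E (H f)) ->
  (forall f, E f -> H (F f) = f) -> (forall f, E' f -> F (H f) = f) ->
  has_dim E k -> has_dim E' k.
Proof.
move=> lF lH EF EH HF FH [e [fe Ee]].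
have Ea (a : 'I_k -> R) : E (fun x => \sum_i a i * e i x).
  by apply/Ee; exists a.
have H0 : H (fun _ => 0) = (fun _ => 0).
  have := lH 0%N (fun _ => 0) (fun _ _ => 0).
  have z U : (fun _ : U => \sum_(i < 0) (0 * 0 : R)) = (fun _ => 0).
    by apply/funext => x; rewrite big_ord0.
  by rewrite z => ->; apply/funext => x; rewrite big_ord0.
exists (fun i => F (e i)); split.
  move=> a a0; apply: fe => x.
  have a0' : F (fun x => \sum_i a i * e i x) = (fun _ => 0).
    by rewrite lF; apply/funext.
  have := HF _ (Ea a); rewrite a0' H0 => E0.
  by have := congr1 (@^~ x) E0 => /= <-.
move=> f; split.
  move=> E'f; have /Ee[a Ha] := EH _ E'f.
  exists a => y; have HE : H f = (fun x => \sum_i a i * e i x) by apply/funext.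
  by have := congr1 (@^~ y) (FH _ E'f); rewrite HE lF => /= <-.
move=> [a Ha]; have -> : f = F (fun x => \sum_i a i * e i x).
  by rewrite lF; apply/funext.
exact/EF/Ea.
Qed.

Lemma same_spectrum_map (T T' : Type) (E : R -> set (T -> R))
    (E' : R -> set (T' -> R)) (F : (T -> R) -> T' -> R) (H : (T' -> R) -> T -> R) :
  combination_map F -> combination_map H ->
  (forall l f, E l f -> E' l (F f)) -> (forall l f, E' l f -> E l (H f)) ->
  (forall l f, E l f -> H (F f) = f) -> (forall l f, E' l f -> F (H f) = f) ->
  same_spectrum E E'.
Proof.
move=> lF lH EF EH HF FH l k; split.
  exact: (has_dim_map lF lH (EF l) (EH l) (HF l) (FH l)).
exact: (has_dim_map lH lF (EH l) (EF l) (FH l) (HF l)).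
Qed.

End Dimension.

Section Transplantation.
Context {R : realType}.

Definition transplant (G G' : pattern) (T : tile G' -> tile G -> R)
    (w : tile G -> R) (i : tile G') : R := \sum_j T i j * w j.

Definition intertwines (G G' : pattern) (T : tile G' -> tile G -> R) :=
  forall c (w : tile G -> R) i,
    transplant T (mirror c w) i = mirror c (transplant T w) i.

Variables (G G' : pattern) (T : tile G' -> tile G -> R).
Hypothesis TA : intertwines T.

Lemma laplacian_sum (I : Type) (s : seq I) (g : I -> 'rV[R]_2 -> R) :
  (forall i, smooth (g i)) ->
  laplacian (fun x => \sum_(i <- s) g i x) = (fun x => \sum_(i <- s) laplacian (g i) x).
Proof.
move=> sg; elim: s => [|i s IH]; apply/funext => x.
  rewrite big_nil; have -> : (fun x => \sum_(i <- [::]) g i x) = (cst 0 : 'rV[R]_2 -> R).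
    by apply/funext => y; rewrite big_nil.
  apply: (etrans (laplacianE _ _)).
  have D v : 'D_v (cst 0 : 'rV[R]_2 -> R) = cst 0.
    by apply/funext => y; rewrite derive_cst.
  have E v := congr1 (@^~ x) (etrans (congr1 (fun h => 'D_v h) (D v)) (D v)).
  have -> := E e0; have -> := E e1; by rewrite /= addr0 oppr0.
have -> : (fun x => \sum_(i <- i :: s) g i x) =
    (fun x => g i x + (fun x => \sum_(i <- s) g i x) x).
  by apply/funext => y; rewrite big_cons.
have -> := congr1 (@^~ x) (laplacianD (sg i) (smooth_sum s sg)).
by rewrite big_cons IH.
Qed.

Lemma near_forall (I : finType) (x : 'rV[R]_2) (P : I -> 'rV[R]_2 -> Prop) :
  (forall i, \forall y \near x, P i y) -> \forall y \near x, forall i, P i y.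
Proof. by move=> H; have F := @filter_forall _ _ P (nbhs x) _; apply: F. Qed.

Lemma within_cvg_sum (I : Type) (s : seq I) (g : I -> 'rV[R]_2 -> R) (D : set 'rV[R]_2) x :
  (forall i, g i @ within D (nbhs x) --> g i x) ->
  (fun y => \sum_(i <- s) g i y) @ within D (nbhs x) --> \sum_(i <- s) g i x.
Proof.
move=> cg; elim: s => [|i s IH].
  rewrite big_nil; under eq_fun do rewrite big_nil; exact: cvg_cst.
rewrite big_cons; under eq_fun do rewrite big_cons.
exact: (cvgD (cg i) IH).
Qed.

(** Local representatives are combined with the coefficients of [T]; intertwining identifies the
    combination of the reflected functions with the reflection of the combination, as the conditions
    at sides demand. *)
Lemma transplant_modes l phi : modes l phi ->
  modes l (fun i x => transplant T (phi^~ x) i).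
Proof.
move=> mp; split.
- move=> i x ox; apply: within_cvg_sum => j.
  exact: (cvgM (cvg_cst _) (modes_cvg mp ox)).
- move=> i c x xc; rewrite -TA; apply: eq_bigr => j _.
  by rewrite -(modes_edge mp j xc).
- move=> i x xi; have [g Hg] := choice (fun j => modes_octi mp j xi).
  have sg j : smooth (fun x => T i j * g j x).
    by apply: smoothZ; have [] := Hg j.
  exists (fun x => \sum_j T i j * g j x); split.
  + exact: smooth_sum.
  + have N : \forall y \near x, forall j, phi j y = g j y.
      by apply: near_forall => j; have [] := Hg j.
    by apply: filterS N => y E; apply: eq_bigr => j _; rewrite E.
  have -> := congr1 (@^~ x) (laplacian_sum (index_enum _) sg).
  rewrite mulr_sumr; apply: eq_bigr => j _; have [sj _ Lj] := Hg j.
  by have -> := congr1 (@^~ x) (laplacianZ (T i j) sj); rewrite Lj mulrCA.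
- move=> i c x xc v1.
  have H j : exists g, smooth g /\ \forall y \near x, oct y ->
      phi j y = g y /\ mirror c (phi^~ y) j = g (sigma c y).
    by have [g] := modes_smooth mp j xc v1; exists g.
  have [g Hg] := choice H.
  exists (fun x => \sum_j T i j * g j x).
    by apply: smooth_sum => j; apply: smoothZ; have [] := Hg j.
  have N : \forall y \near x, forall j, oct y ->
      phi j y = g j y /\ mirror c (phi^~ y) j = g j (sigma c y).
    by apply: near_forall => j; have [] := Hg j.
  apply: filterS N => y E oy; split.
    by apply: eq_bigr => j _; rewrite (E j oy).1.
  by rewrite -TA; apply: eq_bigr => j _; rewrite (E j oy).2.
move=> i x ox xi nx; split.
  by rewrite /transplant big1// => j _; rewrite (modes_diagonal mp j ox xi nx).1 mulr0.
have H j : exists g, smooth g /\ \forall y \near x, oct y -> phi j y = g y.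
  by have [_ [g]] := modes_diagonal mp j ox xi nx; exists g.
have [g Hg] := choice H.
exists (fun x => \sum_j T i j * g j x).
  by apply: smooth_sum => j; apply: smoothZ; have [] := Hg j.
have N : \forall y \near x, forall j, oct y -> phi j y = g j y.
  by apply: near_forall => j; have [] := Hg j.
by apply: filterS N => y E oy; apply: eq_bigr => j _; rewrite (E j oy).
Qed.

Definition transplant_fun (f : glued_manifold R G -> R) : glued_manifold R G' -> R :=
  assemble (fun i x => transplant T (fun j => f (glue j x)) i).

Lemma transplant_fun_combination : combination_map transplant_fun.
Proof.
move=> k a e; apply/funext => p; rewrite /transplant_fun /assemble /transplant.
under eq_bigr do rewrite mulr_sumr.
rewrite exchange_big; apply: eq_bigr => i _; rewrite mulr_sumr.
by apply: eq_bigr => j _; rewrite mulrCA.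
Qed.

Lemma transplant_fun_eigen l f : Defs.eigenspace (glued_manifold R G) l f ->
  Defs.eigenspace (glued_manifold R G') l (transplant_fun f).
Proof. by move=> ef; apply/assemble_eigen/transplant_modes/eigen_modes. Qed.

Lemma transplant_fun_glue l f i x : Defs.eigenspace (glued_manifold R G) l f ->
  oct x -> transplant_fun f (glue i x) = transplant T (fun j => f (glue j x)) i.
Proof.
move=> ef ox; apply: (assemble_glue (l := l)) => //.
exact/transplant_modes/eigen_modes.
Qed.

End Transplantation.

Lemma transplantK (R : realType) (G G' : pattern) (T : tile G' -> tile G -> R)
    (S : tile G -> tile G' -> R) l f :
  intertwines T -> intertwines S ->
  (forall w i, transplant S (transplant T w) i = w i) ->
  Defs.eigenspace (glued_manifold R G) l f ->
  transplant_fun S (transplant_fun T f) = f.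
Proof.
move=> TA SA ST ef; apply/funext => p; have [i _ pE] := glueP p.
have ox := oct_fold p; rewrite pE.
rewrite (transplant_fun_glue SA i (transplant_fun_eigen TA ef) ox).
have -> : (fun j => transplant_fun T f (glue j (fold p))) =
    transplant T (fun j => f (glue j (fold p))).
  by apply/funext => j; rewrite (transplant_fun_glue TA j ef ox).
exact: ST.
Qed.

Lemma transplant_isospectral (R : realType) (G G' : pattern)
    (T : tile G' -> tile G -> R) (S : tile G -> tile G' -> R) :
  intertwines T -> intertwines S ->
  (forall w i, transplant S (transplant T w) i = w i) ->
  (forall w i, transplant T (transplant S w) i = w i) ->
  isospectral (glued_manifold R G) (glued_manifold R G').
Proof.
move=> TA SA ST TS.
apply: (same_spectrum_map (F := transplant_fun T) (H := transplant_fun S)).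
- exact: transplant_fun_combination.
- exact: transplant_fun_combination.
- by move=> l f; exact: transplant_fun_eigen.
- by move=> l f; exact: transplant_fun_eigen.
- by move=> l f; exact: (transplantK TA SA ST).
- by move=> l f; exact: (transplantK SA TA TS).
Qed.

(** * Contractions *)

Section RealContinuity.
Context {R : realType} {Z : topologicalType}.
Implicit Types f g : Z -> R.

Lemma continuous_addf f g : continuous f -> continuous g ->
  continuous (fun z => f z + g z).
Proof. by move=> cf cg z; exact: (cvgD (cf z) (cg z)). Qed.

Lemma continuous_mulf f g : continuous f -> continuous g ->
  continuous (fun z => f z * g z).
Proof. by move=> cf cg z; exact: (cvgM (cf z) (cg z)). Qed.

Lemma continuous_minf f g : continuous f -> continuous g ->
  continuous (fun z => Num.min (f z) (g z)).
Proof. by move=> cf cg z; exact: (@continuous_min _ _ f g z (cf z) (cg z)). Qed.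

Lemma continuous_maxf f g : continuous f -> continuous g ->
  continuous (fun z => Num.max (f z) (g z)).
Proof. by move=> cf cg z; exact: (@continuous_max _ _ f g z (cf z) (cg z)). Qed.

Lemma continuous_cstf (a : R) : continuous (fun _ : Z => a).
Proof. by move=> z; exact: cvg_cst. Qed.

(** The retraction of the line onto [0, 1]; it turns maps on the interval into globally continuous
    ones, which the pasting lemmas accept. *)
Definition clip (x : R) : R := Num.max 0 (Num.min 1 x).

Lemma clip_ge0 x : 0 <= clip x.
Proof. by rewrite /clip le_max lexx. Qed.

Lemma clip_le1 x : clip x <= 1.
Proof. by rewrite /clip ge_max ler01 ge_min lexx. Qed.

Lemma clip_id x : 0 <= x <= 1 -> clip x = x.
Proof. by case/andP => x0 x1; rewrite /clip (min_r x1) (max_r x0). Qed.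

Lemma clip_le0 x : x <= 0 -> clip x = 0.
Proof.
by move=> x0; rewrite /clip (min_r (le_trans x0 ler01)) max_l.
Qed.

Lemma clip_ge1 x : 1 <= x -> clip x = 1.
Proof. by move=> x1; rewrite /clip (min_l x1) max_r. Qed.

Lemma continuous_clip f : continuous f -> continuous (fun z => clip (f z)).
Proof.
move=> cf; apply: continuous_maxf; first exact: continuous_cstf.
by apply: continuous_minf => //; exact: continuous_cstf.
Qed.

Lemma closed_le_cont f (a : R) : continuous f ->
  closed [set z | f z <= a].
Proof.
move=> cf; apply: (@closed_comp _ _ f [set x | x <= a]); last exact: closed_le.
by move=> z _; exact: cf.
Qed.

Lemma closed_ge_cont f (a : R) : continuous f ->
  closed [set z | a <= f z].
Proof.
move=> cf; apply: (@closed_comp _ _ f [set x | a <= x]); last exact: closed_ge.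
by move=> z _; exact: cf.
Qed.

End RealContinuity.

Lemma continuous_paste (Z T : topologicalType) (I : finType) (C : I -> set Z)
    (F : Z -> T) : (forall i, closed (C i)) -> (forall z, exists i, C i z) ->
  (forall i, exists2 g : Z -> T, continuous g & forall z, C i z -> F z = g z) ->
  continuous F.
Proof.
move=> clC cov H z W Wz.
have N i : \forall y \near z, C i y -> W (F y).
  have [g cg Fg] := H i; have [Cz|nCz] := pselect (C i z).
    have Wg : nbhs (g z) W by rewrite -Fg.
    have N : \forall y \near z, W (g y) := cg z _ Wg.
    by apply: filterS N => y Wy Cy; rewrite Fg.
  have NC : \forall y \near z, ~ C i y.
    by apply: open_nbhs_nbhs; split=> //; exact: closed_openC.
  by apply: filterS NC => y nC /nC.
have F' := @filter_forall _ _ (fun i y => C i y -> W (F y)) (nbhs z) _ N.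
have {}F' : \forall y \near z, forall i, C i y -> W (F y) by apply: F'.
by apply: filterS F' => y Hy; have [i Ci] := cov y; exact: (Hy i).
Qed.

Lemma continuous_paste2 (R : realType) (Z U : topologicalType) (f : Z -> R) (a : R)
    (G g h : Z -> U) :
  continuous f -> continuous g -> continuous h ->
  (forall z, f z <= a -> G z = g z) -> (forall z, a <= f z -> G z = h z) ->
  continuous G.
Proof.
move=> cf cg ch Gg Gh.
apply: (@continuous_paste _ _ _
  (fun b : bool => if b then [set z | f z <= a] else [set z | a <= f z])).
- by case; [exact: closed_le_cont|exact: closed_ge_cont].
- by move=> z; have [za|/ltW za] := leP (f z) a; [exists true|exists false].
- by case; [exists g|exists h].
Qed.

Section Contraction.
Context {R : realType} {T : topologicalType}.
Variables (F : T * R -> T) (x0 : T).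
Hypotheses (cF : continuous F) (F0 : forall p, F (p, 0) = p)
  (F1 : forall p, F (p, 1) = x0).

Lemma contraction_comp (Z : topologicalType) (g : Z -> T) (h : Z -> R) :
  continuous g -> continuous h -> continuous (fun z => F (g z, h z)).
Proof.
move=> cg ch z; apply: (@continuous_comp _ _ _ (fun z => (g z, h z)) F); last exact: cF.
exact: (cvg_pair (cg z) (ch z)).
Qed.

Lemma contraction_path_connected : @path_connected_space R T.
Proof.
split; first by exists x0.
move=> x y.
exists (fun t => if t <= 2^-1 then F (x, 2 * t) else F (y, 2 - 2 * t)); split.
- apply: continuous_subspaceT.
  apply: (@continuous_paste2 _ _ _ (fun t => t) 2^-1 _ (fun t => F (x, 2 * t))
    (fun t => F (y, 2 - 2 * t))).
  + by move=> t; exact: cvg_id.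
  + apply: contraction_comp; first by move=> t; exact: cvg_cst.
    by apply: continuous_mulf; [exact: continuous_cstf|move=> t; exact: cvg_id].
  + apply: contraction_comp; first by move=> t; exact: cvg_cst.
    move=> t; apply: cvgB; first exact: cvg_cst.
    by apply: cvgM; [exact: cvg_cst|exact: cvg_id].
  + by move=> t ->.
  + move=> t t2; case: ifP => // t2'.
    have -> : t = 2^-1 by apply/le_anti; rewrite t2 t2'.
    by rewrite mulfV// F1 (_ : 2 - 1 = 1) ?F1//; ring.
- by rewrite invr_ge0 ler0n mulr0 F0.
- by rewrite ifF; [rewrite mulr1 subrr F0|apply/negbTE; rewrite -ltNge; lra].
Qed.

Section Loop.
Variable gamma : R -> T.
Hypotheses (cg : {within `[0, 1], continuous gamma}) (gE : gamma 0 = gamma 1).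

Let g (t : R) := gamma (clip t).

Let cgt : continuous g.
Proof.
move=> t W Wt; have ct : clip t \in `[0, 1]%R by rewrite in_itv /= clip_ge0 clip_le1.
have W0 : \forall z \near clip t, `[0, 1]%classic z -> W (gamma z).
  exact: ((subspace_continuousP _ _).1 cg (clip t) ct W Wt).
have cc : continuous (fun t : R => clip t).
  by apply: continuous_clip => z; exact: cvg_id.
have N : \forall z \near t, `[0, 1]%classic (clip z) -> W (gamma (clip z)) := cc t _ W0.
apply: filterS N => z; apply.
by rewrite /= in_itv /= clip_ge0 clip_le1.
Qed.

(* A square filled by moving along the track of the base point under the
   contraction, then once around the moved loop, then back. *)
Let stage1 (z : R * R) : T :=
  let t := clip z.1 in let s := clip (2 * z.2) in
  F (g (t + s * (2 * t - 1)), Num.min s (Num.min (3 * t) (3 - 3 * t))).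

(* The track of the base point is run through and back, up to a shorter and
   shorter time. *)
Let stage2 (z : R * R) : T :=
  let t := clip z.1 in
  F (gamma 0, Num.min 1 (Num.min (3 * t) (3 - 3 * t)) * (2 - 2 * z.2)).

(** At s = 1/2 the loop argument is 3t - 1: on the outer thirds it is clipped to an end of the loop,
    which gives the track of the base point, and on the middle third the contraction time is 1,
    which gives the constant [x0]. *)
Let stages_agree z : z.2 = 2^-1 -> stage1 z = stage2 z.
Proof.
move=> zE; rewrite /stage1 /stage2 zE mulfV// (clip_ge1 (lexx 1)).
have -> : 2 - 1 = 1 :> R by ring.
rewrite mulr1 mul1r; have := clip_ge0 z.1; have := clip_le1 z.1.
move: (clip z.1) => t t1 t0; rewrite /g.
have [ta|ta] := leP (3 * t) 1.
  by rewrite clip_le0//; lra.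
have [tb|tb] := leP (3 - 3 * t) 1.
  by rewrite clip_ge1 ?gE//; lra.
by rewrite min_l ?F1//; rewrite le_min; apply/andP; split; lra.
Qed.

(** The contraction may move the base point, so by itself it gives a free homotopy only. Conjugating
    by the track of the base point fixes both ends of the loop, and [stage2] then retracts the
    track. *)
Lemma contraction_null_homotopic : null_homotopic gamma.
Proof.
have c1 : continuous (fun z : R * R => z.1) by move=> z; exact: cvg_fst.
have c2 : continuous (fun z : R * R => z.2) by move=> z; exact: cvg_snd.
have cc (a : R) : continuous (fun _ : R * R => a) by exact: continuous_cstf.
have ct : continuous (fun z : R * R => clip z.1) by exact: continuous_clip.
have cs : continuous (fun z : R * R => clip (2 * z.2)).
  by apply: continuous_clip; exact: continuous_mulf.
have c3 : continuous (fun z : R * R => 3 * clip z.1) by exact: continuous_mulf.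
have c33 : continuous (fun z : R * R => 3 - 3 * clip z.1).
  by move=> z; exact: (cvgB (cvg_cst _) (c3 z)).
have cm : continuous (fun z : R * R => Num.min (3 * clip z.1) (3 - 3 * clip z.1)).
  exact: continuous_minf.
exists (fun z => if z.2 <= 2^-1 then stage1 z else stage2 z); split.
- apply: continuous_subspaceT.
  apply: (@continuous_paste2 _ _ _ snd 2^-1 _ stage1 stage2) => //.
  + apply: contraction_comp; last exact: continuous_minf.
    move=> z; apply: (@continuous_comp _ _ _
      (fun z : R * R => clip z.1 + clip (2 * z.2) * (2 * clip z.1 - 1)) g).
      apply: continuous_addf => //; apply: continuous_mulf => //.
      move=> y; apply: cvgB; last exact: cvg_cst.
      by apply: cvgM; [exact: cvg_cst|exact: ct].
    exact: cgt.
  + apply: contraction_comp; first by move=> z; exact: cvg_cst.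
    apply: continuous_mulf; first exact: continuous_minf.
    move=> z; apply: cvgB; first exact: cvg_cst.
    by apply: cvgM; [exact: cvg_cst|exact: c2].
  + by move=> z ->.
  + move=> z z2; case: ifP => // z2'; apply: stages_agree.
    by apply/le_anti; rewrite z2 z2'.
- move=> t t01; rewrite /= ifT; last by rewrite invr_ge0 ler0n.
  rewrite /stage1 /= mulr0 (clip_le0 (lexx 0)) mul0r addr0 min_l; last first.
    by rewrite (clip_id t01) le_min; case/andP: t01 => ? ?; apply/andP; split; lra.
  by rewrite F0 /g !clip_id.
- move=> t _; rewrite /= ifF; last by apply/negbTE; rewrite -ltNge; lra.
  by rewrite /stage2 /= mulr1 subrr mulr0 F0.
have m0 (s : R) : 0 <= s -> Num.min s (Num.min 0 3) = 0 /\ Num.min s (Num.min 3 0) = 0.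
  by move=> s0; rewrite (min_l (ler0n R 3)) (min_r (ler0n R 3)) min_r.
move=> s s01; split; rewrite /= /stage1 /stage2 /=.
  rewrite (clip_le0 (lexx 0)) !mulr0 subr0 sub0r mulrN1 add0r.
  rewrite (m0 _ (clip_ge0 _)).1 (m0 _ ler01).1 mul0r !F0 /g clip_le0 ?if_same//.
  by rewrite oppr_le0 clip_ge0.
rewrite (clip_ge1 (lexx 1)) !mulr1 subrr (m0 _ (clip_ge0 _)).2 (m0 _ ler01).2.
rewrite mul0r !F0 /g clip_ge1 ?gE ?if_same//.
by rewrite (_ : 2 - 1 = 1); [rewrite mulr1 lerDl clip_ge0|ring].
Qed.

End Loop.

Lemma contraction_simply_connected : simply_connected R T.
Proof.
split; first exact: contraction_path_connected.
exact: contraction_null_homotopic.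
Qed.

End Contraction.

(** * Connectedness of glued octagons *)

Section Convexity.
Context {R : realType}.
Implicit Types (x y : 'rV[R]_2) (c : bool * bool).

Lemma oct_convex x y (s : R) : 0 <= s <= 1 -> oct x -> oct y ->
  oct ((1 - s) *: x + s *: y).
Proof.
case/andP=> s0 s1; have s0' : 0 <= 1 - s by rewrite subr_ge0.
have H k : `|crd k ((1 - s) *: x + s *: y)| <= (1 - s) * `|crd k x| + s * `|crd k y|.
  rewrite crdD !crdZ; apply: le_trans (ler_normD _ _) _.
  by rewrite !normrM (ger0_norm s0) (ger0_norm s0').
move=> /and3P[x0 x1 x2] /and3P[y0 y1 y2].
have h0 := H false; have h1 := H true.
apply/and3P; split; nra.
Qed.

Lemma oct_scale x (s : R) : 0 <= s <= 1 -> oct x -> oct (s *: x).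
Proof.
move=> s01 ox; have := oct_convex s01 oct0 ox.
by rewrite scaler0 add0r.
Qed.

Lemma edge_pl c (v : R) : `|v| <= 1 -> edge c (pl c 2 v).
Proof.
move=> v1; rewrite /edge (octE c) ucr_pl vcr_pl eqxx andbT ger0_norm//.
by apply/and3P; split; lra.
Qed.

Lemma continuous_pl (Z : topologicalType) c (u : R) (f : Z -> R) : continuous f ->
  continuous (fun z => pl c u (f z)).
Proof.
move=> cf; have E v : pl c u v = v *: pl c 0 1 + pl c u 0.
  apply: (@crP _ c); first by rewrite ucr_affine !ucr_pl mulr0 add0r.
  by rewrite vcr_affine !vcr_pl mulr1 addr0.
under eq_fun do rewrite E.
move=> z; apply: cvgD; last exact: cvg_cst.
by apply: cvgZr_tmp; exact: cf.
Qed.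

End Convexity.

Section Connectedness.
Context {R : realType} {G : pattern}.
Hypothesis G_connected : forall B : tile G -> Prop, B (tile0 G) ->
  (forall c i, B i -> B (act c i)) -> forall i, B i.

Lemma glued_connected : connected_space (@glued R G).
Proof.
split; first by exists (glue0 G).
pose C := connected_component [set: @glued R G] (glue (tile0 G) 0).
have seg i (x : 'rV[R]_2) : oct x ->
    connected_component [set: @glued R G] (glue i 0) (glue i x).
  move=> ox; pose g (t : R) : @glued R G := glue i (clip t *: x).
  have cg : continuous g.
    apply: glue_comp_continuous.
      move=> t; apply: cvgZr_tmp; apply: (@continuous_clip R R id).
      by move=> z; exact: cvg_id.
    by move=> t; apply: oct_scale; rewrite ?clip_ge0 ?clip_le1.
  exists (g @` `[0, 1]%classic).
    split=> //; last first.
      apply: connected_continuous_connected; first exact: segment_connected.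
      exact: continuous_subspaceT.
    by exists 0; rewrite /= ?in_itv/= ?lexx ?ler01// /g clip_le0 ?scale0r.
  by exists 1; rewrite /= ?in_itv/= ?lexx ?ler01// /g clip_ge1 ?scale1r.
have CG i : C (glue i 0).
  apply: (G_connected (B := fun i => C (glue i 0))).
    exact: connected_component_refl.
  move=> c j Cj; apply: connected_component_trans Cj _.
  have e0 : edge c (pl c (2 : R) 0) by apply: edge_pl; rewrite normr0.
  have o0 : oct (pl c (2 : R) 0) by case/andP: e0.
  apply: connected_component_trans (seg j _ o0) _.
  by rewrite -(glue_act _ e0); apply: connected_component_sym; exact: seg.
have -> : [set: @glued R G] = C.
  apply/seteqP; split=> // p _; have [i _ ->] := glueP p.
  exact: connected_component_trans (CG i) (seg i _ (oct_fold p)).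
exact: component_connected.
Qed.

End Connectedness.

(** * Contraction of a star of octagons *)

Section Star.
Context {R : realType} {G : pattern}.
Variables (center : tile G) (col : tile G -> bool * bool).
Hypothesis col_center : forall i, i != center -> act (col i) i = center.
Hypothesis col_act : forall c i, i != center -> act c i != i -> c = col i.

(** An outer tile is projected along the normal of the side shared with the centre. The tangential
    coordinate is clamped because the octagon, with |v| <= 2, is wider than the side, with |v| <=
    1. *)
Let retract i (x : 'rV[R]_2) : 'rV[R]_2 :=
  if i == center then x
  else pl (col i) 2 (Num.max (-1) (Num.min 1 (vcr (col i) x))).

Let edge_retract i x : i != center -> edge (col i) (retract i x).
Proof.
move=> ic; rewrite /retract (negbTE ic); apply: edge_pl.
rewrite ler_norml le_max lexx /= ge_max ge_min lexx /=; lra.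
Qed.

Let oct_retract i x : oct x -> oct (retract i x).
Proof.
by move=> ox; have [ic|/(edge_retract x)/andP[]//] := eqVneq i center; rewrite /retract ic eqxx.
Qed.

Let retract_edge i x : edge (col i) x -> retract i x = x.
Proof.
move=> xc; rewrite /retract; case: ifP => // _.
have := edge_vcr xc; rewrite ler_norml => /andP[v0 v1].
rewrite (min_r v1) (max_r v0); apply: (@crP _ (col i)); rewrite ?ucr_pl ?vcr_pl//.
by case/andP: xc => _ /eqP ->.
Qed.

Let continuous_retract i : continuous (fun p : @glued R G => retract i (fold p)).
Proof.
rewrite /retract; case: (i == center); first exact: fold_continuous.
apply: continuous_pl; apply: continuous_maxf; first exact: continuous_cstf.
apply: continuous_minf; first exact: continuous_cstf.
move=> p; apply: (@continuous_comp _ _ _ (@fold R G) (vcr (col i))).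
  exact: fold_continuous.
exact: vcr_continuous.
Qed.

Let push i (x : 'rV[R]_2) (s : R) : 'rV[R]_2 :=
  (1 - clip (2 * s)) *: x + clip (2 * s) *: retract i x.

Let shrink i (x : 'rV[R]_2) (s : R) : 'rV[R]_2 :=
  (1 - clip (2 * s - 1)) *: retract i x.

Let track i (x : 'rV[R]_2) (s : R) : @glued R G :=
  if s <= 2^-1 then glue i (push i x s) else glue center (shrink i x s).

(* Each outer tile is first flattened onto the side it shares with the central
   tile, which is then shrunk to its midpoint. *)
Let contract (z : @glued R G * R) : @glued R G :=
  track (odflt (tile0 G) [pick i in blk z.1]) (fold z.1) z.2.

Let oct_push i x s : oct x -> oct (push i x s).
Proof.
move=> ox; apply: oct_convex => //; last exact: oct_retract.
by rewrite clip_ge0 clip_le1.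
Qed.

Let oct_shrink i x s : oct x -> oct (shrink i x s).
Proof.
move=> ox; apply: oct_scale; last exact: oct_retract.
by have := clip_ge0 (2 * s - 1); have := clip_le1 (2 * s - 1); lra.
Qed.

(** The retraction fixes the shared side, so a point on it follows the same track from either
    tile. *)
Let track_center i c x s : edge c x -> i != center -> act c i = center ->
  track i x s = track center x s.
Proof.
move=> xc ic ai; have cE : c = col i by apply: col_act; rewrite // ai eq_sym.
rewrite /track /push /shrink retract_edge -?cE// /retract eqxx.
case: ifP => // _; rewrite -scalerDl subrK scale1r -ai.
by rewrite glue_act.
Qed.

Let track_cls i j x s : j \in cls i x -> track j x s = track i x s.
Proof.
case/clsP => [->//|[c xc ->]].
have [->//|ai] := eqVneq (act c i) i.
have [ic|ic] := eqVneq i center.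
  have ac : act c center != center by rewrite -ic.
  by rewrite ic; apply: (track_center s xc ac); rewrite actK.
have E : act c i = center by rewrite (col_act ic ai) col_center.
by rewrite E; apply/esym/(track_center s xc ic E).
Qed.

Let contractE i p s : i \in blk p -> contract (p, s) = track i (fold p) s.
Proof.
move=> ip; rewrite /contract [(p, s).1]/= [(p, s).2]/=.
case: pickP => [j jp|no]; last by exfalso; move: (no i); rewrite ip.
apply: track_cls.
by rewrite -(blk_glue i (oct_fold p)) -(glue_fold ip).
Qed.

Let closed_blk i : closed [set p : @glued R G | i \in blk p].
Proof.
rewrite -openC openE => p /= /negP ip.
apply: filterS (near_blk p) => q qp; apply/negP.
by apply: contra ip; exact: (fintype.subsetP qp).
Qed.

Let continuous_contract : continuous contract.
Proof.
have c2 : continuous (fun z : @glued R G * R => z.2) by move=> z; exact: cvg_snd.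
have c1 : continuous (fun z : @glued R G * R => z.1) by move=> z; exact: cvg_fst.
have cf : continuous (fun z : @glued R G * R => fold z.1).
  move=> z; apply: (@continuous_comp _ _ _ fst (@fold R G)); first exact: c1.
  exact: fold_continuous.
have cr i : continuous (fun z : @glued R G * R => retract i (fold z.1)).
  move=> z; apply: (@continuous_comp _ _ _ fst (fun p => retract i (fold p))).
    exact: c1.
  exact: continuous_retract.
have cd : continuous (fun z : @glued R G * R => 2 * z.2).
  by apply: continuous_mulf => //; exact: continuous_cstf.
have ca : continuous (fun z : @glued R G * R => clip (2 * z.2)).
  exact: continuous_clip.
have cb : continuous (fun z : @glued R G * R => clip (2 * z.2 - 1)).
  by apply: continuous_clip => z; exact: (cvgB (cd z) (cvg_cst _)).
pose C (ib : tile G * bool) : set (@glued R G * R) :=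
  [set z | ib.1 \in blk z.1] `&`
  (if ib.2 then [set z | z.2 <= 2^-1] else [set z | 2^-1 <= z.2]).
apply: (@continuous_paste _ _ _ C).
- case=> i b; apply: closedI.
    apply: (@closed_comp _ _ fst [set p : @glued R G | i \in blk p]).
      by move=> z _; exact: c1.
    exact: closed_blk.
  by case: b; [exact: closed_le_cont|exact: closed_ge_cont].
- case=> p s; have [i ip _] := glueP p.
  by have [ss|/ltW ss] := leP s 2^-1; [exists (i, true)|exists (i, false)].
case=> i b; case: b.
  exists (fun z => glue i (push i (fold z.1) z.2)).
    apply: glue_comp_continuous => [z|z]; last by apply: oct_push; exact: oct_fold.
    apply: cvgD; apply: cvgZ.
    - exact: (cvgB (cvg_cst _) (ca z)).
    - exact: cf.
    - exact: ca.
    - exact: cr.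
  by case=> p s [/= ip ss]; rewrite (contractE s ip) /track ss.
exists (fun z => glue center (shrink i (fold z.1) z.2)).
  apply: glue_comp_continuous => [z|z]; last by apply: oct_shrink; exact: oct_fold.
  apply: cvgZ; first exact: (cvgB (cvg_cst _) (cb z)).
  exact: cr.
case=> p s [/= ip ss]; rewrite (contractE s ip) /track; case: ifP => // ss'.
have -> : s = 2^-1 by apply/le_anti; rewrite ss ss'.
rewrite /push /shrink mulfV// (clip_ge1 (lexx 1)) !subrr scale0r add0r.
rewrite (clip_le0 (lexx 0)) subr0 !scale1r.
have [->//|ic] := eqVneq i center.
(* At half time the point has reached the shared side, where the outer tile may be exchanged for the
   centre. *)
by rewrite -(glue_act i (edge_retract (fold p) ic)) col_center.
Qed.

Lemma star_simply_connected : simply_connected R (@glued R G).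
Proof.
apply: (@contraction_simply_connected _ _ contract (glue center 0)).
- exact: continuous_contract.
- move=> p; have [i ip pE] := glueP p; rewrite (contractE _ ip) /track.
  rewrite invr_ge0 ler0n /push mulr0 (clip_le0 (lexx 0)) subr0 scale1r scale0r.
  by rewrite addr0 -pE.
move=> p; have [i ip _] := glueP p; rewrite (contractE _ ip) /track ifF; last first.
  by apply/negbTE; rewrite -ltNge; lra.
by rewrite /shrink clip_ge1; [rewrite subrr scale0r|lra].
Qed.

End Star.

(** * Doubling along the Neumann sides *)

Section DoubleCover.
Variable G : pattern.

(* Two copies of the glued manifold, joined to each other along the Neumann
   sides; the quotient by the exchange of the copies has those sides as mirrors. *)
Definition dcover_act c (t : tile G * bool) : tile G * bool :=
  if free_neumann c t.1 then (t.1, ~~ t.2) else (act c t.1, t.2).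

Lemma dcover_actK c : involutive (dcover_act c).
Proof.
case=> i b; rewrite /dcover_act /=; have [h|h] := boolP (free_neumann c i).
  by rewrite /= h negbK.
rewrite /= actK; case: ifP => // /andP[/eqP]; rewrite actK => E n.
by move: h n; rewrite /free_neumann -E eqxx => /= /negP.
Qed.

Definition dcover : pattern :=
  Pattern (tile0 G, false) dcover_actK (fun _ _ => false).

Definition exchange (t : tile dcover) : tile dcover := (t.1, ~~ t.2).

Lemma exchange_act c t : exchange (act c t) = act c (exchange t).
Proof. by case: t => i b; rewrite /exchange /= /dcover_act /=; case: ifP. Qed.

Lemma exchange_inj : injective exchange.
Proof. by case=> i b [j d] [-> /negb_inj ->]. Qed.

Context {R : realType}.
Local Notation cover := (glued_manifold R dcover).

Lemma dcover_pure_dirichlet : pure_dirichlet cover.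
Proof.
apply/seteqP; split=> // p /glued_neumannP[i [c [_ _ _]]].
by rewrite /free_neumann andbF.
Qed.

Definition cover_map (p : cover) : cover := glue_map exchange p.

Lemma cover_map_glue t (x : 'rV[R]_2) : oct x ->
  cover_map (glue t x) = glue (exchange t) x.
Proof. exact: glue_map_glue exchange_act _ _. Qed.

Lemma cover_map_continuous : continuous cover_map.
Proof. exact: glue_map_continuous exchange_act. Qed.

Lemma cover_map_involutive : involutive cover_map.
Proof.
move=> p; have [[i b] _ ->] := glueP p; have op := oct_fold p.
by rewrite !cover_map_glue// /exchange /= negbK.
Qed.

Lemma cover_map_isometric c c' : atlas cover c -> atlas cover c' ->
  forall p, dom c p -> dom c' (cover_map p) -> locally_isometric c c' cover_map p.
Proof.
move=> [s _ <-] [s' _ <-] p.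
exact: (glue_map_isometric exchange_act exchange_inj).
Qed.

Lemma octi_scale (x : 'rV[R]_2) (h : R) : 0 < h < 1 -> oct x -> octi (h *: - x + x).
Proof.
case/andP=> h0 h1 /and3P[x0 x1 x2].
have E k : `|crd k (h *: - x + x)| = (1 - h) * `|crd k x|.
  have -> : h *: - x + x = (1 - h) *: x by rewrite scalerN addrC scalerBl scale1r.
  by rewrite crdZ normrM ger0_norm// subr_ge0 ltW.
rewrite /octi !E; have p0 := normr_ge0 (crd false x); have p1 := normr_ge0 (crd true x).
by apply/and3P; split; nra.
Qed.

(** Moving slightly towards the centre of a tile leads from any point into the open octagon, where a
    point lies in a single tile and the exchange of copies displaces it. *)
Lemma cover_map_effective (p : cover) : ~ \forall q \near p, cover_map q = q.
Proof.
move=> H; have [t tp pE] := glueP p; have op := oct_fold p.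
have := near_glue H tp => /nearP2[d d0 Hd].
have [h [h01 Hh]] : exists h : R, 0 < h < 1 /\
    (oct (h *: - fold p + fold p) ->
     cover_map (glue t (h *: - fold p + fold p)) = glue t (h *: - fold p + fold p)).
  apply: (@filter_ex _ (0 : R)^'+); apply: filterI.
    have N : \forall h \near (0 : R)^'+, 0 < h /\ h < 1.
      by apply: filterI; [exact: nbhs_right_gt|exact: nbhs_right_lt].
    by apply: filterS N => h [-> ->].
  exact: (@near_side _ (fold p) (- fold p)
    (fun y => oct y -> cover_map (glue t y) = glue t y) d d0 Hd).
have yi := octi_scale h01 op; have oy := octi_oct yi.
have := Hh oy; rewrite cover_map_glue// => /(congr1 (@blk R dcover)).
rewrite !blk_glue// => E; have := mem_cls (exchange t) (h *: - fold p + fold p).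
rewrite E => /clsP[|[c xc _]]; last by rewrite (edge_octi xc) in yi.
by case: (t) => i [].
Qed.

Definition mirror_orbifold : flatOrbifold R := FlatOrbifold
  dcover_pure_dirichlet cover_map_continuous cover_map_involutive
  cover_map_isometric cover_map_effective.

(** Pullback of functions to both copies; [mean_matrix] is its left inverse, averaging over the
    copies. *)
Definition lift_matrix (t : tile dcover) (i : tile G) : R := (t.1 == i)%:R.

Definition mean_matrix (i : tile G) (t : tile dcover) : R := (t.1 == i)%:R / 2.

Lemma transplant_lift w t : transplant lift_matrix w t = w t.1.
Proof.
rewrite /transplant (bigD1 t.1)//= /lift_matrix eqxx mul1r big1 ?addr0// => j.
by rewrite eq_sym => /negbTE ->; rewrite mul0r.
Qed.

Lemma transplant_mean w i :
  transplant mean_matrix w i = (w (i, true) + w (i, false)) / 2.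
Proof.
rewrite /transplant; under eq_bigr do rewrite [X in w X]surjective_pairing.
rewrite -(pair_bigA _ (fun j b => mean_matrix i (j, b) * w (j, b))) /=.
rewrite (bigD1 i)//= big_bool /mean_matrix /= eqxx big1 => [|j /negbTE E].
  by rewrite addr0 mulr1n; ring.
by rewrite big_bool /= E !mul0r addr0.
Qed.

Lemma mirror_dcover c (w : tile dcover -> R) i b :
  mirror c w (i, b) = if free_neumann c i then w (i, ~~ b)
    else if act c i == i then - w (i, b) else w (act c i, b).
Proof.
rewrite /mirror /= /dcover_act /=; case: (free_neumann c i).
  by rewrite xpair_eqE eqxx; case: b.
by rewrite xpair_eqE eqxx andbT /sgn mulN1r.
Qed.

Lemma mirror_base c (w : tile G -> R) i :
  mirror c w i = if free_neumann c i then w i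
    else if act c i == i then - w i else w (act c i).
Proof.
rewrite /mirror /free_neumann; case: eqP => //= _.
by case: (neu c i); rewrite /sgn ?mul1r ?mulN1r.
Qed.

Lemma lift_intertwines : intertwines lift_matrix.
Proof.
move=> c w [i b]; rewrite transplant_lift mirror_dcover mirror_base !transplant_lift.
by [].
Qed.

Lemma mean_intertwines : intertwines mean_matrix.
Proof.
move=> c w i; rewrite transplant_mean !mirror_dcover mirror_base !transplant_mean.
case: ifP => _; first by rewrite addrC.
by case: ifP => // _; ring.
Qed.

(** Lifting after averaging is the identity on functions invariant under the exchange, which is
    exactly the condition in the orbifold eigenspace. This is why the two maps are compared on
    eigenspaces here and not as inverse matrices. *)
Lemma orbifold_isospectral :
  same_spectrum (orbifold_eigenspace mirror_orbifold)
    (Defs.eigenspace (glued_manifold R G)).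
Proof.
apply: (@same_spectrum_map R _ _ _ _ (transplant_fun mean_matrix)
  (transplant_fun lift_matrix)).
- exact: transplant_fun_combination.
- exact: transplant_fun_combination.
- by move=> l f [ef _]; exact: (transplant_fun_eigen mean_intertwines).
- move=> l f ef; split; first exact: (transplant_fun_eigen lift_intertwines).
  move=> p; have [t _ ->] := glueP p; have op := oct_fold p.
  rewrite [involution _](cover_map_glue t op).
  by rewrite !(transplant_fun_glue lift_intertwines _ ef op) !transplant_lift.
- move=> l f [ef fi]; apply/funext => p; have [[i b] _ ->] := glueP p.
  have op := oct_fold p.
  have ef' := transplant_fun_eigen mean_intertwines ef.
  rewrite (transplant_fun_glue lift_intertwines _ ef' op) transplant_lift.
  rewrite (transplant_fun_glue mean_intertwines _ ef op) transplant_mean.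
  have E : f (glue ((i, true) : tile dcover) (fold p)) =
      f (glue ((i, false) : tile dcover) (fold p)).
    by rewrite -[RHS]fi [involution _](cover_map_glue (i, false) op).
  have H (u : R) : (u + u) / 2 = u by lra.
  by case: b; rewrite [X in X + _]E H// E.
move=> l f ef; apply: (transplantK lift_intertwines mean_intertwines _ ef) => w i.
by rewrite transplant_mean !transplant_lift; lra.
Qed.

End DoubleCover.

(** * The isospectral pair *)

Section Example.

Definition swap (T : eqType) (i j k : T) : T :=
  if k == i then j else if k == j then i else k.

Lemma swapK (T : eqType) (i j : T) : involutive (swap i j).
Proof.
move=> k; rewrite /swap; have [->|ki] := eqVneq k i.
  by rewrite eqxx; case: eqP.
by have [->|kj] := eqVneq k j; rewrite ?eqxx// (negbTE ki) (negbTE kj).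
Qed.

(* The four copies: p is the centre of the star. The sides are colours
   (axis, sign). *)
Local Notation o := (false, false).
Local Notation p := (false, true).
Local Notation q := (true, false).
Local Notation r := (true, true).

Definition star_act (c : bool * bool) : bool * bool -> bool * bool :=
  match c with
  | (false, false) => id
  | (false, true) => swap p q
  | (true, false) => swap p r
  | (true, true) => swap o p
  end.

Lemma star_actK c : involutive (star_act c).
Proof. by case: c => -[] []; [exact: swapK|exact: swapK|exact: swapK|]. Qed.

Definition star : pattern :=
  Pattern p star_actK (fun c i => (c == (false, false)) && ~~ i.1).

(** The colour (false, false) is a translation of the Klein group. Its eigenvalues 1, 1, -1, -1
    match the two Neumann and the two Dirichlet sides which that colour has in the star. *)
Definition lasso_act (c : bool * bool) : bool * bool -> bool * bool :=
  match c with
  | (false, false) => fun i => (i.1, ~~ i.2)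
  | (false, true) => swap p q
  | (true, false) => swap p r
  | (true, true) => swap q r
  end.

Lemma lasso_actK c : involutive (lasso_act c).
Proof.
case: c => -[] []; try exact: swapK.
by case=> i j; rewrite /= negbK.
Qed.

Definition lasso : pattern := Pattern o lasso_actK (fun _ _ => false).

Lemma star_cover_connected (B : tile (dcover star) -> Prop) :
  B (tile0 (dcover star)) -> (forall c i, B i -> B (act c i)) -> forall i, B i.
Proof.
move=> Bp H; have Bo := H (true, true) _ Bp; have Bq := H (false, true) _ Bp.
have Br := H (true, false) _ Bp; have Bp' := H (false, false) _ Bp.
have Bo' := H (true, true) _ Bp'; have Bq' := H (false, true) _ Bp'.
have Br' := H (true, false) _ Bp'.
by case=> -[[] []] [].
Qed.

Lemma lasso_connected (B : tile lasso -> Prop) : B (tile0 lasso) ->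
  (forall c i, B i -> B (act c i)) -> forall i, B i.
Proof.
move=> Bo H; have Bp := H (false, false) _ Bo; have Bq := H (false, true) _ Bp.
have Br := H (true, false) _ Bp.
by case=> -[] [].
Qed.

Context {R : realType}.

(* Up to the signs of its columns, the character table of the Klein group. *)
Definition hadamard (i j : bool * bool) : R :=
  sgn (match j with
       | (false, false) => i.1
       | (false, true) => true
       | (true, false) => i.1 (+) i.2
       | (true, true) => i.2
       end).

Lemma sum4 (F : bool * bool -> R) : \sum_i F i = F o + F p + F q + F r.
Proof.
under eq_bigr do rewrite [X in F X]surjective_pairing.
by rewrite -(pair_bigA _ (fun i j => F (i, j))) /= !big_bool /=; ring.
Qed.

(** For the colour (false, false), the columns are eigenvectors of the translation, with sign + for
    o and p and - for q and r. Any other colour exchanges two tiles and is -1 on the rest, so it is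
    twice the projection onto the line of the sum of these two basis vectors, minus the identity.
    The matrix is orthogonal up to a factor and maps these lines to each other: the constant column
    p plus the column q, r or o is twice the indicator of {p, q}, {p, r} or {q, r}. *)
Lemma hadamard_intertwines : @intertwines R star lasso hadamard.
Proof.
move=> c w i; rewrite /mirror /transplant !sum4.
by case: c i => -[] [] [[] []]; rewrite /= /hadamard /sgn /=; ring.
Qed.

(** The columns are orthogonal of squared length 4, so the inverse is the transpose divided by 4. *)
Lemma hadamard_inv_intertwines :
  @intertwines R lasso star (fun j i => hadamard i j / 4).
Proof.
move=> c w i; rewrite /mirror /transplant !sum4.
by case: c i => -[] [] [[] []]; rewrite /= /hadamard /sgn /=; ring.
Qed.

Lemma star_lasso_isospectral :
  isospectral (glued_manifold R star) (glued_manifold R lasso).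
Proof.
apply: (transplant_isospectral hadamard_intertwines hadamard_inv_intertwines) => w i.
  by rewrite /transplant !sum4; case: i => -[] []; rewrite /hadamard /sgn /=; lra.
by rewrite /transplant !sum4; case: i => -[] []; rewrite /hadamard /sgn /=; lra.
Qed.

Lemma edge_mid c : edge c (pl c (2 : R) 0) /\ `|vcr c (pl c (2 : R) 0)| < 1.
Proof. by split; [apply: edge_pl|rewrite vcr_pl]; rewrite normr0. Qed.

Lemma glued_boundary_neq0 (G : pattern) c (i : tile G) : act c i == i ->
  boundary_of (glued_manifold R G) !=set0.
Proof.
move=> ai; have [ec vc] := edge_mid c; exists (glue i (pl c 2 0)).
have [nc|nc] := boolP (neu c i).
  by case: (@neumann_smooth R (glued_manifold R G) _ (side_neumann ec vc ai nc)).
by case: (@dirichlet_smooth R (glued_manifold R G) _ (side_dirichlet ec vc ai nc)).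
Qed.

End Example.

Theorem mainTheorem6 (R : realType) :
  (exists M1 M2 : flatManifold R,
    [/\ simply_connected R M1,
        dirichlet M1 !=set0 /\ neumann M1 !=set0,
        connected_space M2,
        pure_dirichlet M2 &
        isospectral M1 M2])
  /\
  ~ (forall M M' : flatManifold R, isospectral M M' ->
       (neumann_components M #= neumann_components M')%card)
  /\
  (exists (X : flatOrbifold R) (M : flatManifold R),
    [/\ connected_space (orb_cover X) /\ connected_space M,
        boundary_of (orb_cover X) !=set0 /\ boundary_of M !=set0,
        singular_points X !=set0,
        pure_dirichlet M &
        dirichlet_isospectral X M]).
Proof.
have mid c := edge_mid (R := R) c.
have N1 : neumann (glued_manifold R star) !=set0.
  have [ec vc] := mid (false, false).
  (* The centre p has a Neumann side of colour (false, false); below, the tile r has a Dirichlet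
     side of the same colour. *)
  exists (glue ((false, true) : tile star) (pl (false, false) 2 0)).
  exact: (side_neumann (G := star) ec vc).
have D1 : dirichlet (glued_manifold R star) !=set0.
  have [ec vc] := mid (false, false).
  exists (glue ((true, true) : tile star) (pl (false, false) 2 0)).
  exact: (side_dirichlet (G := star) ec vc).
have N2 : neumann (glued_manifold R lasso) = set0.
  apply/seteqP; split=> // x /glued_neumannP[i [c [_ _ _]]].
  by rewrite /free_neumann andbF.
have C2 : connected_space (glued_manifold R lasso) := glued_connected lasso_connected.
split; [|split].
- exists (glued_manifold R star), (glued_manifold R lasso); split=> //.
    (* The outer tiles q, r and o are joined to the centre p by the colours (false, true), (true,
       false) and (true, true). *)
    apply: (@star_simply_connected R star (false, true)
      (fun i => if i == (true, false) then (false, true)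
                else if i == (true, true) then (true, false) else (true, true))).
      by case=> -[] [].
    by case=> -[] [] [[] []].
  exact: star_lasso_isospectral.
(* The lasso has no Neumann component at all, whereas the star has at least one. *)
- move=> /(_ _ _ (star_lasso_isospectral (R := R))).
  rewrite /neumann_components N2 closure0 image_set0 card_eq0 => /eqP E.
  have [x Nx] := N1; suff : (set0 : set (set (glued_manifold R star)))
    (connected_component (closure (neumann (glued_manifold R star))) x) by [].
  by rewrite -E; exists x => //; exact: subset_closure.
exists (mirror_orbifold star), (glued_manifold R lasso); split=> //.
- by split=> //; exact: (glued_connected star_cover_connected).
- split.
    exact: (@glued_boundary_neq0 R (dcover star) (false, true) ((false, false), false)).
  exact: (@glued_boundary_neq0 R lasso (false, true) (false, false)).
- have [ec _] := mid (false, false).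
  have oc : oct (pl (false, false) (2 : R) 0) by case/andP: ec.
  (* The midpoint of the Neumann side of the centre lies on a mirror: there the two copies of the
     tile are glued to each other, so the exchange fixes it. *)
  exists (glue (((false, true), false) : tile (dcover star)) (pl (false, false) 2 0)).
  apply: etrans (cover_map_glue _ oc) _.
  exact: (glue_act (G := dcover star) ((false, true), false) ec).
move=> l k; apply: iff_trans (orbifold_isospectral star (R := R) l k) _.
exact: star_lasso_isospectral.
Qed.
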